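(* Let $1<r<2$ and let $r'=r/(r-1)$ be the dual exponent. There is a constant $C_r>0$ such that the following holds. For every $\delta>0$ there is a constant $C_{r,\delta}>0$ such that, for every integer $y\ge 1$, setting $N_{r,y}=e^{C_{r,\delta}y^{\delta}}$, for all integers $N>N_{r,y}$ and all finitely supported $f:\mathbb Z\to\mathbb C$, $$\max_{1\le b\le y,\ (b,y)=1}\ \lVert A_{N,y,b}f\rVert_{\ell^{r'}(\mathbb Z)}\le C_r\Big(\frac{y}{N}\Big)^{\frac1r-\frac1{r'}}\lVert f\rVert_{\ell^r(\mathbb Z)}.$$
   Context: $\Lambda$ denotes the von Mangoldt function and $\phi$ the Euler totient function. For integers $y\ge1$, $b$ with $(b,y)=1$, $N\ge y$, and $f:\mathbb Z\to\mathbb C$, the average along primes in the progression $b \bmod y$ is $$A_{N,y,b}f(x)=\frac{\phi(y)}{N}\sum_{\substack{1\le n<N\\ n\equiv b \bmod y}}\Lambda(n)f(x-n),\qquad x\in\mathbb Z.$$ *)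

(* Defs.v *)
From HB Require Import structures.
From mathcomp Require Import all_boot all_order all_algebra.
From mathcomp Require Import all_classical all_reals all_analysis.
From mathcomp Require Import complex.
Set Implicit Arguments. Unset Strict Implicit. Unset Printing Implicit Defensive.
Import Order.TTheory GRing.Theory Num.Theory.
Local Open Scope ring_scope.
Local Open Scope classical_set_scope.

(* von Mangoldt function: Lambda n = log p if n = p^k (p prime, k >= 1),
   and 0 otherwise.  n is a prime power (k >= 1) iff n has exactly one
   prime divisor. *)
Definition vonMangoldt (R : realType) (n : nat) : R :=
  match primes n with
  | [:: p] => ln (p%:R : R)
  | _ => 0
  end.

Definition Aavg (R : realType) (N y b : nat) (f : int -> R[i]) (x : int) : R[i] :=
  ((totient y)%:R / N%:R)%:C%C *
  \sum_(1 <= n < N | (n %% y == b %% y)%N) ((vonMangoldt R n)%:C%C * f (x - Posz n)%R).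

Definition lpnorm (R : realType) (p : R) (f : int -> R[i]) : R :=
  (fine (\esum_(x in [set: int]) ((ComplexField.Normc.normc (f x)) `^ p)%:E)) `^ p^-1.

Definition finitely_supported (R : realType) (f : int -> R[i]) : Prop :=
  finite_set [set x : int | f x != 0].

(* Main.v *)
Require Import Defs.
From HB Require Import structures.
From mathcomp Require Import all_boot all_order all_algebra.
From mathcomp Require Import all_classical all_reals all_analysis.
From mathcomp Require Import complex.
From mathcomp Require Import fintype finset ring lra zify.
Set Implicit Arguments. Unset Strict Implicit. Unset Printing Implicit Defensive.
Import Order.TTheory GRing.Theory Num.Theory.
Local Open Scope ring_scope.

(** Only an upper bound is needed, so no information on the distribution of
    primes in progressions enters.  Up to the few powers of small primes,
    [Lambda n <= log N * S n], where [S] is the square of Selberg's linear form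
    of level [z], a small power of [N], sieving by the primes not dividing [y].
    [S] has an explicit Ramanujan expansion [S = \sum_U w_U c_U], the squarefree
    moduli being products [q_U] over sets [U] of primes, and
    [|w_U| <= 8^|U| / (q_U G)] with [G >= phi(y)/y * log z].

    For sets X, Y of density product [x] in intervals of length [M ~ N / y], the
    moduli [q_U <= Q] are estimated by moments of a truncated divisor function,
    and the moduli [q_U > Q] on l^2, by almost orthogonality of the [c_U]; for
    [Q ~ x^-4] the bilinear form is at most [C M x^s] for every [s < 1].  If
    [x] is smaller than a power of [1 / log N], then [Lambda <= log N] suffices.
    Dyadic level sets interpolate these bounds to functions, splitting the
    integers into classes modulo [y] and blocks of length [M y] makes them
    global, and duality turns the bilinear bound into the norm estimate. *)

(** * Sums of periodic functions *)

(** The estimate loses no power of log N. The normalisation phi(y) / N, the factor log N and 1 / G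
    multiply to O(1 / M): log z is comparable with log N, and the phi(y) in the lower bound for G
    cancels the one in the average.

    A set bound with x^s for every s < 1, short of the ideal s = 1, is affordable because 1/r < 1.
    The exponents 1/r - eta and 1/r + eta both lie in [1/2, 1), and comparing the two gives
    geometric decay away from the critical pairs of level sets.

    The threshold Q ~ x^-4 comes from the l^2 estimate. Each modulus q > Q contributes about 128^|U|
    q^-2, hence at most a constant times q^(-3/2) Q^(-1/4), and Q^(-1/4) <= x is what makes the
    large moduli contribute O(x). The moments of order k need Q^k <= z; this is where x must exceed
    a power of 1 / log N.

    Indexing squarefree moduli by sets of primes turns each coefficient into a product of local
    factors, and divisor bounds into powers c^|U|, which cost less than any power of q_U. *)

Lemma coprime_prod_primes (s : seq nat) p : prime p -> all prime s -> p \notin s ->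
  coprime p (\prod_(r <- s) r).
Proof.
move=> pp sp ps; rewrite coprime_sym big_seq.
apply: (big_ind (fun a => coprime a p)) => [|a b|r rs].
- exact: coprime1n.
- by move=> ca cb; rewrite coprimeMl ca.
have pr := allP sp _ rs; rewrite prime_coprime // dvdn_prime2 //.
by apply: contraNneq ps => <-.
Qed.

Section PeriodicSums.
Variable R : realType.
Implicit Types F H : nat -> R.

Lemma sum_ord_mul F a b :
  \sum_(x < a * b) F x = \sum_(i < a) \sum_(j < b) F (i * b + j)%N.
Proof.
rewrite -(big_mkord xpredT) big_nat_mul big_mkord; apply: eq_bigr => i _.
rewrite -{1}[(i * b)%N]add0n big_addn mulSn addnK big_mkord.
by apply: eq_bigr => j _; rewrite addnC.
Qed.

Lemma periodic_mul F d : (forall x, F (x + d)%N = F x) ->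
  forall i x, F (i * d + x)%N = F x.
Proof.
move=> FE; elim=> [|i IH] x; first by rewrite mul0n.
by rewrite mulSn -addnA addnC FE IH.
Qed.

Lemma periodic_modn F d : (forall x, F (x + d)%N = F x) ->
  forall x, F (x %% d)%N = F x.
Proof. by move=> FE x; rewrite [in RHS](divn_eq x d) periodic_mul. Qed.

Lemma sum_periodic_mul F d : (forall x, F (x + d)%N = F x) ->
  forall a, \sum_(x < a * d) F x = a%:R * \sum_(x < d) F x.
Proof.
move=> FE a; rewrite sum_ord_mul mulr_natl.
rewrite (eq_bigr (fun=> \sum_(x < d) F x)) ?sumr_const ?card_ord // => i _.
by apply: eq_bigr => j _; rewrite periodic_mul.
Qed.

Lemma sum_periodic_le F d (T : nat) : (0 < d)%N ->
  (forall x, F (x + d)%N = F x) -> (forall x, 0 <= F x) ->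
  \sum_(x < T) F x <= (T%:R / d%:R + 1) * \sum_(x < d) F x.
Proof.
move=> d0 FE F0.
have s0 : 0 <= \sum_(x < d) F x by apply: sumr_ge0.
have leT : (T <= (T %/ d).+1 * d)%N by rewrite ltnW // ltn_ceil.
apply: (@le_trans _ _ (\sum_(x < (T %/ d).+1 * d) F x)).
  rewrite -!(big_mkord xpredT) [leRHS](@big_cat_nat _ _ _ T) //=.
  by rewrite lerDl sumr_ge0.
rewrite sum_periodic_mul // ler_wpM2r // -natr1 lerD2r.
rewrite ler_pdivlMr ?ltr0n // -natrM ler_nat leq_trunc_div //.
Qed.

(** Whole periods give the main term; the last, incomplete one has fewer than [d] terms. *)
Lemma sum_periodic_dist F d (T : nat) (C : R) : (0 < d)%N ->
  (forall x, F (x + d)%N = F x) -> (forall x, `|F x| <= C) ->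
  `|\sum_(x < T) F x| <= T%:R / d%:R * `|\sum_(x < d) F x| + d%:R * C.
Proof.
move=> d0 FE FC.
have C0 : 0 <= C by apply: le_trans (FC 0%N).
rewrite -[in leLHS](big_mkord xpredT F) [in leLHS](divn_eq T d).
rewrite (@big_cat_nat _ _ _ (T %/ d * d)%N) ?leq_addr //= big_mkord.
rewrite sum_periodic_mul //; apply: le_trans (ler_normD _ _) _; apply: lerD.
  rewrite normrM ger0_norm ?ler0n // ler_wpM2r //.
  by rewrite ler_pdivlMr ?ltr0n // -natrM ler_nat leq_trunc_div.
apply: le_trans (ler_norm_sum _ _ _) _.
apply: (@le_trans _ _ (\sum_(T %/ d * d <= i < T %/ d * d + T %% d) C)).
  by apply: ler_sum => i _.
rewrite sumr_const_nat addKn -[leLHS]mulr_natl ler_wpM2r // ler_nat ltnW //.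
by rewrite ltn_pmod.
Qed.

Lemma sum_affine F m n j : (0 < m)%N -> coprime m n ->
  (forall x, F (x + m)%N = F x) ->
  \sum_(i < m) F (i * n + j)%N = \sum_(i < m) F i.
Proof.
move=> m0 cop FE; pose h (i : 'I_m) : 'I_m := Ordinal (ltn_pmod (i * n + j) m0).
have hinj : injective h.
  move=> i i' /(congr1 val) /= /eqP; rewrite eqn_modDr => /eqP e; apply/val_inj => /=.
  rewrite -(modn_small (ltn_ord i)) -(modn_small (ltn_ord i')).
  wlog le : i i' e / (i <= i')%N.
    by move=> hw; case/orP: (leq_total i i') => le; [|symmetry]; apply: hw => //; exact: esym.
  apply/eqP; rewrite eq_sym eqn_mod_dvd //.
  rewrite -(@Gauss_dvdl _ _ n) // mulnBl -eqn_mod_dvd ?leq_mul2r ?le ?orbT //.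
  by rewrite e.
rewrite [RHS](reindex_inj hinj) /=; apply: eq_bigr => i _.
by rewrite periodic_modn.
Qed.

(** In x = i n + j the factor [H] sees only [j], while for fixed [j] the numbers i n + j run through
    all residues modulo [m] as [i] varies. *)
Lemma sum_crt F H m n : (0 < m)%N -> coprime m n ->
  (forall x, F (x + m)%N = F x) -> (forall x, H (x + n)%N = H x) ->
  \sum_(x < m * n) F x * H x = (\sum_(x < m) F x) * (\sum_(x < n) H x).
Proof.
move=> m0 cop FE HE.
rewrite (sum_ord_mul (fun x => F x * H x)) exchange_big /= mulr_sumr.
apply: eq_bigr => j _.
under eq_bigr do rewrite (periodic_mul HE).
by rewrite -mulr_suml sum_affine.
Qed.

Lemma sum_prod_crt (s : seq nat) (F : nat -> nat -> R) :
  uniq s -> all prime s -> (forall p x, p \in s -> F p (x + p)%N = F p x) ->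
  \sum_(x < \prod_(p <- s) p) \prod_(p <- s) F p x
    = \prod_(p <- s) \sum_(x < p) F p x.
Proof.
elim: s => [|p s IH] /=; first by rewrite !big_nil big_ord1 big_nil.
move=> /andP[ps us] /andP[pp sp] FE; rewrite !big_cons.
rewrite (eq_bigr (fun x : 'I__ => F p x * \prod_(q <- s) F q x)); last first.
  by move=> x _; rewrite big_cons.
rewrite (@sum_crt (F p) (fun x => \prod_(q <- s) F q x)) ?prime_gt0 //.
- by rewrite IH // => r x rs; apply: FE; rewrite inE rs orbT.
- exact: coprime_prod_primes.
- by move=> x; apply: FE; rewrite mem_head.
- move=> x; apply: eq_big_seq => r rs.
  rewrite (bigD1_seq r) //= mulnC.
  have /periodic_mul E : forall x, F r (x + r)%N = F r x.
    by move=> x'; apply: FE; rewrite inE rs orbT.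
  by rewrite addnC E.
Qed.

End PeriodicSums.

(** * The Selberg sieve over sets of primes *)

Section SetSums.
Variables (R : realType) (T : finType).
Implicit Types A B C U : {set T}.

(** With [B :\: U] prescribed, [B] is recovered from [B :&: U], a subset of [U]. *)
Lemma card_setD_fiber U C : (#|[set B | B :\: U == C]| <= 2 ^ #|U|)%N.
Proof.
rewrite -card_powerset -(@card_in_imset _ _ (fun B => B :&: U)).
  by apply: subset_leq_card; apply/fintype.subsetP => _ /imsetP[B _ ->]; rewrite inE subsetIr.
move=> B B'; rewrite !inE => /eqP BC /eqP B'C e.
by rewrite -(setID B U) -(setID B' U) BC B'C e.
Qed.

Lemma sum_setD_le (P : pred {set T}) (h : {set T} -> R) U :
  (forall A, P A -> P (A :\: U)) -> (forall A, P A -> 0 <= h A) ->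
  \sum_(A | P A) h (A :\: U) <= 2 ^+ #|U| * \sum_(A | P A) h A.
Proof.
move=> PD h0; rewrite (partition_big (fun A => A :\: U) P) //= mulr_sumr.
apply: ler_sum => C PC.
rewrite (eq_bigr (fun=> h C)); last by move=> A /andP[_ /eqP->].
rewrite sumr_const -[leLHS]mulr_natl ler_wpM2r ?h0 //.
rewrite -natrX ler_nat (leq_trans _ (card_setD_fiber U C)) //.
by apply: subset_leq_card; apply/fintype.subsetP => A; rewrite !inE => /andP[].
Qed.

End SetSums.

Section Sieve.
Variables (R : realType) (z y : nat).
Local Notation I := 'I_z.+1.
Implicit Types (A B U : {set I}) (n : nat) (p : I).

(** For p not dividing y the progression b + y t is equidistributed modulo p. Leaving out the other
    primes costs the factor y / phi(y) in the lower bound for the mass. *)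
Definition sieve_primes : {set I} := [set p : I | prime p & ~~ (p %| y)%N].
Local Notation PP := sieve_primes.

Definition qset A : nat := \prod_(p in A) (p : nat).
Definition phiset A : R := \prod_(p in A) (p%:R - 1).
Definition vloc n p : R := p%:R * (p %| n)%N%:R - 1.
Definition vset n A : R := \prod_(p in A) vloc n p.
Definition sieve_dom : {set {set I}} := [set A : {set I} | (A \subset PP) && (qset A <= z)%N].
Local Notation D := sieve_dom.
Definition sieve_mass : R := \sum_(A in D) (phiset A)^-1.
Local Notation G := sieve_mass.

(* Selberg's linear form, written as a truncated Ramanujan expansion:
   [vset n A] is the Ramanujan sum c_q(n) for q = qset A. *)
Definition selberg n : R :=
  G^-1 * \sum_(A in D) (-1) ^+ #|A| / phiset A * vset n A.

(* Local factors of the coefficient of [vset n U] in [vset n A * vset n B]; they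
   come from v_p ^ 2 = (p - 2) v_p + (p - 1). *)
Definition mloc (a b u : bool) (t : R) : R :=
  if u then (if a && b then t - 2 else (a || b)%:R)
  else (if a && b then t - 1 else (~~ (a || b))%:R).
Definition mset A B U : R := \prod_(p : I) mloc (p \in A) (p \in B) (p \in U) p%:R.
Definition wset U : R :=
  G^-1 ^+ 2 * \sum_(A in D) \sum_(B in D)
    (-1) ^+ #|A| / phiset A * ((-1) ^+ #|B| / phiset B) * mset A B U.

Lemma vset_mul n A B : vset n A * vset n B = \sum_U mset A B U * vset n U.
Proof.
rewrite /vset (big_mkcond (mem A)) (big_mkcond (mem B)) -big_split /=.
pose F p := mloc (p \in A) (p \in B) true p%:R * vloc n p.
pose H p := mloc (p \in A) (p \in B) false p%:R.
rewrite (eq_bigr (fun p => F p + H p)); last first.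
  move=> p _; rewrite /F /H /mloc /vloc; case: (p \in A); case: (p \in B) => /=; try ring.
  by case: (_ %| _)%N => /=; ring.
(* Expanding the product of the binomials [F p + H p] sums over the set [J] of primes at which the
   term with [vloc] is chosen; this set is the [U] of the statement. *)
rewrite bigA_distr; apply: eq_big => // J _.
rewrite /mset [X in _ * X]big_mkcond -big_split /=; apply: eq_bigr => p _.
by rewrite /F /H; case: (p \in J); rewrite ?mulr1.
Qed.

Lemma selberg_sqr n : selberg n ^+ 2 = \sum_U wset U * vset n U.
Proof.
rewrite /selberg exprMn /wset.
under [RHS]eq_bigr do rewrite -mulrA mulr_suml.
rewrite -mulr_sumr; congr (_ * _).
rewrite expr2 mulr_suml exchange_big /=; apply: eq_bigr => A _.
under [RHS]eq_bigr do rewrite mulr_suml.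
rewrite mulr_sumr exchange_big /=; apply: eq_bigr => B _.
rewrite mulrACA vset_mul mulr_sumr; apply: eq_bigr => U _.
by rewrite [LHS]mulrA.
Qed.

Lemma in_sieve_prime A p : A \subset PP -> p \in A -> prime p.
Proof. by move=> /fintype.subsetP AP /AP; rewrite inE => /andP[]. Qed.

Lemma in_sieve_ge A p : A \subset PP -> p \in A -> 2 <= p%:R :> R.
Proof. by move=> AP pA; rewrite ler_nat prime_gt1 // (in_sieve_prime AP). Qed.

Lemma phiset_ge1 A : A \subset PP -> 1 <= phiset A.
Proof.
move=> AP; rewrite /phiset; apply: (big_ind (fun x : R => 1 <= x)) => //.
  by move=> a b a1 b1; rewrite -[1]mulr1 ler_pM.
by move=> p /(in_sieve_ge AP); lra.
Qed.

Lemma phiset_gt0 A : A \subset PP -> 0 < phiset A.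
Proof. by move/phiset_ge1; apply: lt_le_trans. Qed.

Lemma qset_gt0 A : A \subset PP -> (0 < qset A)%N.
Proof. by move=> AP; apply: prodn_cond_gt0 => p /(in_sieve_prime AP)/prime_gt0. Qed.

Lemma qset0 : qset set0 = 1%N. Proof. by rewrite /qset big_set0. Qed.

Lemma qsetUD A B : qset (A :|: B) = (qset A * qset (B :\: A))%N.
Proof.
by rewrite /qset (big_setID A) /= setUK setDUl setDv set0U.
Qed.

Lemma qset_subset A B : B \subset PP -> A \subset B -> (qset A <= qset B)%N.
Proof.
move=> BP AB; have /setUidPr <- := AB.
rewrite qsetUD leq_pmulr // qset_gt0 //.
by apply: subset_trans BP; apply: subsetDl.
Qed.

Lemma qsetU_le A B : A \subset PP -> B \subset PP ->
  (qset (A :|: B) <= qset A * qset B)%N.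
Proof. by move=> AP BP; rewrite qsetUD leq_mul2l qset_subset ?orbT ?subsetDl. Qed.

Lemma mset_neq0 A B U : mset A B U != 0 -> U \subset A :|: B.
Proof.
move=> m0; apply/fintype.subsetP => p pU; apply: contraNT m0; rewrite inE => /norP[pA pB].
by rewrite /mset (bigD1 p) //= pU (negPf pA) (negPf pB) mul0r.
Qed.

(** A nonzero coefficient needs A and B in the domain with U inside their union, whose modulus is at
    most q_A q_B. *)
Lemma wset_supp U : wset U != 0 -> (U \subset PP) && (qset U <= z ^ 2)%N.
Proof.
move=> wU; have [A [B [/andP[AP Az] /andP[BP Bz] /mset_neq0 UAB]]] :
    exists A B, [/\ (A \subset PP) && (qset A <= z)%N,
      (B \subset PP) && (qset B <= z)%N & mset A B U != 0].
  apply: contrapT => nex; move/negP: wU; apply; apply/eqP.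
  rewrite /wset big1 ?mulr0 // => A; rewrite inE => AD.
  rewrite big1 // => B; rewrite inE => BD.
  case: (eqVneq (mset A B U) 0) => [->|m0]; first by rewrite mulr0.
  by case: nex; exists A, B.
have ABP : A :|: B \subset PP by rewrite subUset AP.
rewrite (subset_trans UAB ABP) /=.
apply: leq_trans (qset_subset ABP UAB) _; apply: leq_trans (qsetU_le AP BP) _.
by rewrite -mulnn leq_mul.
Qed.

(** Prime by prime. Outside U, a prime in exactly one of A, B kills the product, and a prime in both
    leaves (p - 1) / (p - 1)^2. Inside U the factor is (p - 2) / (p - 1)^2, 1 / (p - 1) or 0, never
    more than 1 / (p - 1). *)
Lemma mset_bound A B U : A \subset PP -> B \subset PP -> U \subset PP ->
  0 <= mset A B U / (phiset A * phiset B)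
    <= (A :\: U == B :\: U)%:R * ((phiset U)^-1 * (phiset (A :\: U))^-1).
Proof.
move=> AP BP UP.
have R0 : 0 <= ((phiset U)^-1 * (phiset (A :\: U))^-1).
  rewrite mulr_ge0 // invr_ge0 ltW // phiset_gt0 //.
  by apply: subset_trans AP; apply: subsetDl.
have [e|ne] := eqVneq (A :\: U) (B :\: U); last first.
  suff -> : mset A B U = 0 by rewrite !mul0r lexx.
  apply: contraNeq ne => m0; apply/eqP/setP => p; rewrite !inE.
  case: (boolP (p \in U)) => //= pU; apply: contraNeq m0 => ne.
  rewrite /mset (bigD1 p) //= (negPf pU) /mloc.
  by case: (p \in A) (p \in B) ne => [] [] //=; rewrite mul0r.
rewrite mul1r.
have phiE A' : (phiset A')^-1 = \prod_(p : I) (if p \in A' then (p%:R - 1)^-1 else 1).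
  by rewrite /phiset -prodfV big_mkcond.
rewrite invfM !phiE -!big_split /=.
have loc p : 0 <= mloc (p \in A) (p \in B) (p \in U) p%:R *
     ((if p \in A then (p%:R - 1)^-1 else 1) * (if p \in B then (p%:R - 1)^-1 else 1))
   <= (if p \in U then (p%:R - 1)^-1 else 1) *
      (if p \in A :\: U then (p%:R - 1)^-1 else 1 : R).
  { have/setP/(_ p) := e; rewrite !inE /mloc.
  have := @in_sieve_ge A p AP; have := @in_sieve_ge B p BP; have := @in_sieve_ge U p UP.
  case: (p \in U); case: (p \in A); case: (p \in B) => //= h1 h2 h3 _;
   rewrite ?mul0r ?mul1r ?mulr1 ?lexx ?ler01 //.
  all: have p2 : 2 <= p%:R :> R by [apply: h1|apply: h2|apply: h3].
  all: have i0 : 0 < (p%:R - 1)^-1 :> R by rewrite invr_gt0; lra.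
  all: have i1 : (p%:R - 1) * (p%:R - 1)^-1 = 1 :> R by rewrite divff //; lra.
  all: try by rewrite ltW //=.
  - apply/andP; split; first by rewrite mulr_ge0 ?mulr_ge0 ?(ltW i0) //; lra.
    rewrite mulrA ger_pMl //; nra.
  - by rewrite mulrA i1 mul1r ltW //= lexx. }
apply/andP; split; first by apply: prodr_ge0 => p _; case/andP: (loc p).
by apply: ler_prod => p _; apply: loc.
Qed.

Hypothesis z0 : (0 < z)%N.

Lemma sieve_mass_gt0 : 0 < G.
Proof.
rewrite /G (bigD1 set0) /=; last by rewrite inE sub0set qset0.
apply: ltr_wpDr; last by rewrite invr_gt0 phiset_gt0 ?sub0set.
apply: sumr_ge0 => A /andP[]; rewrite inE => /andP[AP _] _.
by rewrite invr_ge0 ltW // phiset_gt0.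
Qed.

(** Only pairs with [A :\: U = B :\: U] survive. Each A meets at most 2^|U| such B, and replacing
    [A :\: U] by A in the sum over A costs another 2^|U| and leaves one factor G. *)
Lemma wset_bound_phi U : U \subset PP -> `|wset U| <= 4 ^+ #|U| / (phiset U * G).
Proof.
move=> UP; have G0 := sieve_mass_gt0; have pU0 := phiset_gt0 UP.
have DP A : A \in D -> A \subset PP by rewrite inE => /andP[].
rewrite /wset normrM ger0_norm ?exprn_ge0 ?invr_ge0 ?(ltW G0) //.
apply: (@le_trans _ _ (G^-1 ^+ 2 * ((phiset U)^-1 * (2 ^+ #|U| * (2 ^+ #|U| * G))))); last first.
  rewrite invfM mulrA [4](_ : _ = 2 * 2); last by ring.
  rewrite exprMn le_eqVlt; apply/orP; left; apply/eqP.
  by rewrite expr2; field; rewrite !gt_eqF.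
rewrite ler_wpM2l ?exprn_ge0 ?invr_ge0 ?(ltW G0) //.
apply: (@le_trans _ _ (\sum_(A in D) \sum_(B in D)
   (A :\: U == B :\: U)%:R * ((phiset U)^-1 * (phiset (A :\: U))^-1))).
  apply: le_trans (ler_norm_sum _ _ _) _; apply: ler_sum => A AD.
  apply: le_trans (ler_norm_sum _ _ _) _; apply: ler_sum => B BD.
  have /andP[m0 mb] := mset_bound (DP _ AD) (DP _ BD) UP.
  apply: le_trans mb; rewrite -(ger0_norm m0) le_eqVlt; apply/orP; left; apply/eqP.
  rewrite [mset A B U / _]mulrC invfM !normrM !normrX !normrN1 !expr1n !mul1r //.
apply: (@le_trans _ _ (\sum_(A in D) (phiset U)^-1 * (2 ^+ #|U| * (phiset (A :\: U))^-1))).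
  apply: ler_sum => A AD.
  have ADP : A :\: U \subset PP by apply: subset_trans (DP _ AD); apply: subsetDl.
  rewrite -mulr_suml mulrCA ler_wpM2l ?invr_ge0 ?(ltW pU0) // ler_wpM2r //.
    by rewrite invr_ge0 ltW // phiset_gt0.
  rewrite -natr_sum -natrX ler_nat.
  apply: leq_trans (card_setD_fiber U (A :\: U)).
  rewrite -big_mkcondr /= sum1_card; apply: subset_leq_card.
  by apply/fintype.subsetP => B; rewrite !inE => /andP[_ /eqP->].
rewrite -mulr_sumr ler_wpM2l ?invr_ge0 ?(ltW pU0) // -mulr_sumr ler_wpM2l ?exprn_ge0 //.
apply: (sum_setD_le (h := fun A => (phiset A)^-1)) => A AD.
  have AP := DP _ AD; rewrite inE (subset_trans (subsetDl _ _) AP) /=.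
  move: AD; rewrite inE => /andP[_]; apply: leq_trans.
  by rewrite qset_subset // subsetDl.
by rewrite invr_ge0 ltW // phiset_gt0 // DP.
Qed.

Lemma phiset_ge A : A \subset PP -> (qset A)%:R <= 2 ^+ #|A| * phiset A.
Proof.
move=> AP; rewrite /phiset /qset natr_prod -prodr_const -big_split /=.
apply: ler_prod => p pA; rewrite ler0n /=; have := in_sieve_ge AP pA; lra.
Qed.

(** The base 8 is 4 times the 2 lost in p <= 2 (p - 1). *)
Lemma wset_bound U : U \subset PP -> `|wset U| <= 8 ^+ #|U| / ((qset U)%:R * G).
Proof.
move=> UP; apply: le_trans (wset_bound_phi UP) _.
have G0 := sieve_mass_gt0; have pU0 := phiset_gt0 UP.
have q0 : 0 < (qset U)%:R :> R by rewrite ltr0n qset_gt0.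
rewrite ler_pdivrMr ?mulr_gt0 // mulrAC ler_pdivlMr ?mulr_gt0 //.
rewrite [8](_ : _ = 4 * 2); last by ring.
rewrite exprMn -!mulrA ler_wpM2l ?exprn_ge0 // !mulrA ler_pM2r //.
exact: phiset_ge.
Qed.

(** Every local factor is -1, so all signs cancel and the sum equals the normalising mass. *)
Lemma selberg_rough n : (forall p, p \in PP -> ~~ (p %| n)%N) -> selberg n = 1.
Proof.
move=> hn; rewrite /selberg (eq_bigr (fun A => (phiset A)^-1)).
  by rewrite mulVf // gt_eqF // sieve_mass_gt0.
move=> A; rewrite inE => /andP[/fintype.subsetP AP _].
rewrite /vset (eq_bigr (fun=> -1)) ?prodr_const.
  by rewrite mulrAC -exprMn mulrNN mulr1 expr1n mul1r.
by move=> p /AP/hn /negPf h; rewrite /vloc h mulr0 sub0r.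
Qed.

End Sieve.

(** * The mass of the sieve *)

Section InjectionSums.
Variable R : realType.

Lemma sum_inj_le (I J : finType) (P : pred I) (Q : pred J) (h : I -> J)
    (F : I -> R) (H : J -> R) :
  {in P &, injective h} -> (forall i, P i -> Q (h i)) ->
  (forall i, P i -> F i <= H (h i)) -> (forall j, Q j -> 0 <= H j) ->
  \sum_(i | P i) F i <= \sum_(j | Q j) H j.
Proof.
move=> hinj PQ FH H0; apply: (@le_trans _ _ (\sum_(i | P i) H (h i))).
  exact: ler_sum.
rewrite -(big_imset H hinj) /= big_mkcond [leRHS]big_mkcond.
apply: ler_sum => j _; case: ifPn => [/imsetP[i Pi ->]|_].
  by rewrite PQ.
by case: ifP => // /H0.
Qed.

End InjectionSums.

Section PrimeProducts.

Lemma ltn_div_ord z (n : 'I_z) d : (n %/ d < z)%N.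
Proof. exact: leq_ltn_trans (leq_div _ _) (ltn_ord n). Qed.

Lemma dvdn_prod_primes (s : seq nat) n : uniq s -> all prime s ->
  (\prod_(p <- s) p %| n)%N = all (fun p => p %| n)%N s.
Proof.
elim: s => [|p s IH] /=; first by rewrite big_nil dvd1n.
move=> /andP[ps us] /andP[pp sp]; rewrite big_cons Gauss_dvd ?IH //.
exact: coprime_prod_primes.
Qed.

Variable R : realType.

(* Splitting off the multiples of the first prime p gives T <= T' + T / p. *)
Lemma smooth_harmonic_le (s : seq nat) z : all prime s ->
  \sum_(n < z.+1 | (0 < n)%N && all (mem s) (primes n)) (n%:R : R)^-1
    <= \prod_(p <- s) (p%:R / (p%:R - 1)).
Proof.
elim: s => [_|p s IH /= /andP[pp sp]].
  rewrite big_nil (@le_trans _ _ (\sum_(n < z.+1 | n == inord 1) 1)) //.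
    rewrite big_mkcond [leRHS]big_mkcond; apply: ler_sum => n _.
    case: ifP => [/andP[n0 n1]|_]; last by case: ifP.
    have n1' : (n : nat) = 1%N.
      apply/eqP; rewrite eqn_leq n0 andbT leqNgt; apply/negP => n2.
      move: n1; have := pdiv_prime n2; have := pdiv_dvd n => d p0.
      by move/allP/(_ (pdiv n)); rewrite mem_primes p0 d n0 => /(_ isT).
    have z0 : (0 < z)%N by move: (ltn_ord n); rewrite n1'.
    rewrite ifT ?n1' ?invr1 //; apply/eqP/val_inj => /=; rewrite inordK //.
  by rewrite big_pred1_eq.
set P := fun n : nat => _.
have p1 : 1 < p%:R :> R by rewrite ltr1n prime_gt1.
rewrite big_cons; set T := (X in X <= _).
suff : T <= \prod_(r <- s) (r%:R / (r%:R - 1)) + T / p%:R.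
  move=> h; rewrite -(@ler_pM2l _ ((p%:R - 1) / p%:R)); last first.
    by rewrite divr_gt0; lra.
  rewrite mulrA [_ / _ * (_ / _)](_ : _ = 1); last by field; apply/andP; split; lra.
  rewrite mul1r; apply: (@le_trans _ _ (T - T / p%:R)); last by lra.
  by rewrite mulrBl divff ?mulrBl ?mul1r ?[_^-1 * T]mulrC //; lra.
rewrite {1}/T (bigID (fun n : 'I__ => p %| n)%N) /= addrC lerD //.
  apply: le_trans (IH sp); rewrite big_mkcond [leRHS]big_mkcond.
  apply: ler_sum => n _; case: ifP => [/andP[/andP[n0 /allP Pn] pn]|_]; last first.
    by case: ifP => // _; rewrite invr_ge0.
  rewrite n0 /= ifT //; apply/allP => r rn; have := Pn _ rn.
  rewrite inE => /orP[/eqP rp|//]; move: rn pn; rewrite rp mem_primes.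
  by case/and3P => _ _ ->.
rewrite /T mulr_suml.
apply: (sum_inj_le (h := fun n : 'I_z.+1 => inord (n %/ p) : 'I_z.+1)).
- move=> n n' /andP[_ pn] /andP[_ pn'] /(congr1 val) /=.
  rewrite !inordK ?ltn_div_ord //.
  move=> e; apply/val_inj => /=.
  by rewrite -(divnK pn) -(divnK pn') e.
- move=> n /andP[/andP[n0 /allP Pn] pn].
  rewrite inordK ?ltn_div_ord //.
  rewrite divn_gt0 ?prime_gt0 // dvdn_leq //=; apply/allP => r.
  rewrite mem_primes => /and3P[r1 r2 r3]; apply: Pn; rewrite mem_primes r1 n0 /=.
  by rewrite -(divnK pn) dvdn_mulr.
- move=> n /andP[_ pn].
  rewrite inordK ?ltn_div_ord //.
  by rewrite -invfM -natrM divnK.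
by move=> n _; rewrite divr_ge0 // invr_ge0.
Qed.

Lemma totient_ratio y : (0 < y)%N ->
  \prod_(p <- primes y) (p%:R / (p%:R - 1)) = y%:R / (totient y)%:R :> R.
Proof.
move=> y0; rewrite totientE // {2}(prod_prime_decomp y0) prime_decompE big_map.
rewrite !natr_prod -prodf_div; apply: eq_big_seq => p.
rewrite mem_primes => /and3P[pp _ py].
have l0 : (0 < logn p y)%N by rewrite logn_gt0 mem_primes pp y0.
have p1 : 1 < p%:R :> R by rewrite ltr1n prime_gt1.
rewrite /= -{1}(prednK l0) expnS !natrM -[p.-1]subn1 natrB ?prime_gt0 //.
rewrite natrX invfM mulrACA divff ?mulr1 // expf_neq0 //; lra.
Qed.

End PrimeProducts.

Section Harmonic.
Variable R : realType.

Lemma ln_le_harmonic z : ln (z.+1%:R : R) <= \sum_(n < z.+1 | (0 < n)%N) (n%:R)^-1.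
Proof.
elim: z => [|z IH]; first by rewrite ln1 sumr_ge0 // => n _; rewrite invr_ge0.
rewrite big_mkcond big_ord_recr -big_mkcond /=.
have -> : z.+2%:R = z.+1%:R * (1 + z.+1%:R^-1) :> R.
  by rewrite mulrDr mulr1 divff ?pnatr_eq0 // -natr1.
rewrite lnM ?posrE ?ltr0n ?addr_gt0 ?invr_gt0 ?ltr0n //.
by rewrite lerD // le_ln1Dx // (lt_trans (@ltrN10 R)) // invr_gt0.
Qed.

Lemma harmonic_le_ln z : \sum_(n < z.+2 | (0 < n)%N) (n%:R : R)^-1 <= 1 + ln z.+1%:R.
Proof.
elim: z => [|z IH].
  by rewrite ln1 addr0 big_mkcond !big_ord_recr big_ord0 /= invr1 !add0r.
rewrite big_mkcond big_ord_recr -big_mkcond /=.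
have e : z.+1%:R = z.+2%:R * (1 - z.+2%:R^-1) :> R.
  by rewrite mulrBr mulr1 divff ?pnatr_eq0 // -[z.+2%:R]natr1 addrK.
have i1 : (z.+2%:R)^-1 < 1 :> R by rewrite invf_lt1 ?ltr0n // ltr1n.
have : ln (z.+1%:R : R) <= ln z.+2%:R - z.+2%:R^-1.
  rewrite e lnM ?posrE ?ltr0n ?subr_gt0 // lerD2l.
  by rewrite -[X in ln X]/(1 + - _) le_ln1Dx // ltrN2.
move=> h; apply: le_trans (lerD IH (lexx _)) _.
by rewrite -addrA lerD2l -lerBrDr.
Qed.

Lemma ln_le_subr1 (x : R) : 0 < x -> ln x <= x - 1.
Proof. by move=> x0; rewrite -[X in ln X](subrKC 1) le_ln1Dx // ltrBrDr addNr. Qed.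

(** The inequality ln t <= t - 1 at t = z^e gives ln z <= z^e / e. *)
Lemma harmonic_le_pow (e : R) : 0 < e -> exists2 C : R, 0 < C &
  forall z, (0 < z)%N -> \sum_(n < z.+1 | (0 < n)%N) (n%:R : R)^-1 <= C * z%:R `^ e.
Proof.
move=> e0; exists (1 + e^-1); first by rewrite addr_gt0 // invr_gt0.
case=> // z _; apply: le_trans (harmonic_le_ln z) _.
have : (z.+1%:R : R) `^ 0 <= z.+1%:R `^ e by rewrite ler_powR ?ler1n // ltW.
rewrite powRr0 => p1.
rewrite mulrDl mul1r lerD // -(@ler_pM2l _ e) // mulrA divff ?gt_eqF // mul1r.
rewrite -ln_powR; apply: le_trans (ln_le_subr1 (lt_le_trans ltr01 p1)) _.
by rewrite gerBl.
Qed.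

End Harmonic.

Section SieveMass.
Variables (R : realType) (z y : nat).
Local Notation PP := (sieve_primes z y).
Local Notation I := 'I_z.+1.
Implicit Types A B : {set I}.

Lemma qsetE A : qset A = \prod_(p <- [seq val p | p <- enum A]) p.
Proof. by rewrite big_map big_enum. Qed.

Lemma enum_prime A : A \subset PP -> all prime [seq val p | p <- enum A].
Proof.
move=> AP; apply/allP => _ /mapP[p + ->]; rewrite mem_enum; exact: in_sieve_prime AP.
Qed.

Lemma enum_val_uniq A : uniq [seq val p | p <- enum A].
Proof. by rewrite map_inj_uniq ?enum_uniq //; apply: val_inj. Qed.

Lemma qset_dvdP A n : A \subset PP ->
  reflect (forall p, p \in A -> (p %| n)%N) (qset A %| n)%N.
Proof.
move=> AP; rewrite qsetE dvdn_prod_primes ?enum_val_uniq ?enum_prime //.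
apply: (iffP allP) => h p.
  by move=> pA; apply: h; apply: map_f; rewrite mem_enum.
by case/mapP => r + ->; rewrite mem_enum => /h.
Qed.

Lemma qset_inj : {in [pred A : {set I} | A \subset PP] &, injective (@qset z)}.
Proof.
move=> A B AP BP e.
have sub A' B' : A' \subset PP -> B' \subset PP -> qset A' = qset B' -> A' \subset B'.
  move=> A'P B'P e'; apply/subsetP => p pA.
  have : (p %| qset B')%N by rewrite -e' /qset (bigD1 p) //= dvdn_mulr.
  have pp := in_sieve_prime A'P pA.
  rewrite /qset Euclid_dvd_prod // big_has_cond => /hasP[r _ /andP[rB]].
  by rewrite dvdn_prime2 ?(in_sieve_prime B'P rB) // => /eqP/val_inj ->.
by apply/eqP; rewrite eqEsubset (sub A B AP BP e) (sub B A BP AP (esym e)).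
Qed.

Lemma sum_qset_harmonic (Q : nat) :
  \sum_(A : {set I} | (A \subset PP) && (qset A <= Q)%N) ((qset A)%:R : R)^-1
    <= \sum_(n < Q.+1 | (0 < n)%N) (n%:R)^-1.
Proof.
apply: (sum_inj_le (h := fun A => inord (qset A) : 'I_Q.+1)).
- move=> A B /andP[AP AQ] /andP[BP BQ] /(congr1 val) /=.
  by rewrite !inordK //; apply: qset_inj.
- by move=> A /andP[AP AQ]; rewrite inordK // (qset_gt0 AP).
- by move=> A /andP[AP AQ]; rewrite inordK.
by move=> n _; rewrite invr_ge0.
Qed.

(** The integers n <= z are grouped by the set A of sieve primes dividing them. Then n = q_A m,
    where every prime of m lies in A or divides y, so the sum of 1 / m is at most the Euler product
    over these primes. Its part over A turns 1 / q_A into 1 / [phiset A], and its part over the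
    primes of y is y / phi(y). *)
Lemma sieve_mass_ge : (0 < y)%N ->
  ln z.+1%:R <= y%:R / (totient y)%:R * sieve_mass R z y.
Proof.
move=> y0; apply: le_trans (ln_le_harmonic R z) _.
pose An (n : I) : {set I} := [set p in PP | p %| n]%N.
have AnP n : An n \subset PP by apply/subsetP => p; rewrite inE => /andP[].
have Andvd n : (qset (An n) %| n)%N.
  by apply/qset_dvdP => // p; rewrite inE => /andP[].
rewrite (partition_big An (fun A => A \in sieve_dom z y)) /=; last first.
  move=> n n0; rewrite inE AnP /=; apply: leq_trans (dvdn_leq n0 (Andvd n)) _.
  by rewrite -ltnS.
rewrite mulr_sumr; apply: ler_sum => A; rewrite inE => /andP[AP Az].
pose s := [seq val p | p <- enum A] ++ primes y.
have sp : all prime s.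
  rewrite all_cat enum_prime //=; apply/allP => p; rewrite mem_primes.
  by case/and3P.
have q0 := qset_gt0 AP.
apply: (@le_trans _ _ (\sum_(m < z.+1 | (0 < m)%N && all (mem s) (primes m))
    (qset A)%:R^-1 * (m%:R : R)^-1)).
  have dA (n : I) : An n == A -> (qset A %| n)%N by move=> /eqP <-.
  apply: (sum_inj_le (h := fun n : I => inord (n %/ qset A) : I)).
  - move=> n n' /andP[_ /dA dn] /andP[_ /dA dn'] /(congr1 val) /=.
    rewrite !inordK ?ltn_div_ord //.
    by move=> e; apply/val_inj => /=; rewrite -(divnK dn) -(divnK dn') e.
  - move=> n /andP[n0 An1]; have dn := dA _ An1.
    rewrite inordK ?ltn_div_ord //.
    rewrite divn_gt0 // dvdn_leq //=; apply/allP => r.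
    rewrite mem_primes => /and3P[r1 r2 r3].
    have rn : (r %| n)%N by rewrite -(divnK dn) dvdn_mulr.
    rewrite /= mem_cat mem_primes r1 y0 /=; case: (boolP (r %| y)%N) => [_|ry].
      by rewrite orbT.
    rewrite orbF; apply/mapP.
    have rz : (r < z.+1)%N by apply: leq_ltn_trans (ltn_ord n); apply: dvdn_leq.
    exists (Ordinal rz) => //; rewrite mem_enum -(eqP An1) !inE /=.
    by rewrite r1 ry rn.
  - move=> n /andP[n0 An1]; have dn := dA _ An1.
    rewrite inordK ?ltn_div_ord //.
    by rewrite -invfM -natrM mulnC divnK.
  by move=> m _; rewrite mulr_ge0 // invr_ge0.
rewrite -mulr_sumr.
apply: le_trans (ler_wpM2l _ (smooth_harmonic_le R z sp)) _; first by rewrite invr_ge0.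
rewrite /s big_cat /= totient_ratio // big_map big_enum /= mulrA mulrC ler_wpM2l //.
rewrite /phiset /qset natr_prod -!prodfV -big_split /= le_eqVlt; apply/orP; left.
apply/eqP; apply: eq_bigr => p pA; have := in_sieve_ge R AP pA => p2.
by field; apply/andP; split; lra.
Qed.

End SieveMass.

(** * Moduli at most Q *)

Section PrimeSetBounds.
Variable R : realType.

Lemma powR_ge1 (x e : R) : 1 <= x -> 0 <= e -> 1 <= x `^ e.
Proof. by move=> x1 e0; rewrite -[leLHS](powRr0 x) ler_powR. Qed.

Lemma powR_expr (x e : R) (n : nat) : 0 <= x -> (x ^+ n) `^ e = (x `^ e) ^+ n.
Proof.
move=> x0; elim: n => [|n IH]; first by rewrite !expr0 powR1.
by rewrite !exprS powRM ?exprn_ge0 // IH.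
Qed.

Lemma powR_prod (T : Type) (s : seq T) (P : pred T) (F : T -> R) (e : R) :
  (forall i, P i -> 0 <= F i) ->
  (\prod_(i <- s | P i) F i) `^ e = \prod_(i <- s | P i) F i `^ e.
Proof.
move=> F0; elim: s => [|i s IH]; first by rewrite !big_nil powR1.
rewrite !big_cons; case: ifP => // Pi.
by rewrite powRM ?IH ?F0 ?prodr_ge0 // => j; apply: F0.
Qed.

(* Only the boundedly many primes p with p ^ e < c can contribute a factor
   c > p ^ e. *)
Lemma pow_card_le (c e : R) : 1 <= c -> 0 < e -> exists2 C : R, 0 < C &
  forall z y (A : {set 'I_z.+1}), A \subset sieve_primes z y ->
    c ^+ #|A| <= C * (qset A)%:R `^ e.
Proof.
move=> c1 e0; have c0 : 0 < c by apply: lt_le_trans c1.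
pose p0 := (Num.truncn (c `^ e^-1)).+1.
have p0P p : (p0 <= p)%N -> c <= p%:R `^ e.
  move=> pp; have : c `^ e^-1 <= p%:R.
    by apply: le_trans (ltW (truncnS_gt _)) _; rewrite ler_nat.
  have n1 : c `^ e^-1 \is Num.nneg by rewrite nnegrE powR_ge0.
  have n2 : (p%:R : R) \is Num.nneg by rewrite nnegrE.
  move=> h; have := ge0_ler_powR (ltW e0) n1 n2 h.
  by rewrite -powRrM mulVf ?gt_eqF // powRr1 // ltW.
exists (c ^+ p0) => [|z y A AP]; first by rewrite exprn_gt0.
rewrite /qset natr_prod powR_prod // -prodr_const.
apply: (@le_trans _ _ (\prod_(p in A) ((if (p < p0)%N then c else 1) * p%:R `^ e))).
  apply: ler_prod => p pA; rewrite ltW //=.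
  have p1 : 1 <= p%:R `^ e.
    by rewrite powR_ge1 ?(ltW e0) // ler1n prime_gt0 // (in_sieve_prime AP pA).
  case: ifPn => [_|]; first by rewrite ler_peMr // ltW.
  by rewrite -leqNgt mul1r => /p0P.
rewrite big_split /= ler_wpM2r //; first by apply: prodr_ge0 => p _; exact: powR_ge0.
rewrite -big_mkcondr /= prodr_const; apply: ler_weXn2l => //.
rewrite -[leqRHS]card_ord; pose h (p : 'I_z.+1) : 'I_p0 := inord p.
rewrite -(@card_in_imset _ _ h) ?max_card //.
move=> p q /andP[_ pp] /andP[_ qp] /(congr1 val) /=.
by rewrite !inordK // => /val_inj.
Qed.

End PrimeSetBounds.

Section PrimeSetSums.
Variables (R : realType) (z y : nat).
Local Notation PP := (sieve_primes z y).
Local Notation I := 'I_z.+1.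
Implicit Types A B U : {set I}.

Lemma sum_prod_set A (F : nat -> nat -> R) : A \subset PP ->
  (forall (p : I) x, p \in A -> F p (x + p)%N = F p x) ->
  \sum_(x < qset A) \prod_(p in A) F p x = \prod_(p in A) \sum_(x < p) F p x.
Proof.
move=> AP FE; rewrite -(big_mkord xpredT (fun x => \prod_(p in A) F p x)) qsetE big_mkord.
rewrite (eq_bigr (fun x : 'I__ => \prod_(p <- [seq val p | p <- enum A]) F p x)).
  rewrite sum_prod_crt ?enum_val_uniq ?(enum_prime AP) // ?big_map ?big_enum //.
  by move=> _ x /mapP[p + ->]; rewrite mem_enum; apply: FE.
by move=> x _; rewrite [RHS]big_map big_enum.
Qed.

Lemma sieve_coprime (p : I) : p \in PP -> coprime p y.
Proof. by rewrite inE => /andP[pp py]; rewrite prime_coprime. Qed.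

Lemma sum_affine_dvd (p : I) b : p \in PP -> \sum_(t < p) (p %| b + y * t)%N%:R = 1 :> R.
Proof.
move=> pP; have p0 : (0 < p)%N by move: pP; rewrite inE => /andP[/prime_gt0].
rewrite (eq_bigr (fun t : 'I_p => (fun x => (p %| x)%N%:R) (t * y + b)%N)); last first.
  by move=> t _; rewrite addnC mulnC.
rewrite (@sum_affine _ (fun x => (p %| x)%N%:R)) ?sieve_coprime //; last first.
  by move=> x; rewrite dvdn_addl.
rewrite (bigD1 (Ordinal p0)) //= dvdn0 big1 ?addr0 // => i i0.
rewrite gtnNdvd //; rewrite lt0n; apply: contraNneq i0 => i0.
by apply/eqP/val_inj.
Qed.

Lemma qset_dvdE A n : A \subset PP -> (qset A %| n)%N%:R = \prod_(p in A) (p %| n)%N%:R :> R.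
Proof.
move=> AP; case: (qset_dvdP n AP) => h.
  by rewrite big1 // => p /h ->.
apply/esym/eqP; rewrite prodf_seq_eq0 /=.
apply: contrapT => /negP hn; apply: h => p pA; apply: contraT => pn.
by case/negP: hn; apply/hasP; exists p; rewrite ?mem_index_enum //= pA (negPf pn) eqxx.
Qed.

(** One full period of length q_A contains exactly one multiple of q_A, by the Chinese remainder
    theorem. *)
Lemma count_progression_le A b (T : nat) : A \subset PP ->
  \sum_(t < T) (qset A %| b + y * t)%N%:R <= T%:R / (qset A)%:R + 1 :> R.
Proof.
move=> AP; have q0 := qset_gt0 AP.
have -> : T%:R / (qset A)%:R + 1 =
   (T%:R / (qset A)%:R + 1) * \sum_(t < qset A) (qset A %| b + y * t)%N%:R :> R.
  rewrite (eq_bigr (fun t : 'I__ => \prod_(p in A) (p %| b + y * t)%N%:R)); last first.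
    by move=> t _; rewrite qset_dvdE.
  rewrite (@sum_prod_set A (fun p t => (p %| b + y * t)%N%:R)) //.
    rewrite big1 ?mulr1 // => p pA; rewrite sum_affine_dvd //.
    by move/subsetP: AP => /(_ _ pA).
  by move=> p x _; rewrite mulnDr addnA dvdn_addl // dvdn_mull.
apply: (@sum_periodic_le _ (fun t => (qset A %| b + y * t)%N%:R)) => // x.
by rewrite mulnDr addnA dvdn_addl // dvdn_mull.
Qed.

(** As [qset] is injective on sets of sieve primes, this counts the divisors d <= Q of n that are
    products of distinct sieve primes. *)
Definition tau_trunc (Q n : nat) : R :=
  \sum_(A : {set I} | (A \subset PP) && (qset A <= Q)%N) (qset A %| n)%N%:R.

Lemma tau_trunc_ge0 Q n : 0 <= tau_trunc Q n.
Proof. by apply: sumr_ge0. Qed.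

Definition harm (Q : nat) : R := \sum_(n < Q.+1 | (0 < n)%N) (n%:R)^-1.

(** The power is opened one factor at a time, and [B] collects the primes of the divisors chosen so
    far. Adding A multiplies the modulus by the modulus of [A :\: B], and summing the reciprocals of
    the latter costs 2^|B| times a harmonic sum. The bound Q^(k - j) on q_B keeps every modulus
    below Q^k <= T, so the +1 in the final count is absorbed by the factor 2. *)
Lemma tau_trunc_moment_aux (k Q T b : nat) (K : R) : (0 < Q)%N -> (Q ^ k <= T)%N ->
  (forall A, A \subset PP -> (qset A <= Q ^ k)%N -> 2 ^+ #|A| <= K) ->
  forall j B, (j <= k)%N -> B \subset PP -> (qset B <= Q ^ (k - j))%N ->
  \sum_(t < T) (qset B %| b + y * t)%N%:R * tau_trunc Q (b + y * t) ^+ j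
    <= 2 * T%:R / (qset B)%:R * (K * harm Q) ^+ j.
Proof.
move=> Q0 QT HK; elim=> [|j IH] B jk BP qB.
  rewrite expr0 mulr1; under eq_bigr do rewrite expr0 mulr1.
  apply: le_trans (count_progression_le b T BP) _.
  have q0 : 0 < (qset B)%:R :> R by rewrite ltr0n (qset_gt0 BP).
  have : 1 <= T%:R / (qset B)%:R :> R.
    by rewrite ler_pdivlMr // mul1r ler_nat (leq_trans qB) // subn0.
  by rewrite -mulrA; lra.
have harm0 : 0 <= harm Q by apply: sumr_ge0 => n _; rewrite invr_ge0.
have K0 : 0 <= K.
  by apply: le_trans (HK _ (sub0set _) _); rewrite ?cards0 ?qset0 ?expn_gt0 ?Q0.
have qBk : (qset B <= Q ^ k)%N.
  by apply: leq_trans qB _; rewrite leq_pexp2l // leq_subr.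
under eq_bigr do rewrite exprS {1}/tau_trunc mulr_suml mulr_sumr.
rewrite exchange_big /=.
apply: (@le_trans _ _ (\sum_(A : {set I} | (A \subset PP) && (qset A <= Q)%N)
    2 * T%:R / (qset B)%:R * (K * harm Q) ^+ j * (qset (A :\: B))%:R^-1)).
  apply: ler_sum => A /andP[AP AQ].
  have ABP : B :|: A \subset PP by rewrite subUset BP AP.
  rewrite (eq_bigr (fun t : 'I_T => (qset (B :|: A) %| b + y * t)%N%:R *
     tau_trunc Q (b + y * t) ^+ j)); last first.
    move=> t _; rewrite mulrA !qset_dvdE //; congr (_ * _).
    rewrite (big_mkcond (mem B)) (big_mkcond (mem A)) -big_split [RHS]big_mkcond /=.
    apply: eq_bigr => p _; rewrite inE; case: (p \in B); case: (p \in A) => /=;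
      rewrite ?mulr1 ?mul1r //.
    by case: (_ %| _)%N; rewrite ?mulr1 ?mulr0.
  apply: le_trans (IH _ (ltnW jk) ABP _) _.
    apply: leq_trans (qsetU_le BP AP) _.
    by rewrite -(subnSK jk) expnS mulnC leq_mul.
  rewrite qsetUD natrM invfM -!mulrA ler_wpM2l // ler_wpM2l // ler_wpM2l ?invr_ge0 //.
  by rewrite mulrC.
rewrite -mulr_sumr exprSr [leRHS]mulrA ler_wpM2l //.
  by rewrite mulr_ge0 ?exprn_ge0 ?mulr_ge0 ?invr_ge0.
apply: le_trans (sum_setD_le (P := fun A => (A \subset PP) && (qset A <= Q)%N)
   (h := fun A => ((qset A)%:R : R)^-1) _ _) _.
- move=> A /andP[AP AQ]; rewrite (subset_trans (subsetDl _ _) AP) /=.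
  by apply: leq_trans AQ; apply: (qset_subset AP); apply: subsetDl.
- by move=> A _; rewrite invr_ge0.
by apply: ler_pM; rewrite ?HK ?sum_qset_harmonic ?exprn_ge0 ?sumr_ge0 // => A _; rewrite invr_ge0.
Qed.

End PrimeSetSums.

Section Moments.
Variable R : realType.

Lemma tau_trunc_moment (k : nat) (e : R) : 0 < e -> exists2 C : R, 0 < C &
  forall z y b Q T : nat, (0 < Q)%N -> (Q ^ k <= T)%N ->
  \sum_(t < T) tau_trunc R z y Q (b + y * t) ^+ k <= C * T%:R * Q%:R `^ e.
Proof.
(* The k-th power below has base a constant times Q^((k + 1) d), and this d makes k (k + 1) d <=
   e. *)
move=> e0; pose d := e / (2 * k.+1%:R ^+ 2).
have k0 : 0 < k.+1%:R :> R by rewrite ltr0n.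
have d0 : 0 < d by rewrite divr_gt0 // mulr_gt0 // exprn_gt0.
have [C1 C10 H1] := @pow_card_le R 2 d (ler1n _ 2) d0.
have [C2 C20 H2] := @harmonic_le_pow R d d0.
exists (2 * (C1 * C2) ^+ k); first by rewrite mulr_gt0 // exprn_gt0 // mulr_gt0.
move=> z y b Q T Q0 QT.
have Q1 : 1 <= Q%:R :> R by rewrite ler1n.
pose K := C1 * (Q%:R ^+ k) `^ d.
have HK (A : {set 'I_z.+1}) : A \subset sieve_primes z y -> (qset A <= Q ^ k)%N ->
    2 ^+ #|A| <= K.
  move=> AP Ak; apply: le_trans (H1 _ _ _ AP) _; rewrite ler_wpM2l ?(ltW C10) //.
  by apply: ge0_ler_powR; rewrite ?(ltW d0) ?nnegrE ?exprn_ge0 // -natrX ler_nat.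
have := tau_trunc_moment_aux b Q0 QT HK (leqnn k) (sub0set _).
rewrite subnn expn0 qset0 => /(_ (leqnn _)).
under eq_bigr do rewrite dvd1n mul1r.
move=> h; apply: le_trans h _; rewrite invr1 mulr1 [2 * _ * T%:R]mulrAC -[leRHS]mulrA.
rewrite ler_wpM2l ?mulr_ge0 //.
apply: (@le_trans _ _ ((C1 * C2 * (Q%:R `^ (k.+1%:R * d))) ^+ k)).
  have harm0 : 0 <= harm R Q by apply: sumr_ge0 => n _; rewrite invr_ge0.
  have K0 : 0 <= K by rewrite mulr_ge0 ?powR_ge0 ?(ltW C10).
  rewrite lerXn2r ?nnegrE ?mulr_ge0 ?powR_ge0 ?(ltW C10) ?(ltW C20) //.
  apply: (@le_trans _ _ (K * (C2 * Q%:R `^ d))).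
    by rewrite ler_wpM2l //; exact: H2.
  rewrite /K -powR_mulrn // -powRrM -natr1 mulrDl mul1r powRD; last first.
    by rewrite pnatr_eq0 -lt0n Q0 implybT.
  by rewrite -!mulrA ler_wpM2l ?(ltW C10) // mulrCA.
rewrite exprMn ler_wpM2l ?exprn_ge0 ?mulr_ge0 ?(ltW C10) ?(ltW C20) //.
rewrite -powR_mulrn ?powR_ge0 // -powRrM ler_powR // /d.
rewrite -natr1; have : 0 <= k%:R :> R by []; move: (k%:R : R) => x x0.
have x1 : 0 < x + 1 by lra.
rewrite [leLHS](_ : _ = e * (x / (2 * (x + 1)))); last by field; lra.
rewrite ger_pMr // ler_pdivrMr; lra.
Qed.

(** Let U_n be the primes of U dividing n. Then |v_U(n)| <= q_(U_n), so with the bound for w_U each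
    term is at most Q^(e/2) / (G q_(U - U_n)) up to a constant. Mapping U to the pair (U - U_n, U_n)
    separates a harmonic sum from the truncated divisor function. *)
Lemma major_part_le (e : R) : 0 < e -> exists2 C : R, 0 < C &
  forall z y n Q : nat, (0 < z)%N -> (0 < Q)%N ->
  \sum_(U : {set 'I_z.+1} | (U \subset sieve_primes z y) && (qset U <= Q)%N)
     `|wset R y U| * `|vset R n U|
    <= C / sieve_mass R z y * Q%:R `^ e * tau_trunc R z y Q n.
Proof.
move=> e0; have e20 : 0 < e / 2 by rewrite divr_gt0.
have [C1 C10 H1] := @pow_card_le R 8 (e / 2) (ler1n _ 8) e20.
have [C2 C20 H2] := @harmonic_le_pow R (e / 2) e20.
exists (C1 * C2); first by rewrite mulr_gt0.
move=> z y n Q z0 Q0; set PP := sieve_primes z y; set G := sieve_mass R z y.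
have G0 : 0 < G by apply: sieve_mass_gt0.
have C10' := ltW C10; have C20' := ltW C20.
pose Un (U : {set 'I_z.+1}) := [set p in U | p %| n]%N.
have UnU U : Un U \subset U by apply/subsetP => p; rewrite inE => /andP[].
have qUn U : qset U = (qset (Un U) * qset (U :\: Un U))%N.
  by rewrite -qsetUD; congr qset; apply/esym/setUidPr.
apply: (@le_trans _ _ (\sum_(U : {set 'I_z.+1} | (U \subset PP) && (qset U <= Q)%N)
    C1 / G * Q%:R `^ (e / 2) * (qset (U :\: Un U))%:R^-1)).
  apply: ler_sum => U /andP[UP UQ].
  have q0 : 0 < (qset U)%:R :> R by rewrite ltr0n (qset_gt0 UP).
  have qn0 : 0 < (qset (Un U))%:R :> R.
    by rewrite ltr0n (qset_gt0 (subset_trans (UnU U) UP)).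
  have qd0 : 0 < (qset (U :\: Un U))%:R :> R.
    by rewrite ltr0n (qset_gt0 (subset_trans (subsetDl _ _) UP)).
  have w1 : `|wset R y U| <= C1 / G * Q%:R `^ (e / 2) * (qset U)%:R^-1.
    apply: le_trans (wset_bound R z0 UP) _; rewrite invfM [_^-1 * G^-1]mulrC mulrA ler_wpM2r ?invr_ge0 //.
    rewrite mulrAC ler_wpM2r ?invr_ge0 ?(ltW G0) //.
    apply: le_trans (H1 _ _ _ UP) _; rewrite ler_wpM2l //.
    by apply: ge0_ler_powR; rewrite ?(ltW e20) ?nnegrE // ler_nat.
  have v1 : `|vset R n U| <= (qset (Un U))%:R.
    rewrite /vset normr_prod /qset natr_prod big_mkcond [leRHS]big_mkcond /=.
    apply: ler_prod => p _; rewrite inE /vloc; case: ifP => /= pU; last by rewrite ler01 lexx.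
    have := in_sieve_ge R UP pU; case: (p %| n)%N => /= p2; rewrite normr_ge0 /=.
      by rewrite mulr1 ger0_norm; lra.
    by rewrite mulr0 sub0r normrN1.
  apply: le_trans (ler_pM _ _ w1 v1) _ => //.
  rewrite -[leLHS]mulrA ler_wpM2l ?mulr_ge0 ?powR_ge0 ?invr_ge0 ?(ltW G0) //.
  by rewrite qUn natrM invfM mulrAC mulVf ?mul1r // gt_eqF.
rewrite -mulr_sumr.
have -> : C1 * C2 / G * Q%:R `^ e * tau_trunc R z y Q n =
    C1 / G * Q%:R `^ (e / 2) * (C2 * Q%:R `^ (e / 2) * tau_trunc R z y Q n).
  rewrite {1}(splitr e) powRD; last by rewrite pnatr_eq0 -lt0n Q0 implybT.
  by ring.
rewrite ler_wpM2l ?mulr_ge0 ?powR_ge0 ?invr_ge0 ?(ltW G0) //.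
apply: (@le_trans _ _ (harm R Q * tau_trunc R z y Q n)); last first.
  by rewrite ler_wpM2r ?tau_trunc_ge0 //; exact: H2.
apply: (@le_trans _ _ ((\sum_(B : {set 'I_z.+1} | (B \subset PP) && (qset B <= Q)%N)
    (qset B)%:R^-1) * tau_trunc R z y Q n)); last first.
  by rewrite ler_wpM2r ?tau_trunc_ge0 //; exact: sum_qset_harmonic.
rewrite /tau_trunc big_distrlr /= pair_big_dep /=.
apply: (sum_inj_le (h := fun U => (U :\: Un U, Un U))).
- move=> U V _ _ [e1 e2]; rewrite -(setID U (Un U)) -(setID V (Un V)) e1.
  by have /setIidPr -> := UnU U; have /setIidPr -> := UnU V; rewrite e2.
- move=> U /andP[UP UQ] /=.
  rewrite !(subset_trans _ UP) ?subsetDl ?UnU //=.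
  by rewrite !(leq_trans _ UQ) // (qset_subset UP) ?subsetDl ?UnU.
- move=> U /andP[UP UQ] /=; rewrite (_ : (_ %| _)%N = true) ?mulr1 //.
  by apply/(qset_dvdP n (subset_trans (UnU U) UP)) => p; rewrite inE => /andP[].
by move=> [A B] _; rewrite mulr_ge0 ?invr_ge0.
Qed.

End Moments.

(** * Moduli larger than Q *)

Section Correlations.
Variables (R : realType) (z y : nat).
Local Notation PP := (sieve_primes z y).
Local Notation I := 'I_z.+1.
Implicit Types A B U V : {set I}.

(** The Ramanujan sum c_q(a - a') for q = q_U, written with congruences because subtraction in [nat]
    truncates. *)
Definition vdiff (a a' : nat) U : R := \prod_(p in U) (p%:R * (a == a' %[mod p])%N%:R - 1).

Lemma dvdn_affine_pair (p : I) n a a' : p \in PP ->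
  (p %| n + y * a)%N -> (p %| n + y * a')%N = (a == a' %[mod p])%N.
Proof.
move=> pP pa; have cop := sieve_coprime pP.
wlog le : a a' pa / (a <= a')%N => [hw|].
  case/orP: (leq_total a a') => le; first exact: hw.
  apply/idP/idP => [pa'|e]; first by rewrite eq_sym -(hw _ _ pa' le).
  by move: pa; rewrite -(subnKC le) mulnDr addnA dvdn_addl // dvdn_mull // -eqn_mod_dvd.
rewrite -(subnKC le) mulnDr addnA dvdn_addr // Gauss_dvdr //.
rewrite eq_sym eqn_mod_dvd ?leq_addr // addKn //.
Qed.

Lemma sum_vloc (p : I) b a : p \in PP -> \sum_(u < p) vloc R (b + y * (u + a)) p = 0.
Proof.
move=> pP; rewrite /vloc big_split /= -mulr_sumr.
rewrite (eq_bigr (fun u : 'I_p => (p %| (b + y * a) + y * u)%N%:R)); last first.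
  by move=> u _; have -> : (b + y * (u + a) = b + y * a + y * u)%N by lia.
by rewrite sum_affine_dvd // mulr1 sumr_const card_ord mulNrn subrr.
Qed.

(** Two divisibility indicators multiply to one of them if a and a' agree modulo p, and to 0
    otherwise. This is the local orthogonality relation of Ramanujan sums. *)
Lemma sum_vloc2 (p : I) b a a' : p \in PP ->
  \sum_(u < p) vloc R (b + y * (u + a)) p * vloc R (b + y * (u + a')) p
    = p%:R * (p%:R * (a == a' %[mod p])%N%:R - 1).
Proof.
move=> pP.
have E u c : (b + y * (u + c) = (b + y * c) + y * u)%N by lia.
pose e c (u : nat) : R := (p %| (b + y * c) + y * u)%N%:R.
have se c : \sum_(u < p) e c u = 1 by rewrite sum_affine_dvd.
have ee u : e a u * e a' u = (a == a' %[mod p])%N%:R * e a u.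
  rewrite /e; case: (boolP (p %| b + y * a + y * u)%N) => [h|_]; last by rewrite mul0r mulr0.
  rewrite mul1r mulr1; congr (_%:R).
  have : (p %| (b + y * u) + y * a)%N by rewrite addnAC.
  by move/(dvdn_affine_pair a' pP) <-; rewrite addnAC.
rewrite (eq_bigr (fun u : 'I_p => p%:R ^+ 2 * ((a == a' %[mod p])%N%:R * e a u)
   - p%:R * e a u - p%:R * e a' u + 1)).
  rewrite !big_split /= !sumrN -!mulr_sumr !se sumr_const card_ord; ring.
move=> u _; rewrite /vloc !E -/(e a u) -/(e a' u) -ee; ring.
Qed.

(** The average factors over primes. If U and V differ, a prime lying in only one of them
    contributes the mean of a single [vloc], which is 0. *)
Lemma sum_vset2 U V b a a' : U \subset PP -> V \subset PP ->
  \sum_(u < qset (U :|: V)) vset R (b + y * (u + a)) U * vset R (b + y * (u + a')) V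
    = (U == V)%:R * ((qset (U :|: V))%:R * vdiff a a' U).
Proof.
move=> UP VP; have UVP : U :|: V \subset PP by rewrite subUset UP VP.
(* The product lemma wants a function of natural numbers; [inord] turns p back into an index so that
   membership in U and V can be tested. *)
pose F (p u : nat) : R :=
  (if inord p \in U then p%:R * (p %| b + y * (u + a))%N%:R - 1 else 1) *
  (if inord p \in V then p%:R * (p %| b + y * (u + a'))%N%:R - 1 else 1).
rewrite (eq_bigr (fun u : 'I__ => \prod_(p in U :|: V) F p u)); last first.
  move=> u _; rewrite /vset (big_mkcond (mem U)) (big_mkcond (mem V)) -big_split [RHS]big_mkcond /=.
  apply: eq_bigr => p _; rewrite inE /F inord_val /vloc.
  by case: (p \in U); case: (p \in V); rewrite ?mulr1.
rewrite (sum_prod_set UVP); last first.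
  move=> p x _; rewrite /F; congr (_ * _); congr (if _ then _ * _%:R - _ else _).
    by rewrite addnAC mulnDr addnA dvdn_addl // dvdn_mull.
  by rewrite addnAC mulnDr addnA dvdn_addl // dvdn_mull.
have [e|ne] := eqVneq U V.
  rewrite -e setUid mul1r /qset natr_prod -big_split /=; apply: eq_bigr => p pU.
  have pP := subsetP UP _ pU; rewrite -(@sum_vloc2 p b) //.
  by apply: eq_bigr => u _; rewrite /F inord_val -e pU.
rewrite mul0r; have [p pUV] : exists p, (p \in U) != (p \in V).
  apply: contrapT => nex; case/eqP: ne; apply/setP => p; apply/eqP.
  by apply: contrapT => /negP h; case: nex; exists p.
have pin : p \in U :|: V by rewrite inE; move: pUV; case: (p \in U); case: (p \in V).
have pP := subsetP UVP _ pin.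
rewrite (bigD1 p) //= [X in X * _](_ : _ = 0) ?mul0r //.
move: pUV; rewrite /F inord_val; case: (p \in U); case: (p \in V) => // _.
  by under eq_bigr do rewrite mulr1; exact: sum_vloc.
by under eq_bigr do rewrite mul1r; exact: sum_vloc.
Qed.

Lemma vset_le U n : U \subset PP -> `|vset R n U| <= (qset U)%:R.
Proof.
move=> UP; rewrite /vset normr_prod /qset natr_prod; apply: ler_prod => p pU.
rewrite normr_ge0 /= /vloc; have := in_sieve_ge R UP pU; case: (p %| n)%N => /= p2.
  by rewrite mulr1 ger0_norm; lra.
by rewrite mulr0 sub0r normrN1; lra.
Qed.

(** The incomplete last period is bounded trivially: its length and the product of the two Ramanujan
    sums are each at most z^4, whence z^8. *)
Lemma corr_vset_le U V b a a' (M : nat) : U \subset PP -> V \subset PP ->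
  (qset U <= z ^ 2)%N -> (qset V <= z ^ 2)%N ->
  `|\sum_(u < M) vset R (b + y * (u + a)) U * vset R (b + y * (u + a')) V|
    <= (U == V)%:R * (M%:R * `|vdiff a a' U|) + z%:R ^+ 8.
Proof.
move=> UP VP Uz Vz; have UVP : U :|: V \subset PP by rewrite subUset UP VP.
have q0 := qset_gt0 UVP; have qz := leq_trans (qsetU_le UP VP) (leq_mul Uz Vz).
pose f u := vset R (b + y * (u + a)) U * vset R (b + y * (u + a')) V.
have fE u : f (u + qset (U :|: V))%N = f u.
  have per (W : {set I}) c : W \subset U :|: V ->
      vset R (b + y * (u + qset (U :|: V) + c)) W = vset R (b + y * (u + c)) W.
    move=> WUV; apply: eq_bigr => p pW; rewrite /vloc addnAC mulnDr addnA dvdn_addl //.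
    by rewrite dvdn_mull // /qset (bigD1 p) ?(subsetP WUV) //= dvdn_mulr.
  by rewrite /f !per ?subsetUl ?subsetUr.
have fC u : `|f u| <= z%:R ^+ 4.
  rewrite normrM [X in _ ^+ X](_ : _ = 2 + 2)%N // exprD ler_pM //.
    by apply: le_trans (vset_le _ UP) _; rewrite -natrX ler_nat.
  by apply: le_trans (vset_le _ VP) _; rewrite -natrX ler_nat.
apply: le_trans (@sum_periodic_dist _ f _ M _ q0 fE fC) _.
rewrite sum_vset2 // lerD //.
  rewrite !normrM ger0_norm // mulrCA ler_wpM2l // [`|_%:R|]ger0_norm // mulrA.
  by rewrite divfK // pnatr_eq0 -lt0n.
rewrite [X in _ <= _ ^+ X](_ : _ = 4 + 4)%N // exprD ler_wpM2r ?exprn_ge0 //.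
by rewrite -natrX ler_nat (leq_trans qz) // -expnD.
Qed.

(** Each local factor is at most p times an indicator plus 1, which sums to 2 p over a period. As
    q_U <= T, completing the last period costs a factor 2. *)
Lemma sum_vdiff_le U a (T : nat) : U \subset PP -> (qset U <= T)%N ->
  \sum_(a' < T) `|vdiff a a' U| <= 2 * T%:R * 2 ^+ #|U|.
Proof.
move=> UP UT; have q0 := qset_gt0 UP.
have q0' : 0 < (qset U)%:R :> R by rewrite ltr0n.
apply: (@le_trans _ _ (\sum_(a' < T) \prod_(p in U) (p%:R * (a == a' %[mod p])%N%:R + 1))).
  apply: ler_sum => a' _; rewrite /vdiff normr_prod; apply: ler_prod => p _.
  rewrite normr_ge0 /=; apply: le_trans (ler_normB _ _) _.
  by rewrite normr1 ger0_norm // mulr_ge0.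
apply: le_trans (@sum_periodic_le _
  (fun a' => \prod_(p in U) (p%:R * (a == a' %[mod p])%N%:R + 1)) _ _ q0 _ _) _.
- move=> x; apply: eq_bigr => p pU; congr (_ * _%:R + _).
  by rewrite -[in LHS]modnDm (eqP (_ : p %| qset U)%N) ?addn0 ?modn_mod // /qset (bigD1 p) //= dvdn_mulr.
- by move=> x; apply: prodr_ge0 => p _; rewrite addr_ge0 ?mulr_ge0.
rewrite (@sum_prod_set _ z y U (fun p a' => p%:R * (a == a' %[mod p])%N%:R + 1)) //; last first.
  by move=> p x _; rewrite modnDr.
rewrite (eq_bigr (fun p : I => 2 * p%:R)); last first.
  move=> p pU; have p0 := prime_gt0 (in_sieve_prime UP pU).
  rewrite big_split /= sumr_const card_ord -mulr_sumr.
  rewrite (bigD1 (Ordinal (ltn_pmod a p0))) //= modn_mod eqxx big1; last first.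
    move=> i ia; suff -> : (a == i %[mod p])%N = false by [].
    by apply: contraNF ia => /eqP h; apply/eqP/val_inj => /=; rewrite h modn_small.
  by rewrite addr0 mulr1 [RHS]mulr_natl mulr2n.
rewrite big_split /= prodr_const -natr_prod -/(qset U).
rewrite mulrCA mulrA [leLHS]mulrC -!mulrA.
rewrite [leLHS](_ : _ = 2 ^+ #|U| * (T%:R + (qset U)%:R)); last by field; rewrite gt_eqF.
rewrite mulrA [leRHS]mulrC ler_wpM2l ?exprn_ge0 //.
have : (qset U)%:R <= T%:R :> R by rewrite ler_nat.
lra.
Qed.

End Correlations.

Section MinorPart.
Variable R : realType.

Lemma sum_inv_pow32 (z : nat) :
  \sum_(n < z.+1 | (0 < n)%N) (n%:R * Num.sqrt n%:R : R)^-1 <= 3.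
Proof.
(* The subtracted term is the integral of t^(-3/2) from m + 1 to infinity; with it the induction
   closes. *)
suff H m : \sum_(n < m.+2 | (0 < n)%N) (n%:R * Num.sqrt n%:R : R)^-1 <= 3 - 2 / Num.sqrt m.+1%:R.
  case: z => [|z]; first by rewrite big_mkcond big_ord_recr big_ord0 /= addr0.
  apply: le_trans (H z) _; rewrite gerBl divr_ge0 // sqrtr_ge0.
elim: m => [|m IH].
  by rewrite big_mkcond !big_ord_recr big_ord0 /= !add0r sqrtr1 mulr1 invr1; lra.
rewrite big_mkcond big_ord_recr -big_mkcond /=.
apply: le_trans (lerD IH (lexx _)) _.
set s := Num.sqrt m.+1%:R; set t := Num.sqrt m.+2%:R.
have s0 : 0 < s by rewrite sqrtr_gt0 ltr0n.
have st : s <= t by rewrite ler_wsqrtr // ler_nat.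
have t0 : 0 < t by apply: lt_le_trans st.
have tt : m.+2%:R = t ^+ 2 by rewrite sqr_sqrtr.
have ss : m.+1%:R = s ^+ 2 by rewrite sqr_sqrtr.
have e : t ^+ 2 = s ^+ 2 + 1 by rewrite -tt -ss natr1.
rewrite tt -addrA lerD2l -(@ler_pM2r _ (t ^+ 3 * s)) ?mulr_gt0 ?exprn_gt0 //.
rewrite [leLHS](_ : _ = - 2 * t ^+ 3 + s); last by field; rewrite !gt_eqF.
rewrite [leRHS](_ : _ = - 2 * t ^+ 2 * s); last by field; rewrite !gt_eqF.
have h : (t - s) * (t + s) = 1 by rewrite -subr_sqr e; ring.
have : 0 <= (t - s) * t * (t - s) by rewrite mulr_ge0 ?mulr_ge0 ?subr_ge0 // ltW.
have k : 2 * t ^+ 3 - 2 * t ^+ 2 * s = t * (t + s) * (t - s) + t * (t - s) * (t - s) by ring.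
have : t * (t + s) * (t - s) = t by rewrite -mulrA [(t + s) * _]mulrC h mulr1.
lra.
Qed.

Lemma cauchy_sum (T : finType) (A : {set T}) (F : T -> R) :
  (\sum_(i in A) F i) ^+ 2 <= #|A|%:R * \sum_(i in A) F i ^+ 2.
Proof.
rewrite expr2 mulr_suml.
apply: (@le_trans _ _ (\sum_(i in A) \sum_(j in A) (F i ^+ 2 + F j ^+ 2) / 2)).
  apply: ler_sum => i _; rewrite mulr_sumr; apply: ler_sum => j _.
  by have := sqr_ge0 (F i - F j); rewrite sqrrB; lra.
under eq_bigr do rewrite -mulr_suml big_split /= sumr_const.
rewrite -mulr_suml big_split /= sumr_const sumrMnl -mulr_natl; lra.
Qed.

(** Cauchy-Schwarz in u, then expansion of the square over a, a' in Y, leads to the Gram matrix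
    [Gam], whose row sums are bounded. The terms U = V give the main contribution; the rest is the
    error from incomplete periods. *)
Lemma minor_part_le : exists2 C : R, 0 < C &
  forall (z y b Q M T : nat) (X : {set 'I_M}) (Y : {set 'I_T}),
  (0 < Q <= z)%N -> (z ^ 13 <= M)%N -> (z ^ 2 <= T)%N ->
  (\sum_(u in X) \sum_(a in Y) \sum_(U : {set 'I_z.+1} | (U \subset sieve_primes z y)
      && (Q < qset U <= z ^ 2)%N) wset R y U * vset R (b + y * (u + a)) U) ^+ 2
   <= C * #|X|%:R * #|Y|%:R * M%:R * T%:R * Q%:R `^ (- 4^-1) / sieve_mass R z y ^+ 2.
Proof.
have q40 : 0 < 4^-1 :> R by rewrite invr_gt0.
(* The base 128 is 8 . 8 . 2: w_U^2 gives 64^|U|, and averaging [vdiff] gives 2^|U|. Spending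
   q^(1/4) on it turns q^-2 into q^(-3/2) q^(-1/4), where the last factor is at most Q^(-1/4). *)
have [C1 C10 H1] := @pow_card_le R 128 4^-1 (ler1n _ _) q40.
have [C2 C20 H2] := @pow_card_le R 8 1 (ler1n _ _) ltr01.
exists (6 * C1 + C2 ^+ 2); first by rewrite addr_gt0 ?mulr_gt0 ?exprn_gt0.
move=> z y b Q M T X Y /andP[Q0 Qz] zM zT.
have z0 : (0 < z)%N by apply: leq_trans Qz.
set PP := sieve_primes z y; set G := sieve_mass R z y.
have G0 : 0 < G by apply: sieve_mass_gt0.
pose PU := fun U : {set 'I_z.+1} => (U \subset PP) && (Q < qset U <= z ^ 2)%N.
pose w (U : {set 'I_z.+1}) := wset R y U.
pose v (n : nat) (U : {set 'I_z.+1}) := vset R n U.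
pose E n := \sum_(U | PU U) w U * v n U.
change ((\sum_(u in X) \sum_(a in Y) E (b + y * (u + a))%N) ^+ 2 <=
  (6 * C1 + C2 ^+ 2) * #|X|%:R * #|Y|%:R * M%:R * T%:R * Q%:R `^ (- 4^-1) / G ^+ 2).
apply: le_trans (cauchy_sum _ _) _.
pose qe : R := Q%:R `^ (- 4^-1).
have qe0 : 0 <= qe by apply: powR_ge0.
have G20 : 0 < G ^+ 2 by rewrite exprn_gt0.
have sw2 : \sum_(U | PU U) w U ^+ 2 * 2 ^+ #|U| <= 3 * C1 * qe / G ^+ 2.
  apply: (@le_trans _ _ (\sum_(U | PU U) C1 * qe / G ^+ 2 *
      ((qset U)%:R * Num.sqrt (qset U)%:R)^-1)).
    apply: ler_sum => U /andP[UP /andP[QU Uz]].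
    have q0 : 0 < (qset U)%:R :> R by rewrite ltr0n (qset_gt0 UP).
    set q := (qset U)%:R : R.
    have wU : w U ^+ 2 <= (8 ^+ #|U| / (q * G)) ^+ 2.
      rewrite -real_normK ?num_real // lerXn2r ?nnegrE ?normr_ge0 ?wset_bound //.
      by rewrite divr_ge0 ?exprn_ge0 ?mulr_ge0 ?(ltW G0).
    apply: le_trans (ler_wpM2r _ wU) _; first by rewrite exprn_ge0.
    rewrite [leLHS](_ : _ = 128 ^+ #|U| * (q ^+ 2 * G ^+ 2)^-1); last first.
      rewrite [128](_ : _ = 8 * 8 * 2); last by ring.
      rewrite [(8 * 8 * 2) ^+ _]exprMn [(8 * 8) ^+ _]exprMn.
      by move: (8 ^+ #|U|) (2 ^+ #|U|) => e8 e2; field; rewrite !gt_eqF.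
    rewrite [leRHS](_ : _ = C1 * (qe * (q * Num.sqrt q)^-1 * q ^+ 2) * (q ^+ 2 * G ^+ 2)^-1); last first.
      by field; rewrite !gt_eqF ?sqrtr_gt0.
    rewrite ler_wpM2r ?invr_ge0 ?mulr_ge0 ?exprn_ge0 ?(ltW G0) //.
    apply: le_trans (H1 _ _ _ UP) _; rewrite ler_wpM2l ?(ltW C10) // -/q.
    have sq : Num.sqrt q = q `^ 4^-1 * q `^ 4^-1.
      rewrite -powRD; last by rewrite gt_eqF ?implybT.
      by rewrite -[4^-1 + 4^-1](_ : 2^-1 = _) ?powR12_sqrt ?(ltW q0) //; lra.
    have qq0 : 0 < q `^ 4^-1 by rewrite powR_gt0.
    have QQ0 : 0 < (Q%:R : R) `^ 4^-1 by apply: powR_gt0; rewrite ltr0n.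
    rewrite /qe powRN invfM [leRHS](_ : _ = q * (Num.sqrt q)^-1 * (Q%:R `^ 4^-1)^-1); last first.
      by field; rewrite !gt_eqF ?sqrtr_gt0.
    have qs : q = Num.sqrt q * Num.sqrt q by rewrite -expr2 sqr_sqrtr ?(ltW q0).
    rewrite {2}qs mulfK ?gt_eqF ?sqrtr_gt0 // {1}sq ler_pdivlMr // ler_wpM2l ?(ltW qq0) //.
    by apply: ge0_ler_powR; rewrite ?(ltW q40) ?nnegrE // ler_nat ltnW.
  rewrite -mulr_sumr mulrC [3 * C1]mulrC -!mulrA mulrC.
  rewrite [leLHS](_ : _ = C1 * (qe * (G ^+ 2)^-1) * \sum_(U | PU U) ((qset U)%:R * Num.sqrt (qset U)%:R)^-1); last by ring.
  rewrite [leRHS](_ : _ = C1 * (qe * (G ^+ 2)^-1) * 3); last by ring.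
  rewrite ler_wpM2l ?mulr_ge0 ?invr_ge0 ?(ltW C10) ?(ltW G20) //.
  apply: le_trans (sum_inv_pow32 (z ^ 2)).
  apply: (sum_inj_le (h := fun A => inord (qset A) : 'I_(z ^ 2).+1)).
  - move=> A B /andP[AP /andP[_ AQ]] /andP[BP /andP[_ BQ]] /(congr1 val) /=.
    by rewrite !inordK //; apply: (@qset_inj z y).
  - by move=> A /andP[AP /andP[_ AQ]]; rewrite inordK // (qset_gt0 AP).
  - by move=> A /andP[AP /andP[_ AQ]]; rewrite inordK.
  by move=> n _; rewrite invr_ge0 mulr_ge0 ?sqrtr_ge0.
(* There are at most z^2 moduli, and each coefficient is at most C2 / G because 8^|U| <= C2 q_U. *)
have sw1 : \sum_(U | PU U) `|w U| <= C2 * z%:R ^+ 2 / G.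
  apply: (@le_trans _ _ (\sum_(n < (z ^ 2).+1 | (0 < n)%N) C2 / G)); last first.
    rewrite big_mkcond big_ord_recl /= add0r sumr_const card_ord -[leLHS]mulr_natr natrX.
    by rewrite mulrAC.
  apply: (sum_inj_le (h := fun A => inord (qset A) : 'I_(z ^ 2).+1)).
  - move=> A B /andP[AP /andP[_ AQ]] /andP[BP /andP[_ BQ]] /(congr1 val) /=.
    by rewrite !inordK //; apply: (@qset_inj z y).
  - by move=> A /andP[AP /andP[_ AQ]]; rewrite inordK // (qset_gt0 AP).
  - move=> A /andP[AP _]; apply: le_trans (wset_bound R z0 AP) _.
    rewrite invfM mulrA ler_wpM2r ?invr_ge0 ?(ltW G0) // ler_pdivrMr ?ltr0n ?(qset_gt0 AP) //.
    by have := H2 _ _ _ AP; rewrite powRr1.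
  by move=> n _; rewrite divr_ge0 ?(ltW C20) ?(ltW G0).
pose Gam (a a' : nat) := \sum_(u < M) E (b + y * (u + a))%N * E (b + y * (u + a'))%N.
have GamE a a' : `|Gam a a'| <= M%:R * (\sum_(U | PU U) w U ^+ 2 * `|vdiff R a a' U|)
     + (\sum_(U | PU U) `|w U|) ^+ 2 * z%:R ^+ 8.
  have -> : Gam a a' = \sum_(U | PU U) \sum_(V | PU V) w U * w V *
      \sum_(u < M) v (b + y * (u + a))%N U * v (b + y * (u + a'))%N V.
    rewrite /Gam; under eq_bigr do rewrite /E mulr_suml.
    rewrite exchange_big /=; apply: eq_bigr => U _.
    under eq_bigr do rewrite mulr_sumr.
    rewrite exchange_big /=; apply: eq_bigr => V _.
    by rewrite mulr_sumr; apply: eq_bigr => u _; rewrite mulrACA.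
  apply: le_trans (ler_norm_sum _ _ _) _.
  apply: (@le_trans _ _ (\sum_(U | PU U) (M%:R * (w U ^+ 2 * `|vdiff R a a' U|) +
      `|w U| * (\sum_(V | PU V) `|w V|) * z%:R ^+ 8))); last first.
    by rewrite big_split /= -mulr_sumr -!mulr_suml -expr2.
  apply: ler_sum => U PUU; have /andP[UP /andP[_ Uz]] := PUU.
  apply: le_trans (ler_norm_sum _ _ _) _.
  apply: (@le_trans _ _ (\sum_(V | PU V) ((U == V)%:R * (M%:R * (w U ^+ 2 * `|vdiff R a a' U|)) +
      `|w U| * `|w V| * z%:R ^+ 8))).
    apply: ler_sum => V /andP[VP /andP[_ Vz]]; rewrite normrM.
    apply: le_trans (ler_wpM2l _ (corr_vset_le R b a a' M UP VP Uz Vz)) _ => //.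
    rewrite mulrDr normrM lerD // mulrCA.
    case: eqVneq => [<-|_]; rewrite ?mul0r // !mul1r.
    by rewrite -normrM -expr2 [`|w U ^+ 2|]ger0_norm ?sqr_ge0 // mulrCA.
  rewrite big_split /= lerD //.
    rewrite -mulr_suml (bigD1 U) //= eqxx big1 ?addr0 ?mul1r // => V /andP[_].
    by rewrite eq_sym => /negPf ->.
  by rewrite -mulr_suml -mulr_sumr.
have row (a : nat) : \sum_(a' < T) `|Gam a a'| <=
    (6 * C1 + C2 ^+ 2) * M%:R * T%:R * qe / G ^+ 2.
  apply: (@le_trans _ _ (\sum_(a' < T) (M%:R * (\sum_(U | PU U) w U ^+ 2 * `|vdiff R a a' U|)
     + (\sum_(U | PU U) `|w U|) ^+ 2 * z%:R ^+ 8))).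
    by apply: ler_sum => a' _; apply: GamE.
  rewrite big_split /= sumr_const card_ord -mulr_sumr exchange_big /=.
  rewrite -2!mulrA mulrDl mulrDl [leRHS](_ : _ = M%:R * (2 * T%:R * (3 * C1 * qe / G ^+ 2)) +
     C2 ^+ 2 * M%:R * T%:R * qe / G ^+ 2); last by ring.
  rewrite lerD //.
    rewrite ler_wpM2l //.
    apply: le_trans (ler_wpM2l _ sw2); last by rewrite mulr_ge0.
    rewrite mulr_sumr; apply: ler_sum => U /andP[UP /andP[_ Uz]].
    rewrite -mulr_sumr mulrCA ler_wpM2l ?sqr_ge0 //.
    exact: (sum_vdiff_le _ _ UP (leq_trans Uz zT)).
  rewrite -[leLHS]mulr_natr.
  apply: (@le_trans _ _ ((C2 * z%:R ^+ 2 / G) ^+ 2 * z%:R ^+ 8 * T%:R)).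
    rewrite ler_wpM2r // ler_wpM2r ?exprn_ge0 // lerXn2r ?nnegrE ?sumr_ge0 //.
    by rewrite divr_ge0 ?mulr_ge0 ?exprn_ge0 ?(ltW C20) ?(ltW G0).
  (* The error z^12 is absorbed: Q^(1/4) <= Q <= z and z^13 <= M. *)
  rewrite [leLHS](_ : _ = C2 ^+ 2 * T%:R / G ^+ 2 * z%:R ^+ 12); last by field; rewrite gt_eqF.
  rewrite [leRHS](_ : _ = C2 ^+ 2 * T%:R / G ^+ 2 * (M%:R * qe)); last by ring.
  rewrite ler_wpM2l ?divr_ge0 ?mulr_ge0 ?exprn_ge0 ?(ltW C20) ?(ltW G0) //.
  rewrite /qe powRN ler_pdivlMr ?powR_gt0 ?ltr0n //.
  apply: (@le_trans _ _ (z%:R ^+ 12 * z%:R)); last first.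
    by rewrite -exprSr -natrX ler_nat.
  rewrite ler_wpM2l ?exprn_ge0 //.
  apply: (@le_trans _ _ Q%:R); last by rewrite ler_nat.
  by rewrite -[leRHS]powRr1 // ler_powR ?ler1n //; lra.
rewrite [leRHS](_ : _ = #|X|%:R * (#|Y|%:R * ((6 * C1 + C2 ^+ 2) * M%:R * T%:R * qe / G ^+ 2))); last by rewrite /qe; ring.
rewrite ler_wpM2l //.
(* By positivity of the squares u may run over the whole interval; only then do full correlations
   appear. *)
apply: (@le_trans _ _ (\sum_(u < M) (\sum_(a in Y) E (b + y * (u + a))%N) ^+ 2)).
  rewrite big_mkcond; apply: ler_sum => u _; case: ifP => // _; exact: sqr_ge0.
apply: (@le_trans _ _ (\sum_(a in Y) \sum_(a' in Y) Gam a a')).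
  rewrite (eq_bigr (fun u : 'I_M => \sum_(a in Y) \sum_(a' in Y)
      E (b + y * (u + a))%N * E (b + y * (u + a'))%N)); last first.
    by move=> u _; rewrite expr2 mulr_suml; apply: eq_bigr => a _; rewrite mulr_sumr.
  rewrite exchange_big /=; apply: ler_sum => a _.
  by rewrite exchange_big.
rewrite [leRHS]mulr_natl -sumr_const; apply: ler_sum => a _.
apply: le_trans (row a); rewrite big_mkcond; apply: ler_sum => a' _.
by case: ifP => // _; apply: ler_norm.
Qed.

End MinorPart.

(** * Interpolation of restricted bounds *)

Section RestrictedInterpolation.
Variable R : realType.

(* [4 y / (1 + y)^2] is comparable with [min y y^-1], and telescopes along a
   geometric progression because y / (1 + y) is bounded. *)
Lemma geometric_bump_sum (y theta : R) (K : nat) : 0 < y -> 1 < theta ->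
  \sum_(j < K) 4 * (y * theta ^+ j) / (1 + y * theta ^+ j) ^+ 2
    <= 4 * theta / (theta - 1).
Proof.
move=> y0 t1; have t0 : 0 < theta by apply: lt_trans t1.
have t10 : 0 < theta - 1 by rewrite subr_gt0.
pose Phi x : R := x / (1 + x).
have step x : 0 < x ->
    4 * x / (1 + x) ^+ 2 <= 4 * theta / (theta - 1) * (Phi (x * theta) - Phi x).
  move=> x0; have x1 : 0 < 1 + x by lra.
  have x2 : 0 < 1 + x * theta by rewrite addr_gt0 // mulr_gt0.
  rewrite [leRHS](_ : _ = 4 * x * (theta / ((1 + x) * (1 + x * theta)))); last first.
    by rewrite /Phi; field; rewrite !gt_eqF.
  rewrite ler_wpM2l ?mulr_ge0 ?(ltW x0) //.
  rewrite ler_pdivlMr ?mulr_gt0 // mulrC ler_pdivrMr ?exprn_gt0 // -subr_ge0.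
  rewrite [leRHS](_ : _ = (1 + x) * (theta - 1)); last by ring.
  by rewrite mulr_ge0 ?(ltW x1) ?(ltW t10).
apply: (@le_trans _ _ (4 * theta / (theta - 1) * (Phi (y * theta ^+ K) - Phi y))).
  elim: K => [|K IH]; first by rewrite big_ord0 expr0 mulr1 subrr mulr0.
  rewrite big_ord_recr /=; apply: le_trans (lerD IH (step _ _)) _.
    by rewrite mulr_gt0 // exprn_gt0.
  by rewrite -mulrDr exprSr mulrA ler_wpM2l ?divr_ge0 ?mulr_ge0 ?(ltW t0) ?(ltW t10) //; lra.
have yK : 0 < y * theta ^+ K by rewrite mulr_gt0 // exprn_gt0.
rewrite -[leRHS]mulr1 ler_wpM2l ?divr_ge0 ?mulr_ge0 ?(ltW t0) ?(ltW t10) //.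
have : Phi (y * theta ^+ K) <= 1 by rewrite /Phi ler_pdivrMr; lra.
have : 0 <= Phi y by rewrite /Phi divr_ge0; lra.
lra.
Qed.

Lemma min_bump (T y t : R) : 0 < y -> 0 <= T -> t <= T * y -> t <= T / y ->
  t <= T * (4 * y / (1 + y) ^+ 2).
Proof.
move=> y0 T0 h1 h2; have y1 : 0 < (1 + y) ^+ 2 by rewrite exprn_gt0 //; lra.
have [yl|yg] := leP y 1.
  apply: le_trans h1 _; rewrite ler_wpM2l // ler_pdivlMr //.
  by rewrite mulrC ler_wpM2r ?(ltW y0) // expr2; nra.
apply: le_trans h2 _; rewrite ler_wpM2l // ler_pdivlMr // ler_pdivrMl //; nra.
Qed.

(** Since a b / 16 <= 1, its exponent may be lowered to 1/2, and 16 sqrt(a b / 16) = 4 sqrt(a b) <=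
    2 (a + b). Having a sum instead of a product lets the masses of the level sets be summed in one
    index at a time. *)
Lemma powR_prod_le (a b s : R) : 0 <= a <= 4 -> 0 <= b <= 4 -> 2^-1 <= s <= 1 ->
  (a * b) `^ s <= 2 * (a + b).
Proof.
move=> /andP[a0 a4] /andP[b0 b4] /andP[s1 s2].
have [->|ab0] := eqVneq (a * b) 0.
  by rewrite powR0 ?gt_eqF //; lra.
have t0 : 0 < a * b / 16 by rewrite divr_gt0 // lt_def ab0 mulr_ge0.
have -> : a * b = 16 * (a * b / 16) by field.
rewrite powRM ?(ltW t0) //.
have h1 : 16 `^ s <= 16 :> R by rewrite -[leRHS]powRr1 // ler_powR // ler1n.
have h2 : (a * b / 16) `^ s <= Num.sqrt (a * b / 16).
  rewrite -powR12_sqrt ?(ltW t0) //; apply: ger_powR => //; rewrite t0 /=; nra.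
apply: le_trans (ler_pM (powR_ge0 _ _) (powR_ge0 _ _) h1 h2) _.
have q0 := sqrtr_ge0 (a * b / 16); have := sqr_sqrtr (ltW t0).
move: q0; move: (Num.sqrt _) => q q0 qE.
rewrite -(@ler_pXn2r _ 2) ?nnegrE //; last by lra.
  by rewrite exprMn qE; have := sqr_ge0 (a - b); rewrite !expr2; lra.
by lra.
Qed.

Lemma dyadic_level (x : R) : 0 < x <= 1 -> exists i : nat, (2^-1) ^+ i.+1 < x <= (2^-1) ^+ i.
Proof.
move=> /andP[x0 x1].
have ex : exists i, (2^-1) ^+ i.+1 < x.
  exists (Num.truncn x^-1); rewrite exprVn invf_plt ?posrE ?exprn_gt0 //.
  apply: lt_trans (truncnS_gt _) _; rewrite -natrX ltr_nat.
  exact: ltn_expl.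
case: (ex_minnP ex) => i hi imin; exists i; rewrite hi /=.
case: i hi imin => [|i] hi imin; first by rewrite expr0.
by rewrite leNgt; apply/negP => /imin; rewrite ltnn.
Qed.

(** Dyadic level sets of a normalised function. Domination is tested against arbitrary [phi], so
    that it can be applied to one variable of a bilinear form at a time. The constant 4 bounds
    2^r. *)
Lemma level_decomposition (T : finType) (f : T -> R) (r : R) : 1 < r -> r < 2 ->
  (forall u, 0 <= f u) -> \sum_u f u `^ r <= 1 ->
  exists (K : nat) (F : nat -> {set T}),
   [/\ forall (phi : T -> R), (forall u, 0 <= phi u) ->
         \sum_u f u * phi u <= \sum_(i < K) (2^-1) ^+ i * \sum_(u in F i) phi u,
       forall i, ((2^-1 : R) ^+ i) `^ r * #|F i|%:R <= 4 &
       \sum_(i < K) ((2^-1 : R) ^+ i) `^ r * #|F i|%:R <= 4].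
Proof.
move=> r1 r2 f0 f1; have r0 : 0 < r by lra.
have fle u : f u <= 1.
  have : f u `^ r <= 1.
    by apply: le_trans f1; rewrite (bigD1 u) //= lerDl sumr_ge0 // => v _; exact: powR_ge0.
  rewrite leNgt => /negP h; rewrite leNgt; apply/negP => fu; apply: h.
  have -> : 1 = 1 `^ r :> R by rewrite powR1.
  by apply: gt0_ltr_powR => //; rewrite nnegrE //; lra.
(* Where f vanishes the level is an arbitrary default; the sets [F i] exclude such points. *)
have levex u : exists i, 0 < f u -> (2^-1) ^+ i.+1 < f u <= (2^-1) ^+ i.
  have [fu|fu] := ltP 0 (f u); last by exists 0%N.
  have fu1 : 0 < f u <= 1 by rewrite fu fle.
  by have [i Hi] := dyadic_level fu1; exists i.
have [lev levP] := boolp.choice levex.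
pose F i := [set u | (0 < f u) && (lev u == i)].
pose K := (\max_u lev u).+1.
have levK u : (lev u < K)%N by rewrite ltnS (@leq_bigmax T lev u).
have Fa i : ((2^-1 : R) ^+ i) `^ r * #|F i|%:R <= 4 * \sum_(u in F i) f u `^ r.
  rewrite -sumr_const mulr_sumr mulr_sumr; apply: ler_sum => u.
  rewrite inE mulr1 => /andP[fu /eqP lu]; have /andP[l1 _] := levP u fu.
  have h4 : 4^-1 <= (2^-1 : R) `^ r.
    rewrite [4^-1](_ : _ = (2^-1) `^ 2); last by rewrite powR_mulrn //; field.
    by apply: ger_powR; [lra|apply: ltW].
  have : ((2^-1) ^+ i.+1) `^ r <= f u `^ r.
    by apply: ge0_ler_powR; rewrite ?nnegrE ?exprn_ge0 ?(ltW r0) ?f0 // -lu ltW.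
  rewrite exprSr powRM ?exprn_ge0 //; have := powR_ge0 ((2^-1 : R) ^+ i) r.
  move: (_ `^ r) (f u `^ r) h4 => X Y; move: (_ `^ r) => Z; nra.
have Fsum : \sum_(i < K) \sum_(u in F i) f u `^ r <= 1.
  apply: le_trans f1.
  rewrite [leRHS](bigID (fun u => 0 < f u)) /=.
  rewrite (partition_big (fun u => inord (lev u) : 'I_K) xpredT) //=.
  rewrite -[leLHS]addr0 lerD ?sumr_ge0 // => [|u _]; last exact: powR_ge0.
  apply: ler_sum => i _; rewrite le_eqVlt; apply/orP; left; apply/eqP.
  apply: eq_bigl => u; rewrite inE; congr (_ && _).
  by apply/eqP/eqP => [->|<-]; rewrite ?inord_val ?inordK.
exists K, F; split.
- move=> phi phi0.
  apply: (@le_trans _ _ (\sum_(u | 0 < f u) (2^-1) ^+ lev u * phi u)).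
    rewrite [leRHS]big_mkcond; apply: ler_sum => u _; case: ltP => fu.
      by rewrite ler_wpM2r //; have /andP[] := levP u fu.
    by have /eqP -> : f u == 0; [rewrite eq_le fu f0|rewrite mul0r].
  rewrite (partition_big (fun u => inord (lev u) : 'I_K) xpredT) //=.
  apply: ler_sum => i _; rewrite mulr_sumr le_eqVlt; apply/orP; left; apply/eqP.
  apply: eq_big => u.
    rewrite inE; congr (_ && _).
    by apply/eqP/eqP => [<-|->]; rewrite ?inord_val ?inordK.
  by move=> /andP[_ /eqP <-]; rewrite inordK.
- move=> i; apply: le_trans (Fa i) _; rewrite -[leRHS]mulr1 ler_wpM2l //.
  apply: le_trans f1; rewrite big_mkcond; apply: ler_sum => u _.
  by case: ifP => // _; exact: powR_ge0.
apply: (@le_trans _ _ (\sum_(i < K) 4 * \sum_(u in F i) f u `^ r)).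
  exact: ler_sum.
by rewrite -mulr_sumr -[leRHS]mulr1 ler_wpM2l.
Qed.

(** The parenthesis is the bound of [geometric_bump_sum] for the ratio 2^(r eta). The 16 is 2 (4 +
    4): the 2 of [powR_prod_le] times the total masses of the two families of level sets. *)
Definition interp_const (r eta : R) : R :=
  16 * (4 * 2 `^ (r * eta) / (2 `^ (r * eta) - 1)).

(** For the levels 2^-i and 2^-j put yy = (m 2^(-r(i + j)))^-eta. The exponent 1/r + eta bounds the
    pair with a factor yy, and 1/r - eta with its inverse. The smaller of the two is a bump
    depending only on i + j, summable in either index uniformly in the other. *)
Lemma interpolation_unit (r eta m A : R) (I J : finType) (k : I -> J -> R)
    (f : I -> R) (g : J -> R) :
  1 < r -> r < 2 -> 0 < eta -> 2^-1 <= r^-1 - eta -> r^-1 + eta <= 1 ->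
  0 < m -> 0 <= A -> (forall u a, 0 <= k u a) ->
  (forall (X : {set I}) (Y : {set J}) s, s = r^-1 - eta \/ s = r^-1 + eta ->
    \sum_(u in X) \sum_(a in Y) k u a <= A * (#|X|%:R * #|Y|%:R / m) `^ s) ->
  (forall u, 0 <= f u) -> (forall a, 0 <= g a) ->
  \sum_u f u `^ r <= 1 -> \sum_a g a `^ r <= 1 ->
  \sum_u \sum_a k u a * f u * g a <= interp_const r eta * A * m `^ (- r^-1).
Proof.
move=> r1 r2 e0 e1 e2 m0 A0 k0 kB f0 g0 f1 g1.
have r0 : 0 < r by lra.
have [K [F [Fd Fa Fs]]] := level_decomposition r1 r2 f0 f1.
have [L [H [Hd Hb Hs]]] := level_decomposition r1 r2 g0 g1.
pose h : R := 2^-1; have h0 : 0 < h by rewrite /h.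
pose a i := (h ^+ i) `^ r * #|F i|%:R; pose b i := (h ^+ i) `^ r * #|H i|%:R.
have a0 i : 0 <= a i by rewrite mulr_ge0 ?powR_ge0.
have b0 i : 0 <= b i by rewrite mulr_ge0 ?powR_ge0.
pose theta : R := 2 `^ (r * eta).
have th1 : 1 < theta.
  have : 1 `^ (r * eta) < 2 `^ (r * eta) :> R.
    by apply: gt0_ltr_powR; rewrite ?mulr_gt0 ?nnegrE ?ltr1n.
  by rewrite powR1.
have th0 : 0 < theta by apply: lt_trans th1.
pose y0 : R := (m `^ eta)^-1; have y00 : 0 < y0 by rewrite invr_gt0 powR_gt0.
pose bump k := 4 * (y0 * theta ^+ k) / (1 + y0 * theta ^+ k) ^+ 2.
pose D := 4 * theta / (theta - 1).
have bumpD i n : \sum_(j < n) bump (i + j)%N <= D.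
  have := @geometric_bump_sum (y0 * theta ^+ i) theta n.
  rewrite mulr_gt0 ?exprn_gt0 // => /(_ isT th1); apply: le_trans.
  rewrite le_eqVlt; apply/orP; left; apply/eqP; apply: eq_bigr => j _.
  by rewrite /bump exprD !mulrA.
have D0 : 0 <= D by rewrite divr_ge0 ?mulr_ge0 ?(ltW th0) // subr_ge0 ltW.
pose T0 := A * m `^ (- r^-1).
have T00 : 0 <= T0 by rewrite mulr_ge0 ?powR_ge0.
have term i j : h ^+ i * h ^+ j * (\sum_(u in F i) \sum_(v in H j) k u v)
    <= T0 * (2 * (a i + b j)) * bump (i + j)%N.
  pose W := h ^+ (i + j)%N; have W0 : 0 < W by rewrite exprn_gt0.
  pose hr := W `^ r; have hr0 : 0 < hr by rewrite powR_gt0.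
  have hW : hr `^ r^-1 = W by rewrite -powRrM divff ?gt_eqF // powRr1 // ltW.
  have yE : y0 * theta ^+ (i + j)%N = ((m * hr) `^ eta)^-1.
    rewrite powRM ?(ltW m0) ?(ltW hr0) // invfM; congr (_ * _).
    rewrite /hr /W /h -powRrM powR_expr // -[2^-1]powR_inv1 // -powRrM mulN1r.
    by rewrite powRN exprVn invrK.
  set yy := ((m * hr) `^ eta)^-1 in yE.
  have mh0 : 0 < m * hr by rewrite mulr_gt0.
  have yy0 : 0 < yy by rewrite invr_gt0 powR_gt0.
  have xE : #|F i|%:R * #|H j|%:R / m = a i * b j / (m * hr).
    rewrite /a /b /hr /W exprD powRM ?exprn_ge0 ?(ltW h0) //.
    have := @powR_gt0 _ (h ^+ i) r (exprn_gt0 _ h0).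
    have := @powR_gt0 _ (h ^+ j) r (exprn_gt0 _ h0).
    move: (_ `^ r) => x1 h1; move: (_ `^ r) => x2 h2; field.
    by rewrite !gt_eqF.
  have bnd s : 2^-1 <= s <= 1 -> h ^+ i * h ^+ j * (A * (#|F i|%:R * #|H j|%:R / m) `^ s) <=
      T0 * (2 * (a i + b j)) * (m * hr) `^ (r^-1 - s).
    move=> s1; rewrite xE powRM ?(mulr_ge0 (a0 i) (b0 j)) ?invr_ge0 ?(ltW mh0) //.
    rewrite -exprD -/W.
    have E : W * ((m * hr)^-1) `^ s = m `^ (- r^-1) * (m * hr) `^ (r^-1 - s).
      rewrite -powR_inv1 ?(ltW mh0) // -powRrM mulN1r powRD; last by rewrite (gt_eqF mh0) implybT.
      rewrite [(m * hr) `^ r^-1]powRM ?(ltW m0) ?(ltW hr0) // hW !mulrA -[_ * m `^ r^-1]powRD.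
        by rewrite addNr powRr0 mul1r.
      by rewrite (gt_eqF m0) implybT.
    rewrite [leLHS](_ : _ = A * (a i * b j) `^ s * (W * (m * hr)^-1 `^ s)); last by ring.
    rewrite E [leRHS](_ : _ = A * (2 * (a i + b j)) * (m `^ (- r^-1) * (m * hr) `^ (r^-1 - s))); last first.
      by rewrite /T0; ring.
    rewrite ler_wpM2r ?mulr_ge0 ?powR_ge0 // ler_wpM2l //.
    by apply: powR_prod_le; rewrite ?a0 ?b0 ?Fa ?Hb.
  rewrite /bump yE; apply: min_bump => //.
  - by rewrite mulr_ge0 // mulr_ge0 // addr_ge0.
  - have := kB (F i) (H j) _ (or_intror erefl).
    move=> /(ler_wpM2l (_ : 0 <= h ^+ i * h ^+ j)) hh; apply: le_trans (hh _) _.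
      by rewrite mulr_ge0 ?exprn_ge0 ?(ltW h0).
    apply: le_trans (bnd _ _) _; first by apply/andP; split; lra.
    by rewrite opprD addNKr powRN.
  have := kB (F i) (H j) _ (or_introl erefl).
  move=> /(ler_wpM2l (_ : 0 <= h ^+ i * h ^+ j)) hh; apply: le_trans (hh _) _.
    by rewrite mulr_ge0 ?exprn_ge0 ?(ltW h0).
  apply: le_trans (bnd _ _) _; first by apply/andP; split; lra.
  by rewrite subKr /yy invrK.
apply: (@le_trans _ _ (\sum_(i < K) \sum_(j < L) T0 * (2 * (a i + b j)) * bump (i + j)%N)).
  apply: (@le_trans _ _ (\sum_(i < K) h ^+ i * \sum_(u in F i) \sum_v k u v * g v)).
    apply: le_trans (Fd (fun u => \sum_v k u v * g v) _).
      rewrite le_eqVlt; apply/orP; left; apply/eqP; apply: eq_bigr => u _.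
      by rewrite mulr_sumr; apply: eq_bigr => v _; rewrite mulrAC mulrC.
    by move=> u; apply: sumr_ge0 => v _; rewrite mulr_ge0.
  apply: ler_sum => i _.
  apply: (@le_trans _ _ (h ^+ i * \sum_(u in F i) \sum_(j < L) h ^+ j * \sum_(v in H j) k u v)).
    rewrite ler_wpM2l ?exprn_ge0 ?(ltW h0) //; apply: ler_sum => u _.
    apply: le_trans (Hd (k u) _); last by move=> v.
    by rewrite le_eqVlt; apply/orP; left; apply/eqP; apply: eq_bigr => v _; rewrite mulrC.
  rewrite exchange_big /= mulr_sumr; apply: ler_sum => j _.
  by rewrite -mulr_sumr mulrA; apply: term.
have swap : \sum_(i < K) \sum_(j < L) T0 * (2 * (a i + b j)) * bump (i + j)%N =
  T0 * 2 * (\sum_(i < K) a i * \sum_(j < L) bump (i + j)%N +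
            \sum_(j < L) b j * \sum_(i < K) bump (j + i)%N).
  under [X in _ * (_ + X)]eq_bigr do rewrite mulr_sumr.
  rewrite [X in _ * (_ + X)]exchange_big /= -big_split /= mulr_sumr; apply: eq_bigr => i _.
  rewrite mulr_sumr -big_split /= mulr_sumr; apply: eq_bigr => j _.
  by rewrite [(j + i)%N]addnC; ring.
rewrite swap.
have S1 : \sum_(i < K) a i * \sum_(j < L) bump (i + j)%N <= 4 * D.
  apply: (@le_trans _ _ (\sum_(i < K) a i * D)); last by rewrite -mulr_suml ler_wpM2r.
  by apply: ler_sum => i _; rewrite ler_wpM2l.
have S2 : \sum_(j < L) b j * \sum_(i < K) bump (j + i)%N <= 4 * D.
  apply: (@le_trans _ _ (\sum_(j < L) b j * D)); last by rewrite -mulr_suml ler_wpM2r.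
  by apply: ler_sum => i _; rewrite ler_wpM2l.
apply: le_trans (ler_wpM2l _ (lerD S1 S2)) _; first by rewrite mulr_ge0.
rewrite /interp_const -/theta -/D -mulrA -/T0; lra.
Qed.

(** Homogeneity reduces to norm one; functions of norm zero vanish and are treated first. *)
Lemma interpolation (r eta m A : R) (I J : finType) (k : I -> J -> R)
    (f : I -> R) (g : J -> R) :
  1 < r -> r < 2 -> 0 < eta -> 2^-1 <= r^-1 - eta -> r^-1 + eta <= 1 ->
  0 < m -> 0 <= A -> (forall u a, 0 <= k u a) ->
  (forall (X : {set I}) (Y : {set J}) s, s = r^-1 - eta \/ s = r^-1 + eta ->
    \sum_(u in X) \sum_(a in Y) k u a <= A * (#|X|%:R * #|Y|%:R / m) `^ s) ->
  (forall u, 0 <= f u) -> (forall a, 0 <= g a) ->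
  \sum_u \sum_a k u a * f u * g a <= interp_const r eta * A * m `^ (- r^-1)
    * ((\sum_u f u `^ r) `^ r^-1 * (\sum_a g a `^ r) `^ r^-1).
Proof.
move=> r1 r2 e0 e1 e2 m0 A0 k0 kB f0 g0; have r0 : 0 < r by lra.
have degen (T : finType) (q : T -> R) : (forall u, 0 <= q u) ->
    \sum_u q u `^ r = 0 -> forall u, q u = 0.
  move=> q0 /eqP; rewrite psumr_eq0 => [/allP h u|u _]; last exact: powR_ge0.
  by have := h u (mem_index_enum _); rewrite powR_eq0 => /andP[/eqP].
have Sf0 : 0 <= \sum_u f u `^ r by apply: sumr_ge0 => u _; exact: powR_ge0.
have Sg0 : 0 <= \sum_a g a `^ r by apply: sumr_ge0 => u _; exact: powR_ge0.
have [Sf|Sf] := eqVneq (\sum_u f u `^ r) 0.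
  rewrite Sf powR0 ?invr_eq0 ?gt_eqF // mul0r mulr0 big1 // => u _.
  by rewrite big1 // => a _; rewrite (degen _ _ f0 Sf) mulr0 mul0r.
have [Sg|Sg] := eqVneq (\sum_a g a `^ r) 0.
  rewrite Sg powR0 ?invr_eq0 ?gt_eqF // !mulr0 big1 // => u _.
  by rewrite big1 // => a _; rewrite (degen _ _ g0 Sg) mulr0.
set nf := (\sum_u f u `^ r) `^ r^-1; set ng := (\sum_a g a `^ r) `^ r^-1.
have nf0 : 0 < nf by rewrite powR_gt0 // lt_def Sf.
have ng0 : 0 < ng by rewrite powR_gt0 // lt_def Sg.
have unit (T : finType) (q : T -> R) : (forall u, 0 <= q u) -> \sum_u q u `^ r != 0 ->
    \sum_u (q u / (\sum_u q u `^ r) `^ r^-1) `^ r <= 1.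
  move=> q0 Sq; have Sq0 : 0 < \sum_u q u `^ r.
    by rewrite lt_def Sq sumr_ge0 // => u _; exact: powR_ge0.
  under eq_bigr do rewrite powRM ?invr_ge0 ?powR_ge0 // -powRN -powRrM mulNr mulVf ?gt_eqF // powR_inv1 ?(ltW Sq0) //.
  by rewrite -mulr_suml divff.
have := interpolation_unit r1 r2 e0 e1 e2 m0 A0 k0 kB
  (fun u => divr_ge0 (f0 u) (ltW nf0)) (fun a => divr_ge0 (g0 a) (ltW ng0))
  (unit _ _ f0 Sf) (unit _ _ g0 Sg).
move=> h; rewrite -ler_pdivrMr ?mulr_gt0 //; apply: le_trans h.
rewrite le_eqVlt; apply/orP; left; apply/eqP.
rewrite mulr_suml; apply: eq_bigr => u _; rewrite mulr_suml; apply: eq_bigr => a _.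
by field; rewrite !gt_eqF.
Qed.

End RestrictedInterpolation.

(** * The Selberg form on sets *)

Section SelbergForm.
Variable R : realType.

(** The density product x can reach 2, because Y lies in an interval twice as long as that of X;
    lowering the exponent then costs at most a factor 2. *)
Lemma powR_le_double (x s t : R) : 0 <= x <= 2 -> 0 < s -> s <= t -> t <= 1 ->
  x `^ t <= 2 * x `^ s.
Proof.
move=> /andP[x0 x2] s0 st t1.
have [->|xn0] := eqVneq x 0; first by rewrite !powR0 ?mulr0 // gt_eqF //; lra.
have xp : 0 < x / 2 by rewrite divr_gt0 // lt_def xn0.
have x1 : x / 2 <= 1 by lra.
have -> : x = 2 * (x / 2) by field.
move: (x / 2) xp x1 => w xp x1; rewrite !powRM ?(ltW xp) // mulrA ler_pM ?powR_ge0 //.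
  apply: (@le_trans _ _ (2 `^ 1)); first by rewrite ler_powR // ler1n.
  by rewrite powRr1 // ler_peMr // powR_ge1 // ?ler1n // ltW.
by apply: ger_powR => //; rewrite xp.
Qed.

(** Above the threshold, c = c^k / c^(k - 1) <= c^k / lam^(k - 1). *)
Lemma threshold_pow (c lam : R) (k : nat) : (0 < k)%N -> 0 <= c -> 0 < lam ->
  c <= lam + c ^+ k * (lam ^+ k.-1)^-1.
Proof.
case: k => // k _ c0 l0 /=; have [cl|lc] := leP c lam.
  by rewrite ler_wpDr // mulr_ge0 ?exprn_ge0 // invr_ge0 exprn_ge0 // ltW.
apply: ler_wpDl; first exact: ltW.
rewrite ler_pdivlMr ?exprn_gt0 // exprS ler_wpM2l // lerXn2r ?nnegrE // ltW //.
Qed.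

(** For fixed u the values u + a are distinct, so a row sums to at most the total of c, and so does
    a column. The result is the geometric mean of the two bounds, which keeps both densities. *)
Lemma hankel_sum_le (M T S : nat) (X : {set 'I_M}) (Y : {set 'I_T}) (c : nat -> R) :
  (forall t, 0 <= c t) -> (M + T <= S)%N ->
  \sum_(u in X) \sum_(a in Y) c (u + a)%N
    <= Num.sqrt (#|X|%:R * #|Y|%:R) * \sum_(t < S) c t.
Proof.
move=> c0 MT; have s0 : 0 <= \sum_(t < S) c t by apply: sumr_ge0.
have bnd (K : nat) (Z : {set 'I_K}) (v : nat) : (v + K <= S)%N ->
    \sum_(a in Z) c (v + a)%N <= \sum_(t < S) c t.
  move=> vK; have lt (a : 'I_K) : (v + a < S)%N.
    by apply: leq_trans vK; rewrite ltn_add2l.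
  apply: (sum_inj_le (h := fun a : 'I_K => Ordinal (lt a))) => //.
  by move=> a a' _ _ /(congr1 val) /= /addnI /val_inj.
have bX : \sum_(u in X) \sum_(a in Y) c (u + a)%N <= #|X|%:R * \sum_(t < S) c t.
  rewrite mulr_natl -sumr_const; apply: ler_sum => u _; apply: bnd.
  by apply: leq_trans MT; rewrite leq_add2r ltnW.
have bY : \sum_(u in X) \sum_(a in Y) c (u + a)%N <= #|Y|%:R * \sum_(t < S) c t.
  rewrite exchange_big /= mulr_natl -sumr_const; apply: ler_sum => a _.
  under eq_bigr do rewrite addnC.
  by apply: bnd; apply: leq_trans MT; rewrite addnC leq_add2l ltnW.
have L0 : 0 <= \sum_(u in X) \sum_(a in Y) c (u + a)%N.
  by apply: sumr_ge0 => u _; apply: sumr_ge0.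
have := ler_pM L0 L0 bX bY; set L := \sum_(u in X) _; set W := \sum_(t < S) _.
move=> h; rewrite -(@ler_pXn2r _ 2) ?nnegrE ?mulr_ge0 ?sqrtr_ge0 //.
rewrite exprMn sqr_sqrtr ?mulr_ge0 // !expr2; apply: le_trans h _.
by rewrite mulrACA.
Qed.

Lemma selberg_sum_le (s : R) : 0 < s -> s < 1 ->
  exists (k : nat) (C : R), [/\ (0 < k)%N, 0 < C &
  forall (z y b Q M : nat) (X : {set 'I_M}) (Y : {set 'I_(2 * M)}),
  let x : R := #|X|%:R * #|Y|%:R / M%:R ^+ 2 in
  0 < x -> x <= 2 -> (0 < Q)%N -> (Q ^ k <= z)%N -> (z ^ 13 <= M)%N ->
  ((x / 2) ^+ 4)^-1 <= Q%:R -> Q%:R <= 32 * (x ^+ 4)^-1 ->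
  \sum_(u in X) \sum_(a in Y) selberg R z y (b + y * (u + a)) ^+ 2
    <= C / sieve_mass R z y * M%:R ^+ 2 * x `^ s].
Proof.
(* Two factors Q^e cost x^(-8 e) = x^(-(1 - s)/2), and the choice of k makes the thresholding loss
   x^(-1/(2 k)) no worse; together the exponent stays at least s. *)
move=> s0 s1; pose e : R := (1 - s) / 16; have e0 : 0 < e by rewrite divr_gt0 ?subr_gt0.
pose k := (Num.truncn (1 - s)^-1).+1.
have k1 : (1 - s)^-1 <= k%:R by rewrite ltW // truncnS_gt.
have k0 : 0 < k%:R :> R by rewrite ltr0n.
have k2 : (2 * k%:R)^-1 <= (1 - s) / 2.
  rewrite invfM [leRHS]mulrC ler_wpM2l //.
  by rewrite invf_ple ?posrE ?subr_gt0.
have kp : (0 < k)%N by [].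
clearbody k.
have [C1 C10 H1] := @major_part_le R e e0.
have [C2 C20 H2] := @tau_trunc_moment R k e e0.
have [C3 C30 H3] := @minor_part_le R.
pose C32 : R := 32 `^ e.
have C320 : 0 < C32 by rewrite powR_gt0.
pose D2 : R := 2 `^ (4 * e).
have D20 : 0 < D2 by rewrite powR_gt0.
pose CC := C1 * C32 * (1 + 3 * C2 * C32) * D2 * 2 + Num.sqrt (2 * C3) * 2.
have CC0 : 0 < CC.
  apply: ltr_wpDr; first by rewrite mulr_ge0 ?sqrtr_ge0.
  by rewrite !mulr_gt0 // addr_gt0 // !mulr_gt0.
exists k, CC; split => // z y b Q M X Y x x0 x2 Q0 Qz zM Qlo Qhi.
have xE : x = #|X|%:R * #|Y|%:R / M%:R ^+ 2 by [].
clearbody x.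
have z0 : (0 < z)%N by apply: leq_trans Qz; rewrite expn_gt0 Q0.
have Qz1 : (Q <= z)%N by apply: leq_trans Qz; rewrite -{1}[Q]expn1 leq_pexp2l.
have zM1 : (z <= M)%N by apply: leq_trans zM; rewrite -{1}[z]expn1 leq_pexp2l.
have M0 : (0 < M)%N by apply: leq_trans zM1.
have M0' : 0 < M%:R :> R by rewrite ltr0n.
set G := sieve_mass R z y; have G0 : 0 < G by apply: sieve_mass_gt0.
have Qe : Q%:R `^ e <= C32 * x `^ (- (4 * e)).
  apply: (@le_trans _ _ ((32 * (x ^+ 4)^-1) `^ e)).
    by apply: ge0_ler_powR; rewrite ?(ltW e0) ?nnegrE ?mulr_ge0 ?invr_ge0 ?exprn_ge0 ?(ltW x0).
  rewrite powRM ?invr_ge0 ?exprn_ge0 ?(ltW x0) // ler_wpM2l ?(ltW C320) //.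
  rewrite -powR_mulrn ?(ltW x0) // -powRN -powRrM.
  by rewrite mulNr.
have Qm : Q%:R `^ (- 4^-1) <= x.
  rewrite powRN invf_ple ?posrE ?powR_gt0 ?ltr0n //.
  apply: (@le_trans _ _ ((x / 2)^-1)).
    by rewrite lef_pV2 ?posrE ?divr_gt0 //; lra.
  have -> : (x / 2)^-1 = (((x / 2) ^+ 4)^-1) `^ 4^-1.
    rewrite -exprVn -powR_mulrn ?invr_ge0 ?divr_ge0 ?(ltW x0) // -powRrM divff //.
    by rewrite powRr1 // invr_ge0 divr_ge0 // ltW.
  by apply: ge0_ler_powR; rewrite ?nnegrE ?invr_ge0 ?exprn_ge0 ?divr_ge0 ?(ltW x0).
have XY : #|X|%:R * #|Y|%:R = M%:R ^+ 2 * x :> R.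
  by rewrite xE mulrCA divff ?mulr1 // expf_neq0 // gt_eqF.
pose P (U : {set 'I_z.+1}) := (U \subset sieve_primes z y) && (qset U <= Q)%N.
pose P' (U : {set 'I_z.+1}) := (U \subset sieve_primes z y) && (Q < qset U <= z ^ 2)%N.
have split_sum n : selberg R z y n ^+ 2 = \sum_(U | P U) wset R y U * vset R n U
    + \sum_(U | P' U) wset R y U * vset R n U.
  rewrite selberg_sqr (bigID P) /=; congr (_ + _).
  rewrite [LHS]big_mkcond [RHS]big_mkcond; apply: eq_bigr => U _.
  rewrite /P /P' negb_and -ltnNge; case: (eqVneq (wset R y U) 0) => [->|/wset_supp /andP[-> ->]].
    by rewrite mul0r; case: ifP; case: ifP.
  by rewrite /= andbT.
have sxp t : 0 < x `^ t by rewrite powR_gt0.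
have xD t t' : x `^ t * x `^ t' = x `^ (t + t').
  by rewrite powRD // (gt_eqF x0) implybT.
have major : \sum_(u in X) \sum_(a in Y) \sum_(U | P U) wset R y U * vset R (b + y * (u + a)) U
   <= C1 * C32 * (1 + 3 * C2 * C32) * D2 * 2 / G * M%:R ^+ 2 * x `^ s.
  pose c t := tau_trunc R z y Q (b + y * t).
  have c0 t : 0 <= c t by apply: tau_trunc_ge0.
  (* This threshold balances both parts: lam x and x^(1/2) lam^(-(k - 1)) both equal x^(1 - 1/(2
     k)). *)
  pose lam := x `^ (- (2 * k%:R)^-1); have l0 : 0 < lam by exact: sxp.
  have sc : \sum_(u in X) \sum_(a in Y) c (u + a)%N <=
      M%:R ^+ 2 * x `^ (1 - (2 * k%:R)^-1) * (1 + 3 * C2 * Q%:R `^ e).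
    apply: (@le_trans _ _ (\sum_(u in X) \sum_(a in Y) (lam + c (u + a)%N ^+ k * (lam ^+ k.-1)^-1))).
      by apply: ler_sum => u _; apply: ler_sum => a _; apply: threshold_pow.
    under eq_bigr do rewrite big_split /= sumr_const -mulr_suml.
    rewrite big_split /= sumr_const -mulr_suml mulrDr lerD //.
      rewrite mulr1 -mulrnA -[leLHS]mulr_natr mulnC natrM XY /lam mulrCA ler_wpM2l //.
      by rewrite -{2}[x]powRr1 ?(ltW x0) // mulrC xD.
    have MT : (M + 2 * M <= 3 * M)%N by rewrite -{1}[M]mul1n -mulnDl.
    have hh := hankel_sum_le X Y (fun t => exprn_ge0 k (c0 t)) MT.
    apply: le_trans (ler_wpM2r _ hh) _; first by rewrite invr_ge0 exprn_ge0 // ltW.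
    rewrite XY sqrtrM ?exprn_ge0 // sqrtr_sqr ger0_norm // -powR12_sqrt ?(ltW x0) //.
    have QM : (Q ^ k <= 3 * M)%N.
      by apply: leq_trans Qz _; apply: leq_trans zM1 _; rewrite leq_pmull.
    apply: le_trans (ler_wpM2r _ (ler_wpM2l _ (H2 z y b Q _ Q0 QM))) _.
    - by rewrite invr_ge0 exprn_ge0 // ltW.
    - by rewrite mulr_ge0 ?powR_ge0.
    rewrite natrM.
    have -> : (lam ^+ k.-1)^-1 = x `^ (2^-1 - (2 * k%:R)^-1).
      rewrite /lam -powR_mulrn ?powR_ge0 // -powRrM -powRN; congr (_ `^ _).
      have -> : k%:R = k.-1%:R + 1 :> R by rewrite natr1 prednK.
      have : 0 <= k.-1%:R :> R by [].
      move: (k.-1%:R : R) => q q0.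
      by field; lra.
    rewrite [leLHS](_ : _ = M%:R ^+ 2 * (x `^ 2^-1 * x `^ (2^-1 - (2 * k%:R)^-1)) * (3 * C2 * Q%:R `^ e)); last by ring.
    by rewrite xD addrA [2^-1 + 2^-1](_ : _ = 1) //; field.
  apply: (@le_trans _ _ (\sum_(u in X) \sum_(a in Y) C1 / G * Q%:R `^ e * c (u + a)%N)).
    apply: ler_sum => u _; apply: ler_sum => a _.
    apply: le_trans (H1 z y _ Q z0 Q0); apply: ler_sum => U _.
    by rewrite -normrM ler_norm.
  under eq_bigr do rewrite -mulr_sumr.
  rewrite -mulr_sumr; apply: le_trans (ler_wpM2l _ sc) _.
    by rewrite mulr_ge0 ?divr_ge0 ?powR_ge0 ?(ltW C10) ?(ltW G0).
  have qe0 : 0 <= Q%:R `^ e := powR_ge0 _ _.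
  have q8 : Q%:R `^ e * x `^ (1 - (2 * k%:R)^-1) * (1 + 3 * C2 * Q%:R `^ e) <=
      C32 * (1 + 3 * C2 * C32) * D2 * (2 * x `^ s).
    have xx : x `^ (1 - (2 * k%:R)^-1 - 8 * e) <= 2 * x `^ s.
      apply: powR_le_double => //; first by rewrite (ltW x0).
        by rewrite /e; lra.
      have : 0 <= (2 * k%:R)^-1 :> R by rewrite invr_ge0 mulr_ge0.
      lra.
    have xn : 1 <= D2 * x `^ (- (4 * e)).
      rewrite /D2 powRN ler_pdivlMr // mul1r; apply: ge0_ler_powR; rewrite ?nnegrE ?(ltW x0) //.
      by rewrite mulr_ge0 // ltW.
    have q1 : 1 + 3 * C2 * Q%:R `^ e <= (1 + 3 * C2 * C32) * (D2 * x `^ (- (4 * e))).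
      have h2 : 1 <= 2 `^ (4 * e) :> R by apply: powR_ge1; [rewrite ler1n|rewrite mulr_ge0 ?(ltW e0)].
      rewrite [leRHS]mulrDl mul1r lerD // -!mulrA ler_wpM2l // ler_wpM2l ?(ltW C20) //.
      apply: le_trans Qe _; rewrite ler_wpM2l ?(ltW C320) // ler_peMl // ltW //.
    apply: (@le_trans _ _ (C32 * x `^ (- (4 * e)) * x `^ (1 - (2 * k%:R)^-1) *
        ((1 + 3 * C2 * C32) * (D2 * x `^ (- (4 * e)))))).
      apply: ler_pM => //; first by rewrite mulr_ge0 ?powR_ge0.
        by rewrite addr_ge0 ?mulr_ge0 ?(ltW C20).
      by rewrite ler_wpM2r ?powR_ge0.
    rewrite [leLHS](_ : _ = C32 * (1 + 3 * C2 * C32) * D2 *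
       (x `^ (1 - (2 * k%:R)^-1) * x `^ (- (4 * e)) * x `^ (- (4 * e)))); last by ring.
    rewrite !xD [_ - 4 * e - 4 * e](_ : _ = 1 - (2 * k%:R)^-1 - 8 * e); last by ring.
    by rewrite ler_wpM2l // !mulr_ge0 ?addr_ge0 ?mulr_ge0 ?(ltW C320) ?(ltW C20) ?(ltW D20).
  rewrite [leLHS](_ : _ = C1 / G * M%:R ^+ 2 * (Q%:R `^ e * x `^ (1 - (2 * k%:R)^-1) * (1 + 3 * C2 * Q%:R `^ e))); last by ring.
  rewrite [leRHS](_ : _ = C1 / G * M%:R ^+ 2 * (C32 * (1 + 3 * C2 * C32) * D2 * (2 * x `^ s))); last by ring.
  by rewrite ler_wpM2l // mulr_ge0 ?exprn_ge0 // divr_ge0 ?(ltW C10) ?(ltW G0).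
have minor : \sum_(u in X) \sum_(a in Y) \sum_(U | P' U) wset R y U * vset R (b + y * (u + a)) U
   <= Num.sqrt (2 * C3) * 2 / G * M%:R ^+ 2 * x `^ s.
  have z2 : (z ^ 2 <= 2 * M)%N.
    apply: leq_trans (leq_pmull _ _) => //; apply: leq_trans zM.
    by rewrite leq_pexp2l.
  have := H3 z y b Q M (2 * M)%N X Y _ zM z2; rewrite Q0 Qz1 => /(_ isT).
  set L := \sum_(u in X) _; rewrite -[C3 * _ * _]mulrA XY => h.
  have x1 : x <= 2 * x `^ s.
    by rewrite -{1}[x]powRr1 ?(ltW x0) // powR_le_double // ?(ltW x0) // ltW.
  apply: (@le_trans _ _ (Num.sqrt (2 * C3) / G * M%:R ^+ 2 * x)); last first.
    rewrite [leRHS](_ : _ = Num.sqrt (2 * C3) / G * M%:R ^+ 2 * (2 * x `^ s)); last by ring.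
    by rewrite ler_wpM2l // mulr_ge0 ?exprn_ge0 // divr_ge0 ?sqrtr_ge0 ?(ltW G0).
  apply: le_trans (ler_norm _) _; rewrite -(@ler_pXn2r _ 2) ?nnegrE ?normr_ge0 //; last first.
    by rewrite !mulr_ge0 ?exprn_ge0 ?sqrtr_ge0 ?invr_ge0 ?(ltW G0) ?(ltW x0).
  rewrite real_normK ?num_real //; apply: le_trans h _.
  have -> : (Num.sqrt (2 * C3) / G * M%:R ^+ 2 * x) ^+ 2 =
     2 * C3 * (M%:R ^+ 2) ^+ 2 * (x * x) / G ^+ 2.
    by rewrite !exprMn sqr_sqrtr ?mulr_ge0 ?(ltW C30) // exprVn; ring.
  rewrite natrM [leLHS](_ : _ = 2 * C3 * (M%:R ^+ 2) ^+ 2 * (x * Q%:R `^ (- 4^-1)) / G ^+ 2); last by ring.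
  rewrite ler_wpM2r ?invr_ge0 ?exprn_ge0 ?(ltW G0) // ler_wpM2l ?mulr_ge0 ?exprn_ge0 ?(ltW C30) //.
  by rewrite ler_wpM2l ?(ltW x0).
under eq_bigr do under eq_bigr do rewrite split_sum.
under eq_bigr do rewrite big_split /=.
rewrite big_split /=; apply: le_trans (lerD major minor) _.
by rewrite /CC -!mulrDl.
Qed.

End SelbergForm.

(** * The prime kernel on sets *)

Section PrimeKernel.
Variable R : realType.
Local Notation Lambda := (@vonMangoldt R).

Lemma vonMangoldt_ge0 n : 0 <= Lambda n.
Proof.
rewrite /vonMangoldt; case E : (primes n) => [|p [|q s]] //.
have : p \in primes n by rewrite E mem_head.
by rewrite mem_primes => /andP[/prime_gt0 p0 _]; rewrite ln_ge0 // ler1n.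
Qed.

(** Powers of primes up to z: the prime powers at which Selberg's form need not equal 1. *)
Definition small_prime_power (z n : nat) : bool :=
  if primes n is [:: p] then (p <= z)%N else false.

Lemma vonMangoldt_le_ln N n : (0 < n < N)%N -> Lambda n <= ln N%:R.
Proof.
move=> /andP[n0 nN]; have N0 : (0 < N)%N by apply: leq_trans nN.
have lN : 0 <= ln N%:R :> R by rewrite ln_ge0 // ler1n.
rewrite /vonMangoldt; case E : (primes n) => [|p [|q s]] //.
have : p \in primes n by rewrite E mem_head.
rewrite mem_primes => /and3P[/prime_gt0 p0 _ pn].
by rewrite ler_ln ?posrE ?ltr0n // ler_nat (leq_trans (dvdn_leq n0 pn)) // ltnW.
Qed.

Lemma vonMangoldt_le_selberg (z y N n : nat) : (0 < z)%N -> (0 < n < N)%N ->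
  Lambda n <= ln N%:R * (selberg R z y n ^+ 2 + (small_prime_power z n)%:R).
Proof.
move=> z0 nN; have lL := vonMangoldt_le_ln nN; have L0 := vonMangoldt_ge0 n.
have lN : 0 <= ln N%:R :> R by apply: le_trans lL.
case E : (primes n) => [|p [|q s]]; try by rewrite {1}/vonMangoldt E mulr_ge0 ?addr_ge0 ?sqr_ge0.
rewrite /small_prime_power E; case: leqP => pz.
  by apply: le_trans lL _; rewrite ler_peMr // lerDr sqr_ge0.
rewrite selberg_rough ?expr1n ?addr0 ?mulr1 // => r rP; apply/negP => rn.
have : (r : nat) \in primes n.
  by rewrite mem_primes rn; case/andP: nN => ->; move: rP; rewrite inE => /andP[->].
by rewrite E inE => /eqP rp; move: (ltn_ord r); rewrite rp ltnS leqNgt pz.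
Qed.

(** Such an n is determined by its prime, at most z, and its exponent. The exponent is below 52 z
    because 2 to it is at most n, while (z + 1)^52 <= 2^(52 z). *)
Lemma card_small_prime_power (z N : nat) : (0 < z)%N -> (N <= z.+1 ^ 52)%N ->
  \sum_(n < N) (small_prime_power z n)%:R <= 104 * z%:R ^+ 2 :> R.
Proof.
move=> z0 Nz; pose P (n : nat) := head 0%N (primes n).
have PE n : small_prime_power z n -> [/\ (P n <= z)%N, prime (P n), (0 < n)%N & n = (P n ^ logn (P n) n)%N].
  rewrite /small_prime_power /P; case E : (primes n) => [|p [|q s]] //= pz.
  have : p \in primes n by rewrite E mem_head.
  rewrite mem_primes => /and3P[pp n0 pn]; split => //.
  by rewrite {1}(prod_prime_decomp n0) prime_decompE E /= big_cons big_nil muln1.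
have LE (n : 'I_N) : small_prime_power z n -> (logn (P n) n < 52 * z)%N.
  move=> /PE[_ pp n0 nE]; rewrite -(@ltn_exp2l 2) //.
  apply: (@leq_ltn_trans n); first by rewrite [leqRHS]nE; case: (logn _ _) => // e; rewrite leq_exp2r ?prime_gt1.
  apply: leq_trans (ltn_ord n) _; apply: leq_trans Nz _.
  by rewrite mulnC expnM leq_exp2r // ltn_expl.
apply: (@le_trans _ _ (\sum_(p : 'I_z.+1 * 'I_(52 * z)) 1)).
  rewrite (eq_bigr (fun n : 'I_N => if small_prime_power z n then 1 else 0 : R)); last first.
    by move=> n _; case: (small_prime_power z n).
  rewrite -big_mkcond /=.
  have z52 : (0 < 52 * z)%N by rewrite muln_gt0.
  apply: (sum_inj_le (h := fun n : 'I_N => (inord (P n) : 'I_z.+1,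
     insubd (Ordinal z52) (logn (P n) n) : 'I_(52 * z)))) => //.
  move=> n n' hn hn' [/(congr1 val) e1 /(congr1 val) e2].
  have [p1 _ _ nE] := PE _ hn; have [p1' _ _ nE'] := PE _ hn'.
  move: e1 e2; rewrite /= !inordK // !val_insubd !LE // => e1 e2.
  by apply/val_inj => /=; rewrite nE nE' e2 e1.
rewrite sumr_const card_prod !card_ord natrM [(52 * z)%:R]natrM -natr1.
have z1 : 1 <= z%:R :> R by rewrite ler1n.
move: (z%:R : R) z1 => t t1; nra.
Qed.

Lemma powR_root_le (m N z : nat) : (0 < m)%N -> (N <= z.+1 ^ m)%N ->
  N%:R `^ m%:R^-1 <= z%:R + 1 :> R.
Proof.
move=> m0 Nz; have -> : z%:R + 1 = ((z.+1 ^ m)%:R) `^ m%:R^-1 :> R.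
  by rewrite natrX -powR_mulrn // -powRrM divff ?pnatr_eq0 -?lt0n // powRr1 // natr1.
by apply: ge0_ler_powR; rewrite ?nnegrE // ler_nat.
Qed.

Lemma log_pow_small (c d : R) : 0 < c -> 0 < d -> exists N0 : R,
  forall N z : nat, N0 <= N%:R -> (0 < N)%N -> (N <= z.+1 ^ 52)%N ->
  c * (ln N%:R) `^ d <= z%:R.
Proof.
(* With t = N^(1/104), the logarithm raised to d is at most e^-d t, while t^2 <= z + 1. Once t >= c'
   + 1 this gives c' t <= t^2 - t <= z. *)
move=> c0 d0; pose e := (104 * d)^-1; have e0 : 0 < e by rewrite invr_gt0 mulr_gt0.
have ed : e * d = 104^-1 by rewrite /e invfM -mulrA mulVf ?mulr1 // gt_eqF.
clearbody e; pose c' := c * (e^-1) `^ d; have c'0 : 0 < c' by rewrite mulr_gt0 //; apply: powR_gt0; rewrite invr_gt0.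
exists ((c' + 1) ^+ 104) => N z NN N0 Nz.
have Np : 0 < N%:R :> R by rewrite ltr0n.
have lN : 0 <= ln N%:R :> R by rewrite ln_ge0 // ler1n.
pose t : R := N%:R `^ 104^-1.
have t0 : 0 < t by apply: powR_gt0.
have tc : c' + 1 <= t.
  have -> : c' + 1 = ((c' + 1) ^+ 104) `^ 104^-1.
    by rewrite -powR_mulrn ?addr_ge0 ?(ltW c'0) // -powRrM divff // powRr1 // addr_ge0 // ltW.
  by apply: ge0_ler_powR; rewrite ?nnegrE ?exprn_ge0 ?addr_ge0 ?(ltW c'0).
have h1 : c * (ln N%:R) `^ d <= c' * t.
  rewrite /c' -mulrA ler_wpM2l ?(ltW c0) //.
  have -> : t = (N%:R `^ e) `^ d.
    by rewrite -powRrM ed.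
  rewrite -powRM ?invr_ge0 ?powR_ge0 ?(ltW e0) //.
  apply: ge0_ler_powR; rewrite ?nnegrE ?(ltW d0) ?mulr_ge0 ?invr_ge0 ?powR_ge0 ?(ltW e0) //.
  rewrite ler_pdivlMl // -ln_powR; apply: le_trans (ln_le_subr1 _) _; first exact: powR_gt0.
  by rewrite gerBl.
have h2 : t ^+ 2 <= z%:R + 1.
  have -> : t ^+ 2 = N%:R `^ 52^-1.
    rewrite /t -powR_mulrn ?powR_ge0 // -powRrM; congr (_ `^ _); lra.
  exact: (@powR_root_le 52 N z isT Nz).
apply: le_trans h1 _; nra.
Qed.

Lemma selberg_eq (z y n n' : nat) :
  (forall p : 'I_z.+1, p \in sieve_primes z y -> (p %| n)%N = (p %| n')%N) ->
  selberg R z y n = selberg R z y n'.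
Proof.
move=> h; congr (_ * _); apply: eq_bigr => A; rewrite inE => /andP[/subsetP AP _].
by congr (_ * _); apply: eq_bigr => p /AP /h e; rewrite /vloc e.
Qed.

Lemma root_bracket (M k : nat) : (0 < M)%N -> (0 < k)%N ->
  exists z, (0 < z)%N && (z ^ k <= M < z.+1 ^ k)%N.
Proof.
move=> M0 k0.
have ex : exists z, (z ^ k <= M)%N by exists 0%N; rewrite exp0n.
have bd z : (z ^ k <= M)%N -> (z <= M)%N.
  by apply: leq_trans; case: z => // z; rewrite -{1}[z.+1]expn1 leq_pexp2l.
case: (ex_maxnP ex bd) => z hz zmax; exists z.
apply/andP; split; first by apply: zmax; rewrite exp1n.
by rewrite hz /= ltnNge; apply/negP => /zmax; rewrite ltnn.
Qed.

(** Here u and a number the points of one residue class modulo y, so a - u is the step along the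
    progression. The range 2 M contains a block of length M shifted by any step below M; the guard
    [u <= a] excludes truncated subtraction. *)
Definition prime_kernel (N y b M : nat) (u : 'I_M) (a : 'I_(2 * M)) : R :=
  if (u <= a)%N && (b + y * (a - u) < N)%N
  then (totient y)%:R / N%:R * Lambda (b + y * (a - u)) else 0.

Lemma totient_le y : (0 < y)%N -> (totient y <= y)%N.
Proof.
by move=> y0; rewrite totient_count_coprime big_mkord -[leqRHS]card_ord -sum1_card; apply: leq_sum => i _; case: coprime.
Qed.

(* Reversing u turns the Toeplitz kernel a - u into a Hankel one; adding the
   multiple z! M of all sieving primes avoids negative arguments. *)
Lemma selberg_reflect (z y b M : nat) (u : 'I_M) (a : nat) : (u <= a)%N ->
  selberg R z y (b + y * (z`! * M - M.-1) + y * (rev_ord u + a))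
    = selberg R z y (b + y * (a - u)).
Proof.
move=> ua; apply: selberg_eq => p; rewrite inE => /andP[pp _].
have pz : (p %| z`!)%N by rewrite dvdn_fact // prime_gt0 //= -ltnS ltn_ord.
have uM := ltn_ord u; have PM : (M <= z`! * M)%N by rewrite leq_pmull // fact_gt0.
have -> : (b + y * (z`! * M - M.-1) + y * (rev_ord u + a) = b + y * (a - u) + y * (z`! * M))%N.
  by rewrite -addnA -mulnDr -addnA -mulnDr /=; congr (_ + _ * _)%N; lia.
by rewrite dvdn_addl // dvdn_mull // dvdn_mulr.
Qed.

(** If log N <= x^(s - 1), the trivial bound M x log N is already at most M x^s up to a constant.
    Otherwise 1 / x is below (log N)^(1/(1 - s)), so Q^k is below z and the Selberg form applies. *)
Lemma prime_kernel_bound (s : R) : 0 < s -> s < 1 -> exists (C N0 : R), 0 < C /\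
  forall (N y b M : nat), (0 < y)%N -> (0 < b)%N -> N0 <= N%:R -> (y ^ 2 <= N)%N ->
  (N <= y * M)%N -> (y * M <= 2 * N)%N ->
  forall (X : {set 'I_M}) (Y : {set 'I_(2 * M)}),
  \sum_(u in X) \sum_(a in Y) prime_kernel N y b u a
    <= C * M%:R * (#|X|%:R * #|Y|%:R / M%:R ^+ 2) `^ s.
Proof.
move=> s0 s1; have [k [C5 [k0 C50 HS]]] := selberg_sum_le s0 s1.
have os : 0 < 1 - s by rewrite subr_gt0.
have kR : 0 < k%:R :> R by rewrite ltr0n.
(* Chosen so that Q <= 32 x^-4 <= 32 (log N)^(4/(1 - s)) gives Q^k <= 32^k (log N)^d, which is at
   most z. *)
pose d : R := 4 * k%:R / (1 - s).
have d0 : 0 < d by rewrite divr_gt0 // mulr_gt0.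
have [N0 HN0] := @log_pow_small (32 ^+ k) d (exprn_gt0 _ (ltr0n _ 32)) d0.
exists (2 + 104 * C5 + 208), (Num.max (expR 1) N0).
split; first by rewrite !addr_gt0 // mulr_gt0.
move=> N y b M y0 b0; rewrite ge_max => /andP[Ne NN0] yN NyM yMN X Y.
have Np : 0 < N%:R :> R by apply: lt_le_trans Ne; exact: expR_gt0.
have N1 : (0 < N)%N by rewrite -(ltr0n R).
have M1 : (0 < M)%N by rewrite lt0n; apply: contraTneq NyM => ->; rewrite muln0 -ltnNge.
have Mp : 0 < M%:R :> R by rewrite ltr0n.
set l := ln N%:R : R.
have l1 : 1 <= l by rewrite -[leLHS]expRK ler_ln ?posrE ?expR_gt0.
have l0 : 0 < l by apply: lt_le_trans l1.
have yp : 0 < y%:R :> R by rewrite ltr0n.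
have yN2 : y%:R / N%:R <= 2 / M%:R :> R.
  rewrite ler_pdivrMr // mulrAC ler_pdivlMr // -!natrM ler_nat //.
set c0 : R := (totient y)%:R / N%:R.
have c00 : 0 <= c0 by rewrite divr_ge0.
have c0y : c0 <= 2 / M%:R.
  by apply: le_trans yN2; rewrite ler_wpM2r ?invr_ge0 // ler_nat totient_le.
pose x : R := #|X|%:R * #|Y|%:R / M%:R ^+ 2.
have XY : #|X|%:R * #|Y|%:R = M%:R ^+ 2 * x :> R.
  by rewrite /x mulrCA divff ?mulr1 // expf_neq0 // gt_eqF.
have x2 : x <= 2.
  rewrite /x ler_pdivrMr ?exprn_gt0 // -natrX -!natrM ler_nat.
  have := max_card (mem X); have := max_card (mem Y); rewrite !card_ord => hY hX.
  by rewrite -mulnn mulnCA leq_mul.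
have x0 : 0 <= x by rewrite divr_ge0 ?mulr_ge0 ?exprn_ge0.
rewrite -/x; clearbody x.
have C0 : 0 < 2 + 104 * C5 + 208 by rewrite !addr_gt0 // mulr_gt0.
have npos (u : 'I_M) (a : 'I_(2 * M)) : (0 < b + y * (a - u))%N by rewrite addn_gt0 b0.
have triv : \sum_(u in X) \sum_(a in Y) prime_kernel N y b u a <= M%:R ^+ 2 * x * (c0 * l).
  rewrite -XY -mulrA mulr_natl -sumr_const; apply: ler_sum => u _.
  rewrite mulr_natl -sumr_const; apply: ler_sum => a _; rewrite /prime_kernel.
  case: ifP => [/andP[_ nN]|_]; last by rewrite mulr_ge0 // ltW.
  by rewrite ler_wpM2l // vonMangoldt_le_ln // npos.
have [x00|xn0] := eqVneq x 0.
  apply: le_trans triv _; rewrite x00 mulr0 mul0r mulr_ge0 ?powR_ge0 //.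
  by rewrite mulr_ge0 // ltW.
have xp : 0 < x by rewrite lt_def xn0.
have xs0 : 0 < x `^ s by rewrite powR_gt0.
have [lx|xl] := leP l (x `^ (s - 1)).
  apply: le_trans triv _.
  apply: (@le_trans _ _ (M%:R ^+ 2 * x * (2 / M%:R * x `^ (s - 1)))).
    by rewrite ler_wpM2l ?mulr_ge0 ?exprn_ge0 // ler_pM // ltW.
  rewrite [leLHS](_ : _ = 2 * M%:R * (x * x `^ (s - 1))); last by field; rewrite gt_eqF.
  rewrite -{1}[x]powRr1 // -powRD ?(gt_eqF xp) ?implybT // subrKC.
  rewrite ler_wpM2r ?(ltW xs0) // ler_wpM2r // -addrA lerDl.
  by rewrite addr_ge0 // mulr_ge0 // ltW.
pose al := (1 - s)^-1; have al0 : 0 < al by rewrite invr_gt0.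
have xi : x^-1 <= l `^ al.
  have -> : x^-1 = (x `^ (s - 1)) `^ al.
    rewrite -powRrM -powR_inv1 // /al; congr (_ `^ _); field; lra.
  by apply: ge0_ler_powR; rewrite ?nnegrE ?powR_ge0 ?(ltW al0) ?(ltW l0) // ltW.
(* The sieve level is the integer 26th root of M, which provides z^13 <= M. Since y^2 <= N <= y M,
   also N <= M^2, whence N <= (z + 1)^52 and log N <= 52 log (z + 1). *)
have [z /andP[z0 /andP[zM Mz]]] := @root_bracket M 26 M1 isT.
have Nz : (N <= z.+1 ^ 52)%N.
  have NM : (N <= M ^ 2)%N.
    rewrite -(leq_pmul2l N1); apply: (@leq_trans (y ^ 2 * M ^ 2)).
      by rewrite -expnMn mulnn leq_exp2r.
    by rewrite leq_mul2r yN orbT.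
  apply: leq_trans NM _; rewrite [52%N](_ : _ = 26 * 2)%N // expnM leq_exp2r //.
  exact: ltnW.
have zbig := HN0 N z NN0 N1 Nz; rewrite -/l in zbig.
have zR : 0 < z%:R :> R by rewrite ltr0n.
have lz : l `^ al <= z%:R.
  apply: le_trans zbig; apply: (@le_trans _ _ (l `^ d)).
    rewrite ler_powR // /d /al ler_peMl ?invr_ge0 ?(ltW os) //.
    have : 1 <= k%:R :> R by rewrite ler1n.
    lra.
  by rewrite ler_peMl ?powR_ge0 // exprn_ege1 // ler1n.
have x4 : (x ^+ 4)^-1 <= l `^ (4 * al).
  rewrite -exprVn mulrC powRrM powR_mulrn ?powR_ge0 // lerXn2r ?nnegrE ?invr_ge0 ?powR_ge0 //.
(* As x / 2 <= 1 the rounded quantity is at least 1, so rounding up at most doubles it; 2 . 16 gives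
   the 32. *)
pose Q := (Num.truncn ((x / 2) ^+ 4)^-1).+1.
have x21 : 1 <= ((x / 2) ^+ 4)^-1.
  rewrite invf_ge1 ?exprn_gt0 ?divr_gt0 // exprn_ile1 ?divr_ge0 // ler_pdivrMr // mul1r //.
have Qlo : ((x / 2) ^+ 4)^-1 <= Q%:R by rewrite ltW // truncnS_gt.
have Qhi : Q%:R <= 32 * (x ^+ 4)^-1.
  have : Q%:R <= ((x / 2) ^+ 4)^-1 + 1.
    by rewrite /Q -natr1 lerD2r truncn_le // (le_trans ler01).
  have -> : 32 * (x ^+ 4)^-1 = 2 * ((x / 2) ^+ 4)^-1 by field; rewrite gt_eqF.
  lra.
have Q0 : (0 < Q)%N by [].
clearbody Q.
have Qz : (Q ^ k <= z)%N.
  rewrite -(ler_nat R) natrX; apply: le_trans zbig.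
  apply: (@le_trans _ _ ((32 * l `^ (4 * al)) ^+ k)).
    rewrite lerXn2r ?nnegrE ?mulr_ge0 ?powR_ge0 //.
    by apply: le_trans Qhi _; rewrite ler_wpM2l.
  rewrite exprMn -[(l `^ _) ^+ k]powR_mulrn ?powR_ge0 // -powRrM.
  by rewrite le_eqVlt; apply/orP; left; apply/eqP; congr (_ * _ `^ _); rewrite /d /al mulrAC.
have zM13 : (z ^ 13 <= M)%N by apply: leq_trans zM; rewrite leq_pexp2l.
have zM3 : (z ^ 3 <= M)%N by apply: leq_trans zM; rewrite leq_pexp2l.
set G := sieve_mass R z y; have G0 : 0 < G by apply: sieve_mass_gt0.
have phiG : (totient y)%:R * l <= 52 * y%:R * G.
  have tp : 0 < (totient y)%:R :> R by rewrite ltr0n totient_gt0.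
  have := sieve_mass_ge R z y0; rewrite -/G mulrAC ler_pdivlMr // => h.
  have l52 : l <= 52 * ln z.+1%:R.
    have := Nz; rewrite -(ler_nat R) natrX => h'.
    rewrite mulr_natl -lnXn ?ltr0n // ler_ln ?posrE ?exprn_gt0 ?ltr0n //.
  rewrite -mulrA; apply: (@le_trans _ _ (52 * (ln z.+1%:R * (totient y)%:R))); last first.
    by rewrite ler_wpM2l.
  by rewrite mulrA mulrC ler_wpM2r.
pose b' := (b + y * (z`! * M - M.-1))%N.
pose X' := [set rev_ord u | u in X].
have cX' : #|X'| = #|X| by rewrite card_imset //; exact: rev_ord_inj.
have := HS z y b' Q M X' Y; rewrite /= cX' {1 2 3 4 5}XY.
have -> : M%:R ^+ 2 * x / M%:R ^+ 2 = x by rewrite mulrAC divff ?mul1r // expf_neq0 // gt_eqF.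
move=> /(_ xp x2 Q0 Qz zM13 Qlo Qhi); rewrite -/G big_imset /=; last by move=> u u' _ _; apply: rev_ord_inj.
move=> HSel.
pose pp (u : 'I_M) (a : 'I_(2 * M)) : R :=
  [&& (u <= a)%N, (b + y * (a - u) < N)%N & small_prime_power z (b + y * (a - u))]%:R.
have HPP : \sum_(u in X) \sum_(a in Y) pp u a <= M%:R * (104 * z%:R ^+ 2).
  apply: (@le_trans _ _ (#|X|%:R * (104 * z%:R ^+ 2))); last first.
    rewrite ler_wpM2r ?mulr_ge0 ?exprn_ge0 // ler_nat.
    by have := max_card (mem X); rewrite card_ord.
  rewrite mulr_natl -sumr_const; apply: ler_sum => u _.
  apply: le_trans (card_small_prime_power z0 Nz).
  rewrite (eq_bigr (fun a : 'I_(2 * M) => if [&& (u <= a)%N, (b + y * (a - u) < N)%N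
     & small_prime_power z (b + y * (a - u))] then 1 else 0 : R)); last first.
    by move=> a _; rewrite /pp; case: ifP.
  rewrite -big_mkcondr /=.
  apply: (sum_inj_le (h := fun a : 'I_(2 * M) => insubd (Ordinal N1) (b + y * (a - u))%N : 'I_N)) => //.
    move=> a a' /andP[_ /and3P[ua aN _]] /andP[_ /and3P[ua' aN' _]] /(congr1 val).
    rewrite !val_insubd aN aN' => /addnI /eqP; rewrite eqn_pmul2l // => /eqP e.
    by apply/val_inj => /=; rewrite -(subnK ua) -(subnK ua') e.
  by move=> a /andP[_ /and3P[ua aN sp]]; rewrite val_insubd aN sp.
have ptw (u : 'I_M) (a : 'I_(2 * M)) : prime_kernel N y b u a <=
    c0 * l * (selberg R z y (b' + y * (rev_ord u + a)) ^+ 2 + pp u a).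
  rewrite /prime_kernel /pp; case: ifP => [/andP[ua nN]|_]; last first.
    by rewrite mulr_ge0 ?addr_ge0 ?sqr_ge0 // mulr_ge0 // ltW.
  rewrite selberg_reflect // ua nN /= -[leRHS]mulrA ler_wpM2l //.
  by apply: vonMangoldt_le_selberg => //; rewrite npos.
apply: (@le_trans _ _ (\sum_(u in X) \sum_(a in Y)
    c0 * l * (selberg R z y (b' + y * (rev_ord u + a)) ^+ 2 + pp u a))).
  by apply: ler_sum => u _; apply: ler_sum => a _.
under eq_bigr do rewrite -mulr_sumr big_split /=.
rewrite -mulr_sumr big_split /= mulrDr.
have part1 : c0 * l * \sum_(u in X) \sum_(a in Y) selberg R z y (b' + y * (rev_ord u + a)) ^+ 2
   <= 104 * C5 * M%:R * x `^ s.
  apply: le_trans (ler_wpM2l _ HSel) _; first by rewrite mulr_ge0 // ltW.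
  (* The cancellation of log N and of phi(y): phi(y) log N <= 52 y G, and y / N <= 2 / M. *)
  have cG : c0 * l / G <= 104 / M%:R.
    rewrite ler_pdivrMr // /c0 mulrAC ler_pdivrMr //.
    apply: le_trans phiG _.
    rewrite [leRHS](_ : _ = 52 * (2 / M%:R * N%:R) * G); last by ring.
    by rewrite ler_wpM2r ?(ltW G0) // ler_wpM2l // -ler_pdivrMr.
  rewrite [leLHS](_ : _ = c0 * l / G * (C5 * M%:R ^+ 2 * x `^ s)); last by ring.
  apply: le_trans (ler_wpM2r _ cG) _; first by rewrite !mulr_ge0 ?exprn_ge0 ?powR_ge0 // ltW.
  by rewrite le_eqVlt; apply/orP; left; apply/eqP; field; rewrite gt_eqF.
have part2 : c0 * l * \sum_(u in X) \sum_(a in Y) pp u a <= 208 * M%:R * x `^ s.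
  apply: le_trans (ler_wpM2l _ HPP) _; first by rewrite mulr_ge0 // ltW.
  apply: (@le_trans _ _ (2 / M%:R * l * (M%:R * (104 * z%:R ^+ 2)))).
    by rewrite ler_wpM2r ?mulr_ge0 ?exprn_ge0 // ler_wpM2r // ltW.
  rewrite [leLHS](_ : _ = 208 * (l * z%:R ^+ 2)); last by field; rewrite gt_eqF.
  rewrite -mulrA ler_wpM2l //.
  (* Here x^-s <= (log N)^(s/(1 - s)), and 1 + s/(1 - s) = 1/(1 - s) is an exponent for which z
     already dominates. With z^3 <= M this disposes of the small prime powers. *)
  have lzx : l <= z%:R * x `^ s.
    rewrite -ler_pdivrMr // -powRN; apply: le_trans lz.
    have -> : x `^ (- s) = (x^-1) `^ s by rewrite -powR_inv1 // -powRrM mulN1r.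
    apply: (@le_trans _ _ (l * (l `^ al) `^ s)).
      rewrite ler_wpM2l ?(ltW l0) //.
      by apply: ge0_ler_powR; rewrite ?nnegrE ?invr_ge0 ?powR_ge0 ?(ltW s0).
    rewrite -powRrM -{1}[l]powRr1 ?(ltW l0) // -powRD ?(gt_eqF l0) ?implybT //.
    rewrite le_eqVlt; apply/orP; left; apply/eqP; congr (_ `^ _); rewrite /al; field; lra.
  apply: (@le_trans _ _ (z%:R * x `^ s * z%:R ^+ 2)).
    by rewrite ler_wpM2r // exprn_ge0.
  rewrite mulrAC -exprS ler_wpM2r ?(ltW xs0) //.
  by rewrite -natrX ler_nat.
apply: le_trans (lerD part1 part2) _.
rewrite -!mulrDl ler_wpM2r ?(ltW xs0) // ler_wpM2r //; lra.
Qed.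

End PrimeKernel.

(** * From sets in blocks to functions on the integers *)

Section GlobalBound.
Variable R : realType.
Local Notation Lambda := (@vonMangoldt R).

(** After normalising both sums to 1, (p q)^rho <= sqrt(p q) <= (p + q) / 2 because rho >= 1/2. With
    rho = 1/r this adds up the bounds of the separate blocks. *)
Lemma sum_powR_pair_le (T : finType) (al be : T -> R) (rho : R) :
  2^-1 <= rho -> rho <= 1 -> (forall j, 0 <= al j) -> (forall j, 0 <= be j) ->
  \sum_j al j `^ rho * be j `^ rho <= (\sum_j al j) `^ rho * (\sum_j be j) `^ rho.
Proof.
move=> r1 r2 a0 b0; have rho0 : 0 < rho by lra.
have A0 : 0 <= \sum_j al j by apply: sumr_ge0.
have B0 : 0 <= \sum_j be j by apply: sumr_ge0.
have zero (q : T -> R) : (forall j, 0 <= q j) -> \sum_j q j = 0 -> forall j, q j = 0.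
  move=> q0 /eqP; rewrite psumr_eq0 => [/allP h j|j _]; last exact: q0.
  by have := h j (mem_index_enum _) => /eqP.
have [A00|An0] := eqVneq (\sum_j al j) 0.
  rewrite big1 ?mulr_ge0 ?powR_ge0 // => j _.
  by rewrite (zero _ a0 A00) powR0 ?mul0r // gt_eqF.
have [B00|Bn0] := eqVneq (\sum_j be j) 0.
  rewrite big1 ?mulr_ge0 ?powR_ge0 // => j _.
  by rewrite (zero _ b0 B00) powR0 ?mulr0 // gt_eqF.
move: A0 B0 An0 Bn0; set A := \sum_j al j; set B := \sum_j be j => A0 B0 An0 Bn0.
have Ap : 0 < A by rewrite lt_def An0.
have Bp : 0 < B by rewrite lt_def Bn0.
have aA j : al j <= A by rewrite /A (bigD1 j) //= lerDl sumr_ge0.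
have bB j : be j <= B by rewrite /B (bigD1 j) //= lerDl sumr_ge0.
have half j : al j `^ rho * be j `^ rho <=
    A `^ rho * B `^ rho * ((al j / A + be j / B) / 2).
  have -> : al j `^ rho * be j `^ rho =
      A `^ rho * B `^ rho * ((al j / A) `^ rho * (be j / B) `^ rho).
    rewrite mulrACA -!powRM ?divr_ge0 // ![_ * (_ / _)]mulrC !divfK //.
  rewrite ler_wpM2l ?mulr_ge0 ?powR_ge0 // -powRM ?divr_ge0 //.
  have : 0 <= al j / A by rewrite divr_ge0.
  have : 0 <= be j / B by rewrite divr_ge0.
  have : al j / A <= 1 by rewrite ler_pdivrMr // mul1r.
  have : be j / B <= 1 by rewrite ler_pdivrMr // mul1r.
  move: (al j / A) (be j / B) => p q q1 p1 q0 p0.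
  have [->|pq] := eqVneq (p * q) 0; first by rewrite powR0 ?gt_eqF //; lra.
  have pq0 : 0 < p * q by rewrite lt_def pq mulr_ge0.
  apply: (@le_trans _ _ (Num.sqrt (p * q))).
    rewrite -powR12_sqrt ?(ltW pq0) //; apply: ger_powR => //; rewrite pq0 /=; nra.
  have s0 := sqrtr_ge0 (p * q); have := sqr_sqrtr (ltW pq0).
  move: (Num.sqrt _) s0 => t t0 tE; rewrite -(@ler_pXn2r _ 2) ?nnegrE //; last by lra.
  by rewrite tE; have := sqr_ge0 (p - q); rewrite !expr2; lra.
apply: (@le_trans _ _ (\sum_j A `^ rho * B `^ rho * ((al j / A + be j / B) / 2))).
  by apply: ler_sum => j _; exact: half.
rewrite -mulr_sumr -[leRHS]mulr1 ler_wpM2l ?mulr_ge0 ?powR_ge0 //.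
rewrite -mulr_suml big_split /= -!mulr_suml -/A -/B !divff //; lra.
Qed.

Definition progression_weight (N y b m : nat) : R :=
  if (b + y * m < N)%N then (totient y)%:R / N%:R * Lambda (b + y * m) else 0.

Lemma progression_weight_ge0 N y b m : 0 <= progression_weight N y b m.
Proof.
rewrite /progression_weight; case: ifP => // _.
by rewrite mulr_ge0 ?divr_ge0 // vonMangoldt_ge0.
Qed.

Lemma sum_window_le (N y b M : nat) (u : 'I_M) (G : nat -> R) :
  (forall a, 0 <= G a) ->
  \sum_(m < M) progression_weight N y b m * G (u + m)%N
    <= \sum_(a < 2 * M) prime_kernel R N y b u a * G a.
Proof.
move=> G0; have lt (m : 'I_M) : (u + m < 2 * M)%N.
  by rewrite mul2n -addnn -addSn leq_add // ltnW.
apply: (sum_inj_le (h := fun m : 'I_M => Ordinal (lt m))) => //.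
- by move=> m m' _ _ /(congr1 val) /= /addnI /val_inj.
- by move=> m _; rewrite /prime_kernel /= leq_addr addKn.
move=> a _; rewrite mulr_ge0 // /prime_kernel; case: ifP => // _.
by rewrite mulr_ge0 ?divr_ge0 // vonMangoldt_ge0.
Qed.

Lemma sum_shift_le (g : nat -> R) (L s : nat) (Gam : R) : (forall t, 0 <= g t) ->
  (forall n, \sum_(t < n) g t <= Gam) -> \sum_(t < L) g (t + s)%N <= Gam.
Proof.
move=> g0 gG; apply: le_trans (gG (L + s)%N).
have lt (t : 'I_L) : (t + s < L + s)%N by rewrite ltn_add2r.
apply: (sum_inj_le (h := fun t : 'I_L => Ordinal (lt t))) => //.
by move=> t t' _ _ /(congr1 val) /= /addIn /val_inj.
Qed.

(** Writing z = (i M + u) y + c splits the integers into pieces, one for each block i and class c.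
    Adding y m + b keeps the class up to the fixed shift b and moves u to u + m < 2 M, so pieces do
    not interact on the F side. The windows for g overlap twice, whence 2 [Gam]. *)
Lemma bilinear_global (r eta C : R) (N y b M : nat) :
  1 < r -> r < 2 -> 0 < eta -> 2^-1 <= r^-1 - eta -> r^-1 + eta <= 1 -> 0 <= C ->
  (0 < M)%N ->
  (forall (X : {set 'I_M}) (Y : {set 'I_(2 * M)}) s,
    s = r^-1 - eta \/ s = r^-1 + eta ->
    \sum_(u in X) \sum_(a in Y) prime_kernel R N y b u a
     <= C * M%:R * (#|X|%:R * #|Y|%:R / M%:R ^+ 2) `^ s) ->
  forall (K : nat) (F g : nat -> R) (Gam : R),
  (forall z, 0 <= F z) -> (forall z, 0 <= g z) ->
  (forall n, \sum_(t < n) g t `^ r <= Gam) ->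
  \sum_(z < K * M * y) \sum_(m < M) progression_weight N y b m * F z * g (z + y * m + b)%N
   <= interp_const r eta * (C * M%:R) * (M%:R ^+ 2) `^ (- r^-1) *
      ((\sum_(z < K * M * y) F z `^ r) `^ r^-1 * (2 * Gam) `^ r^-1).
Proof.
move=> r1 r2 e0 e1 e2 C0 M0 HB K F g Gam F0 g0 gG.
have r0 : 0 < r by lra.
have MR : 0 < M%:R :> R by rewrite ltr0n.
pose cons := interp_const r eta * (C * M%:R) * (M%:R ^+ 2) `^ (- r^-1).
have k0 (u : 'I_M) (a : 'I_(2 * M)) : 0 <= prime_kernel R N y b u a.
  rewrite /prime_kernel; case: ifP => // _.
  by rewrite mulr_ge0 ?divr_ge0 // vonMangoldt_ge0.
pose J : finType := ('I_K * 'I_y)%type.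
pose f (j : J) (u : 'I_M) := F ((j.1 * M + u) * y + j.2)%N.
pose gg (j : J) (a : 'I_(2 * M)) := g ((j.1 * M + a) * y + j.2 + b)%N.
have part (H : nat -> R) : \sum_(z < K * M * y) H z =
    \sum_(j : J) \sum_(u < M) H ((j.1 * M + u) * y + j.2)%N.
  rewrite sum_ord_mul (sum_ord_mul (fun w => \sum_(c < y) H (w * y + c)%N)).
  rewrite -(pair_bigA _ (fun (i : 'I_K) (c : 'I_y) => \sum_(u < M) H ((i * M + u) * y + c)%N)) /=.
  by apply: eq_bigr => i _; rewrite exchange_big.
pose al j := \sum_u f j u `^ r; pose be j := \sum_a gg j a `^ r.
have al0 j : 0 <= al j by apply: sumr_ge0 => u _; exact: powR_ge0.
have be0 j : 0 <= be j by apply: sumr_ge0 => u _; exact: powR_ge0.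
have cons0 : 0 <= cons.
  have th1 : 1 <= 2 `^ (r * eta) :> R by apply: powR_ge1; rewrite ?ler1n // mulr_ge0 ?(ltW r0) ?(ltW e0).
  by rewrite /cons /interp_const !mulr_ge0 ?invr_ge0 ?powR_ge0 ?subr_ge0.
apply: (@le_trans _ _ (\sum_(j : J) cons * (al j `^ r^-1 * be j `^ r^-1))).
  rewrite (part (fun z => \sum_(m < M) progression_weight N y b m * F z * g (z + y * m + b)%N)).
  apply: ler_sum => j _.
  apply: (@le_trans _ _ (\sum_u \sum_a prime_kernel R N y b u a * f j u * gg j a)).
    apply: ler_sum => u _.
    have := @sum_window_le N y b M u (fun a => F ((j.1 * M + u) * y + j.2)%N * g ((j.1 * M + a) * y + j.2 + b)%N).
    move=> /(_ (fun a => mulr_ge0 (F0 _) (g0 _))) h.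
    apply: le_trans (le_trans _ h) _; rewrite le_eqVlt; apply/orP; left; apply/eqP.
      apply: eq_bigr => m _; rewrite mulrA; congr (_ * _); congr g; lia.
    by apply: eq_bigr => a _; rewrite mulrA.
  by apply: interpolation => //; rewrite ?exprn_gt0 ?mulr_ge0 // => a; [exact: F0|exact: g0].
rewrite -mulr_sumr ler_wpM2l //.
apply: le_trans (sum_powR_pair_le _ _ al0 be0) _.
- by lra.
- by lra.
rewrite (part (fun z => F z `^ r)) -/(al _) ler_wpM2l ?powR_ge0 //.
have Gam0 : 0 <= Gam by have := gG 0%N; rewrite big_ord0.
apply: ge0_ler_powR; rewrite ?nnegrE ?invr_ge0 ?(ltW r0) ?sumr_ge0 ?mulr_ge0 //.
(* Each window of length 2 M is two consecutive blocks; for fixed [e] the blocks tile a translate of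
   the whole range. *)
have -> : \sum_j be j = \sum_(e < 2) \sum_(z < K * M * y) g (z + (e * M * y + b))%N `^ r.
  rewrite (eq_bigr (fun e : 'I_2 => \sum_(j : J) \sum_(u < M)
     g ((j.1 * M + u) * y + j.2 + (e * M * y + b))%N `^ r)); last first.
    by move=> e _; rewrite (part (fun z => g (z + (e * M * y + b))%N `^ r)).
  rewrite [RHS]exchange_big /=; apply: eq_bigr => j _.
  rewrite /be (sum_ord_mul (fun a => g ((j.1 * M + a) * y + j.2 + b)%N `^ r)).
  apply: eq_bigr => e _; apply: eq_bigr => u _; congr (g _ `^ _); lia.
apply: (@le_trans _ _ (\sum_(e < 2) Gam)); last first.
  by rewrite sumr_const card_ord mulr_natl.
apply: ler_sum => e _.
exact: (@sum_shift_le (fun t => g t `^ r) _ _ _ (fun t => powR_ge0 _ _) gG).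
Qed.

Definition progression_avg (N y b M : nat) (F : nat -> R) (t : nat) : R :=
  \sum_(m < M) progression_weight N y b m * (if (y * m + b <= t)%N then F (t - (y * m + b))%N else 0).

(* Testing the bilinear form on g = h^(r'-1), where h is the average. *)
Lemma progression_avg_bound (r r' D : R) (N y b M : nat) :
  1 < r -> r' = r / (r - 1) -> 0 <= D -> (0 < y)%N -> (0 < M)%N ->
  (forall (K : nat) (F g : nat -> R) (Gam : R),
  (forall z, 0 <= F z) -> (forall z, 0 <= g z) ->
  (forall n, \sum_(t < n) g t `^ r <= Gam) ->
  \sum_(z < K * M * y) \sum_(m < M) progression_weight N y b m * F z * g (z + y * m + b)%N
   <= D * ((\sum_(z < K * M * y) F z `^ r) `^ r^-1 * (2 * Gam) `^ r^-1)) ->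
  forall (F : nat -> R) (L : nat), (forall z, 0 <= F z) -> (forall z, (L <= z)%N -> F z = 0) ->
  (\sum_(t < L + y * M + b) progression_avg N y b M F t `^ r') `^ r'^-1
    <= 2 * D * (\sum_(z < L) F z `^ r) `^ r^-1.
Proof.
move=> r1 rE D0 y0 M0 HB F L F0 FL; have r0 : 0 < r by lra.
have rr0 : 0 < r' by rewrite rE divr_gt0 // subr_gt0.
set h := progression_avg N y b M F; set L' := (L + y * M + b)%N.
have h0 t : 0 <= h t.
  apply: sumr_ge0 => m _; rewrite mulr_ge0 ?progression_weight_ge0 //; case: ifP => // _; exact: F0.
have hz t : (L' <= t)%N -> h t = 0.
  move=> tL; apply: big1 => m _; case: ifP => [_|_]; last by rewrite mulr0.
  rewrite FL ?mulr0 //.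
  have : (y * m <= y * M)%N by rewrite leq_mul2l ltnW ?orbT.
  by move: tL; rewrite /L'; lia.
pose H := \sum_(t < L') h t `^ r'.
have H0 : 0 <= H by apply: sumr_ge0 => t _; exact: powR_ge0.
pose g t := h t `^ (r' - 1).
(* Since (r' - 1) r = r', the r-th power of g is the r'-th power of h. *)
have gG n : \sum_(t < n) g t `^ r <= H.
  rewrite (eq_bigr (fun t : 'I_n => h t `^ r')); last first.
    move=> t _; rewrite /g -powRrM; congr (_ `^ _); rewrite rE; field; lra.
  have [nL|Ln] := leqP n L'.
    rewrite /H (big_ord_widen _ (fun t => h t `^ r') nL) big_mkcond; apply: ler_sum => t _.
    by case: ifP => // _; exact: powR_ge0.
  rewrite /H (big_ord_widen _ (fun t => h t `^ r') (ltnW Ln)) [leRHS]big_mkcond; apply: ler_sum => t _.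
  by case: ltnP => // Lt; rewrite hz // powR0 // gt_eqF.
have [Hz|Hn] := eqVneq H 0.
  by rewrite -/H Hz powR0 ?invr_eq0 ?gt_eqF // !mulr_ge0 ?powR_ge0.
have Hp : 0 < H by rewrite lt_def Hn.
pose K := L'.
have KL : (L' <= K * M * y)%N by rewrite /K -mulnA leq_pmulr // muln_gt0 M0.
have KL2 : (L <= K * M * y)%N by apply: leq_trans KL; rewrite /L' -addnA leq_addr.
have main := HB K F g H F0 (fun z => powR_ge0 _ _) gG.
have SF : \sum_(z < K * M * y) F z `^ r = \sum_(z < L) F z `^ r.
  rewrite [RHS](big_ord_widen _ (fun t => F t `^ r) KL2) [RHS]big_mkcond; apply: eq_bigr => t _.
  by case: ltnP => // Lt; rewrite FL // powR0 // gt_eqF.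
have lower : H <= \sum_(z < K * M * y) \sum_(m < M)
    progression_weight N y b m * F z * g (z + y * m + b)%N.
  rewrite exchange_big /=.
  have -> : H = \sum_(m < M) \sum_(t < L') progression_weight N y b m *
      (if (y * m + b <= t)%N then F (t - (y * m + b))%N else 0) * g t.
    rewrite exchange_big /=; apply: eq_bigr => t _; rewrite -mulr_suml -[\sum_(m < M) _]/(h t) /g.
    have [->|hn] := eqVneq (h t) 0; first by rewrite mul0r powR0 // gt_eqF.
    have hp : 0 < h t by rewrite lt_def hn h0.
    by rewrite -{2}[h t]powRr1 // -powRD ?hn ?implybT // subrKC.
  apply: ler_sum => m _.
  rewrite (eq_bigr (fun t : 'I_L' => if (y * m + b <= t)%N then
     progression_weight N y b m * F (t - (y * m + b))%N * g t else 0)); last first.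
    by move=> t _; case: ifP => // _; rewrite mulr0 mul0r.
  rewrite -big_mkcond /=.
  have lt (t : 'I_L') : (t - (y * m + b) < K * M * y)%N.
    by apply: leq_trans KL; apply: leq_ltn_trans (ltn_ord t); exact: leq_subr.
  apply: (sum_inj_le (h := fun t : 'I_L' => Ordinal (lt t))) => //.
  - move=> t t' ht ht' /(congr1 val) /= e; apply/val_inj => /=.
    by rewrite -(subnK ht) -(subnK ht') e.
  - by move=> t ht /=; rewrite -addnA subnK.
  by move=> z _; rewrite !mulr_ge0 ?progression_weight_ge0 ?powR_ge0.
have := le_trans lower main; rewrite SF -/H; set S := (\sum_(z < L) _) `^ _.
have S0 : 0 <= S by exact: powR_ge0.
rewrite powRM ?(ltW Hp) // => hh.
(* By 1/r + 1/r' = 1, dividing the duality bound by the positive H^(1/r) leaves the norm of h; the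
   remaining 2^(1/r) is at most 2. *)
have HE : H = H `^ r'^-1 * H `^ r^-1.
  rewrite -powRD ?Hn ?implybT // -[LHS]powRr1 ?(ltW Hp) //; congr (_ `^ _).
  by rewrite rE; field; lra.
have hr0 : 0 < H `^ r^-1 by exact: powR_gt0.
rewrite -(ler_pM2r hr0) -HE; apply: le_trans hh _.
rewrite [leRHS](_ : _ = D * (S * (2 * H `^ r^-1))); last by ring.
rewrite ler_wpM2l // ler_wpM2l // ler_wpM2r ?(ltW hr0) //.
rewrite -[leRHS]powRr1 // ler_powR ?ler1n //.
by rewrite invf_le1 // ltW.
Qed.

End GlobalBound.

(** * Norms on the integers *)

Section IntegerNorms.
Variable R : realType.
Local Notation normc := ComplexField.Normc.normc.

Lemma normc_ge0 (x : R[i]) : 0 <= normc x.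
Proof. by case: x => a b; exact: sqrtr_ge0. Qed.

Lemma normc_sum_le (T : Type) (s : seq T) (P : pred T) (F : T -> R[i]) :
  normc (\sum_(i <- s | P i) F i) <= \sum_(i <- s | P i) normc (F i).
Proof.
elim/big_ind2: _ => [|x a y b xa yb|//]; first by rewrite ComplexField.Normc.normc0.
by apply: le_trans (le_normcD _ _) _; apply: lerD.
Qed.

Lemma normcZ (a : R) (x : R[i]) : 0 <= a -> normc (a%:C%C * x) = a * normc x.
Proof.
move=> a0; rewrite ComplexField.Normc.normcM; congr (_ * _).
by rewrite /= expr0n /= addr0 sqrtr_sqr ger0_norm.
Qed.

Lemma esum_window (F : int -> R) (B L : nat) : (forall x, 0 <= F x) ->
  (forall x, F x != 0 -> exists2 t : nat, (t < L)%N & x = Posz t - Posz B) ->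
  \esum_(x in [set: int]) (F x)%:E = (\sum_(t < L) F (Posz t - Posz B))%:E.
Proof.
move=> F0 FB; pose e (t : nat) : int := Posz t - Posz B.
have einj : injective e by move=> t t'; rewrite /e => /addIr [].
transitivity (\esum_(x in [set e t | t in `I_L]%classic) (F x)%:E).
  rewrite [RHS]esum_mkcond; apply: eq_esum => x _; case: ifPn => // xI.
  apply/eqP; rewrite eqe; apply: contraNT xI => /FB [t tL ->].
  by apply: classical_sets.mem_set; exists t.
rewrite esum_image; last by move=> t t' _ _; exact: einj.
rewrite esum_fset //; last by move=> t _; rewrite lee_fin.
by rewrite -fsbig_ord sumEFin.
Qed.

Lemma finitely_supported_bound (f : int -> R[i]) : finitely_supported f ->
  exists B : nat, forall x, f x != 0 -> (- Posz B <= x <= Posz B)%R.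
Proof.
move=> /finite_seqP [s sE]; exists (\max_(x <- s) `|x|%N)%N => x fx.
have xs : x \in s.
  by have : [set x | f x != 0]%classic x by []; rewrite sE.
by have : (`|x|%N <= \max_(x <- s) `|x|%N)%N; [exact: leq_bigmax_seq|lia].
Qed.

End IntegerNorms.

Section ProgressionAverage.
Variable R : realType.
Local Notation normc := ComplexField.Normc.normc.

Lemma normc_Aavg_le (N y b M B : nat) (f : int -> R[i]) (t : nat) :
  (0 < y)%N -> (0 < b <= y)%N -> (N <= y * M)%N ->
  (forall x, f x != 0 -> (- Posz B <= x <= Posz B)%R) ->
  normc (Aavg N y b f (Posz t - Posz B))
   <= progression_avg N y b M (fun z => normc (f (Posz z - Posz B))) t.
Proof.
move=> y0 /andP[b0 by_] NyM fB.
have c0 : 0 <= (totient y)%:R / N%:R :> R by rewrite divr_ge0.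
rewrite /Aavg normcZ //; apply: le_trans (ler_wpM2l c0 (normc_sum_le _ _ _)) _.
rewrite mulr_sumr big_geq_mkord.
have nE (n : 'I_N) : (n %% y == b %% y)%N && (0 < n)%N ->
    (b <= n)%N /\ (n = b + y * ((n - b) %/ y) :> nat)%N.
  (* As 0 < b <= y, b is the least positive member of its class. The case b = y is separate because
     its residue is 0. *)
  move=> /andP[nb n0]; have bn : (b <= n)%N.
    move: by_; rewrite leq_eqVlt => /orP[/eqP bE|bly].
      rewrite bE; apply: dvdn_leq => //; move: nb; rewrite bE modnn.
      by rewrite /dvdn.
    by rewrite -(modn_small bly) -(eqP nb) leq_mod.
  split=> //; rewrite mulnC divnK ?subnKC //.
  by rewrite -eqn_mod_dvd.
have mM (n : 'I_N) : ((n - b) %/ y < M)%N.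
  rewrite ltn_divLR // mulnC; apply: leq_trans NyM; apply: leq_ltn_trans (ltn_ord n).
  exact: leq_subr.
apply: (sum_inj_le (h := fun n : 'I_N => Ordinal (mM n))) => //.
- move=> n n' /nE[bn ne] /nE[bn' ne'] /(congr1 val) /= e.
  by apply/val_inj => /=; rewrite ne ne' e.
- move=> n /nE[bn ne] /=; set m := ((n - b) %/ y)%N in ne *.
  rewrite /progression_weight -ne ltn_ord normcZ ?vonMangoldt_ge0 // [(y * m + b)%N]addnC -ne.
  rewrite mulrA ler_wpM2l ?mulr_ge0 ?vonMangoldt_ge0 //; case: leqP => nt.
    by rewrite (_ : Posz t - Posz B - Posz n = Posz (t - n) - Posz B) //; lia.
  rewrite [X in normc X](_ : _ = 0) ?ComplexField.Normc.normc0 //.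
  by apply/eqP; apply: contraTT isT => /fB; lia.
move=> m _; rewrite mulr_ge0 ?progression_weight_ge0 //; case: ifP => // _; exact: normc_ge0.
Qed.

Lemma Aavg_support (N y b B : nat) (f : int -> R[i]) (x : int) :
  (forall x, f x != 0 -> (- Posz B <= x <= Posz B)%R) ->
  Aavg N y b f x != 0 -> (- Posz B <= x <= Posz B + Posz N)%R.
Proof.
move=> fB Ax; apply/negP => nx; move/negP: Ax; apply; apply/eqP.
rewrite /Aavg big_nat_cond big1 ?mulr0 // => n /andP[/andP[n1 nN] _].
rewrite [f _](_ : _ = 0) ?mulr0 //; apply/eqP; apply: contraT => /fB h.
by case: nx; lia.
Qed.

(** Translation by B moves the support [-B, B] into the natural numbers, and the average then lives
    on a window of length L + y M + b. *)
Lemma lpnorm_Aavg_le (r r' D : R) (N y b M : nat) (f : int -> R[i]) :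
  1 < r -> r' = r / (r - 1) -> 0 <= D -> (0 < y)%N -> (0 < b <= y)%N -> (0 < M)%N ->
  (N <= y * M)%N ->
  (forall (F : nat -> R) (L : nat), (forall z, 0 <= F z) -> (forall z, (L <= z)%N -> F z = 0) ->
    (\sum_(t < L + y * M + b) progression_avg N y b M F t `^ r') `^ r'^-1
    <= D * (\sum_(z < L) F z `^ r) `^ r^-1) ->
  finitely_supported f -> lpnorm r' (Aavg N y b f) <= D * lpnorm r f.
Proof.
move=> r1 rE D0 y0 byb M0 NyM HB /finitely_supported_bound [B fB].
have r0 : 0 < r by lra.
have rr0 : 0 < r' by rewrite rE divr_gt0 // subr_gt0.
pose F z := normc (f (Posz z - Posz B)); pose L := (2 * B).+1.
have F0 z : 0 <= F z by exact: normc_ge0.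
have FL z : (L <= z)%N -> F z = 0.
  move=> Lz; rewrite /F [f _](_ : _ = 0) ?ComplexField.Normc.normc0 //.
  by apply/eqP; apply: contraT => /fB; rewrite /L in Lz; lia.
(* The convention 0^0 = 1 for [powR] forces the alternative q = 0, ruled out later as both exponents
   are positive. *)
have pw (q : R) (x : R[i]) : normc x `^ q != 0 -> x != 0 \/ q = 0.
  move=> xq; case: (eqVneq q 0) => [|qn]; first by right.
  by left; apply: contra_neq xq => ->; rewrite ComplexField.Normc.normc0 powR0.
have -> : lpnorm r f = (\sum_(z < L) F z `^ r) `^ r^-1.
  rewrite /lpnorm (@esum_window _ (fun x => normc (f x) `^ r) B L) //.
    by move=> x; exact: powR_ge0.
  move=> x /pw [/fB xB|rz]; last by move: r0; rewrite rz ltxx.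
  by exists (absz (x + Posz B)); rewrite /L; lia.
apply: le_trans (HB F L F0 FL).
rewrite /lpnorm (@esum_window _ (fun x => normc (Aavg N y b f x) `^ r') B (L + y * M + b)).
- rewrite /=; apply: ge0_ler_powR.
  + by rewrite invr_ge0 ltW.
  + by rewrite nnegrE sumr_ge0 // => t _; exact: powR_ge0.
  + by rewrite nnegrE sumr_ge0 // => t _; exact: powR_ge0.
  apply: ler_sum => t _; apply: ge0_ler_powR; rewrite ?nnegrE ?normc_ge0 ?(ltW rr0) //.
    by apply: le_trans (normc_Aavg_le t y0 byb NyM fB); exact: normc_ge0.
  exact: normc_Aavg_le.
- by move=> x; exact: powR_ge0.
move=> x /pw [/(Aavg_support fB) xB|rz]; last by move: rr0; rewrite rz ltxx.
by exists (absz (x + Posz B)); rewrite /L; lia.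
Qed.

End ProgressionAverage.

(** * Choice of the exponents and of the constants *)

Theorem theorem1p1 (R : realType) (r : R) (hr1 : 1 < r) (hr2 : r < 2) :
  let r' := r / (r - 1) in
  exists Cr : R, 0 < Cr /\
  forall delta : R, 0 < delta ->
  exists Crd : R, 0 < Crd /\
  forall y : nat, (1 <= y)%N ->
  forall N : nat, (y <= N)%N -> expR (Crd * (y%:R `^ delta)) < N%:R ->
  forall f : int -> R[i], finitely_supported f ->
  forall b : nat, (1 <= b <= y)%N -> coprime b y ->
    lpnorm r' (Aavg N y b f)
      <= Cr * ((y%:R / N%:R) `^ (r^-1 - r'^-1)) * lpnorm r f.
Proof.
move=> r'; have r0 : 0 < r by lra.
have rho1 : 2^-1 < r^-1 by rewrite ltf_pV2 ?posrE.
have rho2 : r^-1 < 1 by rewrite invf_lt1.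
(* Half the distance from 1/r to the nearer end of [1/2, 1], so both perturbed exponents stay
   strictly inside. *)
pose eta := Num.min (r^-1 - 2^-1) (1 - r^-1) / 2.
have eta0 : 0 < eta by rewrite divr_gt0 // lt_min; apply/andP; split; lra.
have eta1 : eta <= (r^-1 - 2^-1) / 2 by rewrite ler_pM2r ?invr_gt0 // ge_min lexx.
have eta2 : eta <= (1 - r^-1) / 2 by rewrite ler_pM2r ?invr_gt0 // ge_min lexx orbT.
clearbody eta.
have e1 : 2^-1 <= r^-1 - eta by lra.
have e2 : r^-1 + eta < 1 by lra.
have [C1 [N1 [C10 H1]]] := @prime_kernel_bound R (r^-1 - eta) ltac:(lra) ltac:(lra).
have [C2 [N2 [C20 H2]]] := @prime_kernel_bound R (r^-1 + eta) ltac:(lra) ltac:(lra).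
pose Ci := interp_const r eta.
have Ci0 : 0 < Ci.
  have : 1 `^ (r * eta) < 2 `^ (r * eta) :> R.
    by apply: gt0_ltr_powR; rewrite ?mulr_gt0 ?nnegrE ?ltr1n.
  rewrite powR1 => th; have th0 := lt_trans ltr01 th.
  by rewrite /Ci /interp_const mulr_gt0 // divr_gt0 ?mulr_gt0 // subr_gt0.
exists (2 * (Ci * (C1 + C2))); split; first by rewrite mulr_gt0 // mulr_gt0 // addr_gt0.
(* The first two terms force N past both thresholds, by exp t >= 1 + t. The third gives y^2 <= N,
   because 2 ln y <= (2 / delta) y^delta. *)
move=> delta d0; exists (`|N1| + `|N2| + 2 / delta); split.
  by rewrite ltr_wpDl ?addr_ge0 // divr_gt0.
move=> y y1 N yN NN f fs b byb cop.
have yd : 1 <= (y%:R : R) `^ delta by apply: powR_ge1; rewrite ?ler1n // ltW.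
have yd2 : 2 * ln (y%:R : R) <= 2 / delta * y%:R `^ delta.
  rewrite -mulrA ler_wpM2l // ler_pdivlMl // -ln_powR.
  by apply: le_trans (ln_le_subr1 (lt_le_trans ltr01 yd)) _; rewrite gerBl.
have n1 := normr_ge0 N1; have n2 := normr_ge0 N2; have m1 := ler_norm N1; have m2 := ler_norm N2.
have big : `|N1| + `|N2| + 2 * ln (y%:R : R) <= (`|N1| + `|N2| + 2 / delta) * y%:R `^ delta.
  by rewrite [leRHS]mulrDl lerD // ler_peMr // addr_ge0.
have ly0 : 0 <= ln (y%:R : R) by rewrite ln_ge0 // ler1n.
have exb c : c <= `|N1| + `|N2| + 2 * ln (y%:R : R) -> expR c <= N%:R.
  by move=> h; apply: le_trans (ltW NN); rewrite ler_expR (le_trans h).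
have NN1 : N1 <= N%:R.
  by apply: le_trans (exb N1 _); [have := expR_ge1Dx N1; lra|lra].
have NN2 : N2 <= N%:R.
  by apply: le_trans (exb N2 _); [have := expR_ge1Dx N2; lra|lra].
have yN2 : (y ^ 2 <= N)%N.
  rewrite -(ler_nat R) natrX; apply: le_trans (exb (2 * ln y%:R) _); last by lra.
  by rewrite expRM_natl lnK // posrE ltr0n.
pose M := (N %/ y).+1.
have NyM : (N <= y * M)%N by rewrite mulnC ltnW // ltn_ceil.
have yMN : (y * M <= 2 * N)%N.
  by rewrite /M mulnS mul2n -addnn leq_add // mulnC leq_trunc_div.
have MR : 0 < M%:R :> R by rewrite ltr0n.
have /andP[b0 _] := byb.
pose D := Ci * ((C1 + C2) * M%:R) * (M%:R ^+ 2) `^ (- r^-1).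
have C120 : 0 <= C1 + C2 by rewrite addr_ge0 // ltW.
have D0 : 0 <= D.
  by rewrite mulr_ge0 ?powR_ge0 // mulr_ge0 ?(ltW Ci0) // mulr_ge0.
have HK (X : {set 'I_M}) (Y : {set 'I_(2 * M)}) s : s = r^-1 - eta \/ s = r^-1 + eta ->
    \sum_(u in X) \sum_(a in Y) prime_kernel R N y b u a
     <= (C1 + C2) * M%:R * (#|X|%:R * #|Y|%:R / M%:R ^+ 2) `^ s.
  case=> ->.
    apply: le_trans (H1 N y b M y1 b0 NN1 yN2 NyM yMN X Y) _.
    by rewrite ler_wpM2r ?powR_ge0 // ler_wpM2r // lerDl ltW.
  apply: le_trans (H2 N y b M y1 b0 NN2 yN2 NyM yMN X Y) _.
  by rewrite ler_wpM2r ?powR_ge0 // ler_wpM2r // lerDr ltW.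
have HG := bilinear_global hr1 hr2 eta0 e1 (ltW e2) C120 (ltn0Sn _) HK.
have HP := progression_avg_bound hr1 (erefl r') D0 y1 (ltn0Sn _) HG.
have := lpnorm_Aavg_le hr1 (erefl r') (mulr_ge0 (ler0n _ 2) D0) y1 byb (ltn0Sn _) NyM HP fs.
move=> h; apply: le_trans h _; rewrite ler_wpM2r ?powR_ge0 //.
rewrite /D; move: (Ci) (ltW Ci0) => ci ci0.
rewrite -!mulrA ler_wpM2l // ler_wpM2l // ler_wpM2l //.
have -> : r^-1 - r'^-1 = 2 * r^-1 - 1.
  by rewrite /r'; field; apply/andP; split; lra.
(* The set bound carries M (M^2)^(-1/r) = M^-(2/r - 1), and 2/r - 1 is exactly 1/r - 1/r'. The gain
   in y / N then follows from N <= y M. *)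
have -> : M%:R * (M%:R ^+ 2) `^ (- r^-1) = (M%:R^-1) `^ (2 * r^-1 - 1) :> R.
  rewrite -[M%:R^-1]powR_inv1 // -powRrM -[M%:R ^+ 2]powR_mulrn // -powRrM.
  rewrite -{1}[M%:R]powRr1 // -powRD.
    by congr (_ `^ _); ring.
  by rewrite pnatr_eq0 implybT.
have Np : 0 < N%:R :> R by rewrite ltr0n (leq_trans y1).
apply: ge0_ler_powR; rewrite ?nnegrE ?invr_ge0 ?divr_ge0 //; first by lra.
by rewrite ler_pdivlMr // mulrC ler_pdivrMr // -natrM ler_nat.
Qed.
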